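(* Let $d\ge 3$ and let a planar $d$-web be given by differential $1$-forms $\omega_1,\dots,\omega_d$ normalized by $a_i\omega_1+\omega_2+\omega_{i+2}=0$ for $i=1,\dots,d-2$, with $a_1=1$ and $d\omega_3=0$. Let $\mathfrak{A}_{d-2}$ be the $(d-3)$-rd prolongation (living in the $(d-2)$-jets) of the abelian equation of the web, and let $$\varkappa=\square_1u_1+\cdots+\square_{d-2}u_{d-2},$$ where $$\square_i=\Delta_1\cdots\Delta_{d-2}\cdot\delta_1-\Delta_1\cdots\Delta_{i-1}\cdot\delta_1\cdot\Delta_{i+1}\cdots\Delta_{d-2}\cdot\Delta_i ,\qquad i=1,\dots,d-2,$$ regarded as a function on $(d-2)$-jets. Then the $d$-web is of maximum rank, i.e. of rank $\frac{(d-1)(d-2)}{2}$, if and only if $\varkappa=0$ on $\mathfrak{A}_{d-2}$.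
   Context: Everything is local (on a sufficiently small neighbourhood of a point in $\mathbb{R}^2$), real and $C^\infty$. A planar $d$-web is a collection of $d$ one-dimensional foliations of a plane domain in general position (directions of different foliations are distinct at each point). It can be given by nowhere vanishing $1$-forms $\omega_1,\dots,\omega_d$, the $i$-th foliation being $\omega_i=0$; each $\omega_i$ may be multiplied by a nonvanishing function, and the forms can always be normalized so that $a_i\omega_1+\omega_2+\omega_{i+2}=0$ for $i=1,\dots,d-2$ and $d\omega_3=0$, with functions $a_1=1$ and $a_i\ne 0,1$ for $i\ge2$ (the basic invariants). Chern connection: there is a unique $1$-form $\gamma$ with $d\omega_i=\omega_i\wedge\gamma$ for $i=1,2,3$. Write $\gamma=g_1\omega_1+g_2\omega_2$ and let $\partial_1,\partial_2$ be the frame dual to $\omega_1,\omega_2$. For a function $u$ assigned weight $k$, set $\delta_i(u)=\delta_i^{(k)}(u)=\partial_i(u)-k\,g_i\,u$ for $i=1,2$; $\delta_i(u)$ has weight $k+1$. Compositions of the $\delta_i$ use the corresponding weights. The functions $a_i$ have weight $0$. Abelian equation and rank: the abelian equation of the web is the system $\lambda_1\omega_1+\cdots+\lambda_d\omega_d=0$, $d(\lambda_1\omega_1)=\cdots=d(\lambda_d\omega_d)=0$ for functions $\lambda_1,\dots,\lambda_d$. The rank of the web is the dimension of its (local) solution space; it never exceeds $(d-1)(d-2)/2$. Put $u_1=\lambda_3,\dots,u_{d-2}=\lambda_d$ (functions of weight $1$); then $\lambda_1=\sum_i a_iu_i$, $\lambda_2=\sum_i u_i$, and the abelian equation is equivalent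 to $$\Delta_1(u_1)=\cdots=\Delta_{d-2}(u_{d-2})=0,\qquad \delta_1(u_1)+\cdots+\delta_1(u_{d-2})=0,$$ where $\Delta_i=\delta_1-\delta_2\circ a_i$, i.e. $\Delta_i(u)=\delta_1(u)-\delta_2(a_iu)$. Jets: let $\pi:\mathbb{R}^{d-2}\times\mathbb{R}^2\to\mathbb{R}^2$ be the trivial bundle with fibre coordinates $u_1,\dots,u_{d-2}$, and let $\mathbf{J}^k(\pi)$ be its bundle of $k$-jets. $\mathfrak{A}_1\subset\mathbf{J}^1(\pi)$ is the subbundle defined by the first-order system $\Delta_1(u_1)=\cdots=\Delta_{d-2}(u_{d-2})=0$, $\delta_1(u_1)+\cdots+\delta_1(u_{d-2})=0$, and $\mathfrak{A}_k\subset\mathbf{J}^k(\pi)$ is its $(k-1)$-prolongation, i.e. the set of $k$-jets satisfying this system and all of its total derivatives up to order $k-1$ (for $d=3$, $\mathfrak{A}_{d-2}=\mathfrak{A}_1$). Products of operators in $\square_i$ denote composition. The operators $\square_i$ are linear differential operators of order at most $d-2$, so $\varkappa$ defines a function on $\mathbf{J}^{d-2}(\pi)$, linear on the fibres over $\mathbb{R}^2$, which is restricted to $\mathfrak{A}_{d-2}$. *)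

(* Defs.v *)
From Stdlib Require Import Reals List Arith.
From Coquelicot Require Import Coquelicot.
Open Scope R_scope.

(* Planar d-webs are studied on an open set D of the plane with coordinates
   (x, y).  Functions on D are total functions R -> R -> R of which only the
   values on D matter.  Families are indexed by nat from 1 on, as in
   omega_1, ..., omega_d; members with index out of range are never read. *)

Definition smooth_at (f : R -> R -> R) (x y : R) : Prop :=
  forall n : nat, ex_diff_n f n x y.

(* The 1-form  dx_coef dx + dy_coef dy. *)
Record one_form := OneForm { dx_coef : R -> R -> R; dy_coef : R -> R -> R }.

Definition smooth_form_at (w : one_form) (x y : R) : Prop :=
  smooth_at (dx_coef w) x y /\ smooth_at (dy_coef w) x y.

Definition d_fun (f : R -> R -> R) : one_form :=
  OneForm (partial_derive 1 0 f) (partial_derive 0 1 f).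

Definition form_scale (f : R -> R -> R) (w : one_form) : one_form :=
  OneForm (fun x y => f x y * dx_coef w x y) (fun x y => f x y * dy_coef w x y).

(* 2-forms are identified with their coefficient of dx /\ dy. *)
Definition wedge (v w : one_form) (x y : R) : R :=
  dx_coef v x y * dy_coef w x y - dy_coef v x y * dx_coef w x y.

Definition d_form (w : one_form) (x y : R) : R :=
  partial_derive 1 0 (dy_coef w) x y - partial_derive 0 1 (dx_coef w) x y.

Definition is_web (d : nat) (D : R * R -> Prop) (om : nat -> one_form) : Prop :=
  forall x y, D (x, y) ->
    (forall i, (1 <= i <= d)%nat ->
       smooth_form_at (om i) x y /\
       (dx_coef (om i) x y <> 0 \/ dy_coef (om i) x y <> 0)) /\
    (forall i j, (1 <= i <= d)%nat -> (1 <= j <= d)%nat -> i <> j ->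
       wedge (om i) (om j) x y <> 0).

(* a_i <> 0, 1 for i >= 2 is a consequence of [is_web] and [is_normalized]. *)
Definition is_normalized (d : nat) (D : R * R -> Prop) (om : nat -> one_form)
    (a : nat -> R -> R -> R) : Prop :=
  forall x y, D (x, y) ->
    (forall i, (1 <= i <= d - 2)%nat ->
       smooth_at (a i) x y /\
       a i x y * dx_coef (om 1%nat) x y + dx_coef (om 2%nat) x y
         + dx_coef (om (i + 2)%nat) x y = 0 /\
       a i x y * dy_coef (om 1%nat) x y + dy_coef (om 2%nat) x y
         + dy_coef (om (i + 2)%nat) x y = 0) /\
    a 1%nat x y = 1 /\
    d_form (om 3%nat) x y = 0.

Definition is_chern_connection (D : R * R -> Prop) (om : nat -> one_form)
    (gam : one_form) : Prop :=
  forall x y, D (x, y) ->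
    smooth_form_at gam x y /\
    (forall i, (1 <= i <= 3)%nat -> d_form (om i) x y = wedge (om i) gam x y).

(* [coef1] and [coef2] are the coefficients in
     alpha = coef1 omega_1 + coef2 omega_2
   obtained by Cramer's rule.  For alpha = du they are partial_1 u and
   partial_2 u in the frame dual to omega_1, omega_2; for alpha = gamma they
   are g_1 and g_2. *)
Definition coef1 (om : nat -> one_form) (alpha : one_form) (x y : R) : R :=
  wedge alpha (om 2%nat) x y / wedge (om 1%nat) (om 2%nat) x y.

Definition coef2 (om : nat -> one_form) (alpha : one_form) (x y : R) : R :=
  wedge (om 1%nat) alpha x y / wedge (om 1%nat) (om 2%nat) x y.

(* A weighted operator takes the weight k of its argument; its value has
   weight k + 1. *)
Definition wop := nat -> (R -> R -> R) -> R -> R -> R.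

Definition delta_1 (om : nat -> one_form) (gam : one_form) : wop :=
  fun k u x y => coef1 om (d_fun u) x y - INR k * coef1 om gam x y * u x y.

Definition delta_2 (om : nat -> one_form) (gam : one_form) : wop :=
  fun k u x y => coef2 om (d_fun u) x y - INR k * coef2 om gam x y * u x y.

Definition Delta_op (om : nat -> one_form) (a : nat -> R -> R -> R) (gam : one_form)
    (i : nat) : wop :=
  fun k u x y =>
    delta_1 om gam k u x y
    - delta_2 om gam k (fun x' y' => a i x' y' * u x' y') x y.

(* Composition A_1 ... A_n of a list of operators (the last one acts first)
   applied to a function of weight k. *)
Fixpoint wcompose (l : list wop) (k : nat) (u : R -> R -> R) : R -> R -> R :=
  match l with
  | nil => u
  | A :: l' => A (k + length l')%nat (wcompose l' k u)
  end.

(* [seq m n] is the list m, m + 1, ..., m + n - 1. *)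
Definition box (d : nat) (om : nat -> one_form) (a : nat -> R -> R -> R)
    (gam : one_form) (i : nat) (u : R -> R -> R) (x y : R) : R :=
  let De := Delta_op om a gam in
  let de1 := delta_1 om gam in
  wcompose (map De (seq 1 (d - 2)) ++ de1 :: nil) 1%nat u x y
  - wcompose (map De (seq 1 (i - 1)) ++ de1 :: nil
             ++ map De (seq (i + 1) (d - 2 - i)) ++ De i :: nil) 1%nat u x y.

(* Sections of the trivial bundle pi, as families u_1, ..., u_{d-2}. *)
Definition section := nat -> R -> R -> R.

Definition kappa (d : nat) (om : nat -> one_form) (a : nat -> R -> R -> R)
    (gam : one_form) (u : section) (x y : R) : R :=
  sum_n_m (fun i => box d om a gam i (u i) x y) 1 (d - 2).

(* A k-jet of sections of pi: its base point and the values
     jet_u i m n = (d/dx)^m (d/dy)^n u_i,   1 <= i <= d - 2,  m + n <= k;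
   the other entries of jet_u are irrelevant. *)
Record jet := Jet { jet_x : R; jet_y : R; jet_u : nat -> nat -> nat -> R }.

(* The Taylor polynomials of degree k form a section with the given k-jet. *)
Definition jet_section (k : nat) (th : jet) : section :=
  fun i x y =>
    sum_n (fun m => sum_n (fun n =>
      jet_u th i m n / (INR (fact m) * INR (fact n))
      * (x - jet_x th) ^ m * (y - jet_y th) ^ n) (k - m)) k.

(* The function on k-jets defined by a differential operator P of order at
   most k:  the k-jet of u at (x, y) is sent to P(u)(x, y).  This does not
   depend on the section representing the jet. *)
Definition jet_fun (k : nat) (P : section -> R -> R -> R) (th : jet) : R :=
  P (jet_section k th) (jet_x th) (jet_y th).

(* The (k-1)-prolongation A_k of the abelian equation (k >= 1).  The total
   derivative (D_x)^m (D_y)^n of the function on jets defined by an operator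
   P is the function defined by (d/dx)^m (d/dy)^n o P. *)
Definition prolongation (d : nat) (om : nat -> one_form)
    (a : nat -> R -> R -> R) (gam : one_form) (k : nat) (th : jet) : Prop :=
  forall m n, (m + n <= k - 1)%nat ->
    (forall i, (1 <= i <= d - 2)%nat ->
       jet_fun k
         (fun u => partial_derive m n (Delta_op om a gam i 1%nat (u i))) th = 0) /\
    jet_fun k
      (fun u => partial_derive m n
         (fun x y => sum_n_m (fun i => delta_1 om gam 1%nat (u i) x y) 1 (d - 2)))
      th = 0.

(* lam_1, ..., lam_d is a solution of the abelian equation on some
   neighbourhood of (x0, y0). *)
Definition abelian_solution (d : nat) (om : nat -> one_form) (x0 y0 : R)
    (lam : nat -> R -> R -> R) : Prop :=
  locally_2d (fun x y =>
    (forall i, (1 <= i <= d)%nat -> smooth_at (lam i) x y) /\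
    sum_n_m (fun i => lam i x y * dx_coef (om i) x y) 1 d = 0 /\
    sum_n_m (fun i => lam i x y * dy_coef (om i) x y) 1 d = 0 /\
    (forall i, (1 <= i <= d)%nat -> d_form (form_scale (lam i) (om i)) x y = 0)) x0 y0.

(* The vector space of germs at (x0, y0) of solutions of the abelian equation
   has dimension r:  s_1, ..., s_r below is a basis of it. *)
Definition has_rank (d : nat) (om : nat -> one_form) (x0 y0 : R) (r : nat)
    : Prop :=
  exists s : nat -> nat -> R -> R -> R,
    (forall j, (1 <= j <= r)%nat -> abelian_solution d om x0 y0 (s j)) /\
    (forall c : nat -> R,
       locally_2d (fun x y => forall i, (1 <= i <= d)%nat ->
         sum_n_m (fun j => c j * s j i x y) 1 r = 0) x0 y0 ->
       forall j, (1 <= j <= r)%nat -> c j = 0) /\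
    (forall lam, abelian_solution d om x0 y0 lam ->
       exists c : nat -> R,
       locally_2d (fun x y => forall i, (1 <= i <= d)%nat ->
         lam i x y = sum_n_m (fun j => c j * s j i x y) 1 r) x0 y0).

(* Main.v *)
Require Import Defs.
From Stdlib Require Import Reals List Arith Lra Lia Permutation.
From Stdlib Require Import FunctionalExtensionality ClassicalEpsilon ProofIrrelevance.
From Coquelicot Require Import Coquelicot.
From HB Require Import structures.
From mathcomp Require all_boot all_algebra ring zify boolp Rstruct.
Open Scope R_scope.

(* Write n = d - 2 and say that an operator P = sum_m P_m(u_m) belongs to the
   symbol module if every P_m is a polynomial in d_2 with function coefficients:
   modulo the equations Delta_m u_m = 0, which express d_1 u_m through d_2 u_m
   and u_m, every operator takes this form.  The total derivatives of order < k
   of the remaining equation span a submodule C_k.  Triangularity of the symbols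
   prod_l (a_m - a_l) shows that, for k <= n, every operator of order <= k is
   congruent modulo C_k to exactly one that involves only the n(n+1)/2 "free"
   derivatives d_2^l u_m with l <= m (indices from 0).  In order n + 1 there is
   one generator left over, W = (d_1 - a_n d_2)...(d_1 - a_1 d_2) applied to the
   last equation, and it has order n only.  Since a composition of first-order
   operators depends on the order of its factors and on their zeroth-order terms
   only up to lower order, kappa coincides with W on A_n.

   If kappa = 0 on A_n then, jets of solutions with arbitrary free derivatives
   existing, W lies in C_n, so no nonzero free operator lies in C_{n+1}; this says that the
   connection on the trivial bundle of free derivatives which is obtained by
   reducing their first derivatives modulo C_{n+1} is flat.  Its parallel
   sections, found by solving linear ordinary differential equations, are the
   solutions.  Conversely, a solution is determined by its free derivatives at
   any point, so at maximum rank they can be prescribed arbitrarily; hence every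
   jet in A_n is the n-jet of a solution, and kappa = W vanishes on solutions. *)

(** * Smooth functions of two variables *)

(** The count behind the overview: the last equation has k derivatives of order k - 1, each with one
    symbol coefficient per unknown. For k <= n they can be solved for the top [d2]-derivatives of
    the first k unknowns, which leaves n - k free ones in order k. In order n + 1 there are n + 1
    derivatives for n unknowns, so one combination drops in order: a single obstruction. The
    elimination is linear algebra over the ring of smooth functions on a square, where the a_i,
    their differences and the frame determinant are units; no rank at a point is ever discussed. A
    jet enters as a family of functions up to vanishing to a given order at a point. Such families
    satisfy the equations to finite order only, so the lemmas must record how many orders each
    operator costs. The main obstacle is the passage from points to functions: kappa is tested jet
    by jet, while flatness is an identity of functions. It is bridged by formal solutions
    constructed at each point, before any actual solution is known, on which each coefficient of the
    normal form of W can be read off. *)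

Definition pdx (f : R -> R -> R) : R -> R -> R := fun x y => Derive (fun t => f t y) x.
Definition pdy (f : R -> R -> R) : R -> R -> R := fun x y => Derive (fun t => f x t) y.

Definition smooth_on (D : R * R -> Prop) (f : R -> R -> R) : Prop :=
  forall x y, D (x, y) -> smooth_at f x y.

Lemma open_locally_2d (D : R * R -> Prop) x y :
  open D -> D (x, y) -> locally_2d (fun u v => D (u, v)) x y.
Proof.
  intros oD Dxy. apply locally_2d_locally.
  apply filter_imp with (2 := oD _ Dxy). now intros [u v].
Qed.

Lemma open_locally_x (D : R * R -> Prop) x y :
  open D -> D (x, y) -> locally x (fun t => D (t, y)).
Proof.
  intros oD Dxy. destruct (open_locally_2d D x y oD Dxy) as [del Hd].
  exists del. intros t Ht. apply Hd; [exact Ht|].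
  rewrite Rminus_diag, Rabs_R0. apply cond_pos.
Qed.

Lemma open_locally_y (D : R * R -> Prop) x y :
  open D -> D (x, y) -> locally y (fun t => D (x, t)).
Proof.
  intros oD Dxy. destruct (open_locally_2d D x y oD Dxy) as [del Hd].
  exists del. intros t Ht. apply Hd; [|exact Ht].
  rewrite Rminus_diag, Rabs_R0. apply cond_pos.
Qed.

Section Smooth.
Variable D : R * R -> Prop.
Hypothesis oD : open D.

Lemma smooth_on_pdx f : smooth_on D f -> smooth_on D (pdx f).
Proof. intros Hf x y Dxy n. exact (proj1 (proj2 (proj2 (proj2 (Hf x y Dxy (S n)))))). Qed.

Lemma smooth_on_pdy f : smooth_on D f -> smooth_on D (pdy f).
Proof. intros Hf x y Dxy n. exact (proj2 (proj2 (proj2 (proj2 (Hf x y Dxy (S n)))))). Qed.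

Lemma smooth_on_cont f x y : smooth_on D f -> D (x, y) -> continuity_2d_pt f x y.
Proof. intros Hf Dxy. exact (proj1 (Hf x y Dxy O)). Qed.

Lemma smooth_on_ex_x f x y : smooth_on D f -> D (x, y) -> ex_derive (fun t => f t y) x.
Proof. intros Hf Dxy. exact (proj1 (proj2 (Hf x y Dxy 1%nat))). Qed.

Lemma smooth_on_ex_y f x y : smooth_on D f -> D (x, y) -> ex_derive (fun t => f x t) y.
Proof. intros Hf Dxy. exact (proj1 (proj2 (proj2 (Hf x y Dxy 1%nat)))). Qed.

Definition eq_on (f g : R -> R -> R) := forall x y, D (x, y) -> f x y = g x y.

Lemma eq_on_locally f g x y : eq_on f g -> D (x, y) ->
  locally_2d (fun u v => f u v = g u v) x y.
Proof.
  intros H Dxy. apply locally_2d_impl with (2 := open_locally_2d D x y oD Dxy).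
  apply locally_2d_forall. intros u v; apply H.
Qed.

Lemma smooth_on_ext f g : eq_on f g -> smooth_on D f -> smooth_on D g.
Proof.
  intros H Hf x y Dxy n. apply ex_diff_n_ext_loc with (2 := Hf x y Dxy n).
  now apply eq_on_locally.
Qed.

Lemma pdx_ext f g : eq_on f g -> eq_on (pdx f) (pdx g).
Proof.
  intros H x y Dxy. apply Derive_ext_loc.
  apply filter_imp with (2 := open_locally_x D x y oD Dxy). intros t; apply H.
Qed.

Lemma pdy_ext f g : eq_on f g -> eq_on (pdy f) (pdy g).
Proof.
  intros H x y Dxy. apply Derive_ext_loc.
  apply filter_imp with (2 := open_locally_y D x y oD Dxy). intros t; apply H.
Qed.

Definition Cn_on n f := forall x y, D (x, y) -> ex_diff_n f n x y.

Lemma Cn_on_ext n f g : eq_on f g -> Cn_on n f -> Cn_on n g.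
Proof.
  intros H Hf x y Dxy. apply ex_diff_n_ext_loc with (2 := Hf x y Dxy).
  now apply eq_on_locally.
Qed.

Lemma Cn_on_S n f : Cn_on (S n) f <->
  (forall x y, D (x, y) -> continuity_2d_pt f x y /\
     ex_derive (fun t => f t y) x /\ ex_derive (fun t => f x t) y)
  /\ Cn_on n (pdx f) /\ Cn_on n (pdy f).
Proof.
  split.
  - intros H; repeat split; try (destruct (H x y H0) as [? [? [? [? ?]]]]; assumption);
      intros x y Dxy; destruct (H x y Dxy) as [? [? [? [? ?]]]]; assumption.
  - intros [H1 [H2 H3]] x y Dxy. destruct (H1 x y Dxy) as [h1 [h2 h3]].
    split; [exact h1|]. split; [exact h2|]. split; [exact h3|].
    split; [exact (H2 x y Dxy) | exact (H3 x y Dxy)].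
Qed.

Lemma Cn_on_le n m f : (m <= n)%nat -> Cn_on n f -> Cn_on m f.
Proof. intros mn Hf x y Dxy. now apply ex_diff_n_m with n; [|apply Hf]. Qed.

Lemma smooth_on_Cn f : smooth_on D f <-> forall n, Cn_on n f.
Proof. split; intros H; [intros n x y Dxy; apply H; exact Dxy | intros x y Dxy n; now apply H]. Qed.

Lemma Cn_on_const n c : Cn_on n (fun _ _ => c).
Proof.
  revert c; induction n as [|n IH]; intros c.
  - intros x y _; split; [apply continuity_2d_pt_const | exact I].
  - apply Cn_on_S; split.
    + intros x y _; split; [apply continuity_2d_pt_const|].
      split; apply ex_derive_const.
    + split; apply (Cn_on_ext n (fun _ _ => 0)); try apply IH;
        intros x y _; symmetry; exact (Derive_const _ _).
Qed.

Lemma Cn_on_plus n f g : Cn_on n f -> Cn_on n g -> Cn_on n (fun x y => f x y + g x y).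
Proof.
  revert f g; induction n as [|n IH]; intros f g Hf Hg.
  - intros x y Dxy; split; [|exact I].
    apply continuity_2d_pt_plus; [apply (Hf x y Dxy) | apply (Hg x y Dxy)].
  - apply Cn_on_S in Hf. apply Cn_on_S in Hg.
    destruct Hf as [Hf [Hf1 Hf2]]. destruct Hg as [Hg [Hg1 Hg2]].
    apply Cn_on_S; split; [|split].
    + intros x y Dxy. destruct (Hf x y Dxy) as [? [? ?]]. destruct (Hg x y Dxy) as [? [? ?]].
      split; [now apply continuity_2d_pt_plus|].
      split; now apply (ex_derive_plus (V := R_NormedModule)).
    + apply Cn_on_ext with (2 := IH _ _ Hf1 Hg1). intros x y Dxy.
      destruct (Hf x y Dxy) as [? [? ?]]. destruct (Hg x y Dxy) as [? [? ?]].
      symmetry; now apply Derive_plus.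
    + apply Cn_on_ext with (2 := IH _ _ Hf2 Hg2). intros x y Dxy.
      destruct (Hf x y Dxy) as [? [? ?]]. destruct (Hg x y Dxy) as [? [? ?]].
      symmetry; now apply Derive_plus.
Qed.

Lemma Cn_on_mult n f g : Cn_on n f -> Cn_on n g -> Cn_on n (fun x y => f x y * g x y).
Proof.
  revert f g; induction n as [|n IH]; intros f g Hf Hg.
  - intros x y Dxy; split; [|exact I].
    apply continuity_2d_pt_mult; [apply (Hf x y Dxy) | apply (Hg x y Dxy)].
  - assert (Hf0 : Cn_on n f) by (apply Cn_on_le with (2 := Hf); auto).
    assert (Hg0 : Cn_on n g) by (apply Cn_on_le with (2 := Hg); auto).
    apply Cn_on_S in Hf. apply Cn_on_S in Hg.
    destruct Hf as [Hf [Hf1 Hf2]]. destruct Hg as [Hg [Hg1 Hg2]].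
    apply Cn_on_S; split; [|split].
    + intros x y Dxy. destruct (Hf x y Dxy) as [? [? ?]]. destruct (Hg x y Dxy) as [? [? ?]].
      split; [now apply continuity_2d_pt_mult|].
      split; now apply ex_derive_mult.
    + apply Cn_on_ext with (2 := Cn_on_plus n _ _ (IH _ _ Hf1 Hg0) (IH _ _ Hf0 Hg1)).
      intros x y Dxy.
      destruct (Hf x y Dxy) as [? [? ?]]. destruct (Hg x y Dxy) as [? [? ?]].
      symmetry; now apply Derive_mult.
    + apply Cn_on_ext with (2 := Cn_on_plus n _ _ (IH _ _ Hf2 Hg0) (IH _ _ Hf0 Hg2)).
      intros x y Dxy.
      destruct (Hf x y Dxy) as [? [? ?]]. destruct (Hg x y Dxy) as [? [? ?]].
      symmetry; now apply Derive_mult.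
Qed.

Lemma Cn_on_inv n f : (forall x y, D (x, y) -> f x y <> 0) ->
  Cn_on n f -> Cn_on n (fun x y => / f x y).
Proof.
  intros f0. induction n as [|n IH]; intros Hf.
  - intros x y Dxy; split; [|exact I].
    apply continuity_2d_pt_inv; [apply (Hf x y Dxy) | now apply f0].
  - assert (Hf0 : Cn_on n f) by (apply Cn_on_le with (2 := Hf); auto).
    apply Cn_on_S in Hf. destruct Hf as [Hf [Hf1 Hf2]].
    assert (H : forall g, Cn_on n g -> Cn_on n (fun x y => -1 * (g x y * (/ f x y * / f x y)))).
    { intros g Hg. apply (Cn_on_mult n (fun _ _ => -1)); [apply Cn_on_const|].
      apply Cn_on_mult; [exact Hg|]. apply Cn_on_mult; auto. }
    apply Cn_on_S; split; [|split].
    + intros x y Dxy. destruct (Hf x y Dxy) as [? [? ?]].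
      split; [now apply continuity_2d_pt_inv; [|apply f0]|].
      split; apply ex_derive_inv; auto.
    + apply Cn_on_ext with (2 := H _ Hf1). intros x y Dxy.
      destruct (Hf x y Dxy) as [? [? ?]].
      unfold pdx. rewrite Derive_inv; auto. field. now apply f0.
    + apply Cn_on_ext with (2 := H _ Hf2). intros x y Dxy.
      destruct (Hf x y Dxy) as [? [? ?]].
      unfold pdy. rewrite Derive_inv; auto. change (Derive (f x) y) with (Derive (fun t => f x t) y). field. now apply f0.
Qed.

Lemma Cn_on_fst n : Cn_on n (fun x _ => x).
Proof.
  destruct n as [|n]; [intros x y _; split; [apply continuity_2d_pt_id1 | exact I]|].
  apply Cn_on_S; split; [|split].
  - intros x y _; split; [apply continuity_2d_pt_id1|].
    split; [apply ex_derive_id | apply ex_derive_const].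
  - apply (Cn_on_ext n (fun _ _ => 1)); [|apply Cn_on_const].
    intros x y _; symmetry; exact (Derive_id _).
  - apply (Cn_on_ext n (fun _ _ => 0)); [|apply Cn_on_const].
    intros x y _; symmetry; exact (Derive_const _ _).
Qed.

Lemma Cn_on_snd n : Cn_on n (fun _ y => y).
Proof.
  destruct n as [|n]; [intros x y _; split; [apply continuity_2d_pt_id2 | exact I]|].
  apply Cn_on_S; split; [|split].
  - intros x y _; split; [apply continuity_2d_pt_id2|].
    split; [apply ex_derive_const | apply ex_derive_id].
  - apply (Cn_on_ext n (fun _ _ => 0)); [|apply Cn_on_const].
    intros x y _; symmetry; exact (Derive_const _ _).
  - apply (Cn_on_ext n (fun _ _ => 1)); [|apply Cn_on_const].
    intros x y _; symmetry; exact (Derive_id _).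
Qed.

Lemma smooth_on_const c : smooth_on D (fun _ _ => c).
Proof. apply smooth_on_Cn; intros n; apply Cn_on_const. Qed.
Lemma smooth_on_fst : smooth_on D (fun x _ => x).
Proof. apply smooth_on_Cn; intros n; apply Cn_on_fst. Qed.
Lemma smooth_on_snd : smooth_on D (fun _ y => y).
Proof. apply smooth_on_Cn; intros n; apply Cn_on_snd. Qed.
Lemma smooth_on_plus f g :
  smooth_on D f -> smooth_on D g -> smooth_on D (fun x y => f x y + g x y).
Proof. rewrite !smooth_on_Cn; intros Hf Hg n; now apply Cn_on_plus. Qed.
Lemma smooth_on_mult f g :
  smooth_on D f -> smooth_on D g -> smooth_on D (fun x y => f x y * g x y).
Proof. rewrite !smooth_on_Cn; intros Hf Hg n; now apply Cn_on_mult. Qed.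
Lemma smooth_on_inv f : (forall x y, D (x, y) -> f x y <> 0) ->
  smooth_on D f -> smooth_on D (fun x y => / f x y).
Proof. rewrite !smooth_on_Cn; intros f0 Hf n; now apply Cn_on_inv. Qed.

Lemma pdx_plus f g : smooth_on D f -> smooth_on D g ->
  eq_on (pdx (fun x y => f x y + g x y)) (fun x y => pdx f x y + pdx g x y).
Proof. intros Hf Hg x y Dxy. apply Derive_plus; now apply smooth_on_ex_x. Qed.
Lemma pdy_plus f g : smooth_on D f -> smooth_on D g ->
  eq_on (pdy (fun x y => f x y + g x y)) (fun x y => pdy f x y + pdy g x y).
Proof. intros Hf Hg x y Dxy. apply Derive_plus; now apply smooth_on_ex_y. Qed.
Lemma pdx_mult f g : smooth_on D f -> smooth_on D g ->
  eq_on (pdx (fun x y => f x y * g x y)) (fun x y => pdx f x y * g x y + f x y * pdx g x y).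
Proof. intros Hf Hg x y Dxy. now apply (Derive_mult (fun t => f t y) (fun t => g t y)); apply smooth_on_ex_x. Qed.
Lemma pdy_mult f g : smooth_on D f -> smooth_on D g ->
  eq_on (pdy (fun x y => f x y * g x y)) (fun x y => pdy f x y * g x y + f x y * pdy g x y).
Proof. intros Hf Hg x y Dxy. now apply (Derive_mult (fun t => f x t) (fun t => g x t)); apply smooth_on_ex_y. Qed.

Lemma pdx_pdy f : smooth_on D f -> eq_on (pdx (pdy f)) (pdy (pdx f)).
Proof.
  intros Hf x y Dxy. apply Schwarz.
  - apply locally_2d_impl with (2 := open_locally_2d D x y oD Dxy).
    apply locally_2d_forall. intros u v Duv.
    split; [now apply smooth_on_ex_x|]. split; [now apply smooth_on_ex_y|].
    split; [apply (smooth_on_ex_x (pdy f)) | apply (smooth_on_ex_y (pdx f))]; auto;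
      [now apply smooth_on_pdy | now apply smooth_on_pdx].
  - apply (smooth_on_cont (pdx (pdy f))); auto. now apply smooth_on_pdx, smooth_on_pdy.
  - apply (smooth_on_cont (pdy (pdx f))); auto. now apply smooth_on_pdy, smooth_on_pdx.
Qed.

(** Bootstrapping: if all [f i] are C^n, so are the right-hand sides, which are their partial
    derivatives, and then the [f i] are C^(n+1). This turns continuous solutions of a total
    differential system into smooth ones. *)
Lemma smooth_on_system (N : nat) (f F1 F2 : nat -> R -> R -> R) :
  (forall i, (i < N)%nat -> forall x y, D (x, y) ->
     continuity_2d_pt (f i) x y /\ is_derive (fun t => f i t y) x (F1 i x y) /\
     is_derive (fun t => f i x t) y (F2 i x y)) ->
  (forall n, (forall i, (i < N)%nat -> Cn_on n (f i)) ->
     forall i, (i < N)%nat -> Cn_on n (F1 i) /\ Cn_on n (F2 i)) ->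
  forall i, (i < N)%nat -> smooth_on D (f i).
Proof.
  intros H1 H2.
  assert (K : forall n i, (i < N)%nat -> Cn_on n (f i)).
  { induction n as [|n IH]; intros i iN.
    - intros x y Dxy; split; [now apply H1 | exact I].
    - destruct (H2 n IH i iN) as [K1 K2]. apply Cn_on_S; split; [|split].
      + intros x y Dxy. destruct (H1 i iN x y Dxy) as [h0 [h1 h2]].
        split; [exact h0|]. split; eexists; [exact h1 | exact h2].
      + apply Cn_on_ext with (2 := K1). intros x y Dxy.
        symmetry; apply is_derive_unique. now apply H1.
      + apply Cn_on_ext with (2 := K2). intros x y Dxy.
        symmetry; apply is_derive_unique. now apply H1. }
  intros i iN. apply smooth_on_Cn. intros n; now apply K.
Qed.

End Smooth.

Lemma partial_derive_iter m n f : partial_derive m n f = Nat.iter m pdx (Nat.iter n pdy f).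
Proof.
  assert (Hy : forall n f, (fun x y => Derive_n (fun z => f x z) n y) = Nat.iter n pdy f).
  { clear; induction n as [|n IH]; intros f; [reflexivity|].
    apply functional_extensionality; intros x; apply functional_extensionality; intros y.
    cbn [Nat.iter nat_rect Derive_n]. unfold pdy at 1.
    apply Derive_ext. intros t.
    exact (f_equal (fun h => h x t) (IH f)). }
  assert (Hx : forall m f, (fun x y => Derive_n (fun z => f z y) m x) = Nat.iter m pdx f).
  { clear; induction m as [|m IH]; intros f; [reflexivity|].
    apply functional_extensionality; intros x; apply functional_extensionality; intros y.
    cbn [Nat.iter nat_rect Derive_n]. unfold pdx at 1.
    apply Derive_ext. intros t.
    exact (f_equal (fun h => h t y) (IH f)). }
  rewrite <- Hx, <- Hy. reflexivity.
Qed.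

(** * Linear ordinary differential equations *)

Fixpoint rsum (N : nat) (f : nat -> R) : R :=
  match N with O => 0 | S n => rsum n f + f n end.

Lemma rsum_ext N f g : (forall i, (i < N)%nat -> f i = g i) -> rsum N f = rsum N g.
Proof.
  induction N as [|N IH]; intros H; simpl; [reflexivity|].
  rewrite IH by (intros; apply H; lia). now rewrite H by lia.
Qed.

Lemma rsum_le N f g : (forall i, (i < N)%nat -> f i <= g i) -> rsum N f <= rsum N g.
Proof.
  induction N as [|N IH]; intros H; simpl; [lra|].
  apply Rplus_le_compat; [apply IH; intros; apply H; lia | apply H; lia].
Qed.

Lemma rsum_const N c : rsum N (fun _ => c) = INR N * c.
Proof. induction N as [|N IH]; [simpl; ring|]. rewrite S_INR. simpl rsum. rewrite IH; ring. Qed.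

Lemma rsum_plus N f g : rsum N (fun i => f i + g i) = rsum N f + rsum N g.
Proof. induction N as [|N IH]; simpl; [ring|]. rewrite IH; ring. Qed.

Lemma rsum_minus N f g : rsum N (fun i => f i - g i) = rsum N f - rsum N g.
Proof. induction N as [|N IH]; simpl; [ring|]. rewrite IH; ring. Qed.

Lemma rsum_scal N c f : rsum N (fun i => c * f i) = c * rsum N f.
Proof. induction N as [|N IH]; simpl; [ring|]. rewrite IH; ring. Qed.

Lemma rsum_0 N f : (forall i, (i < N)%nat -> f i = 0) -> rsum N f = 0.
Proof.
  intros H. rewrite (rsum_ext N f (fun _ => 0)) by exact H. rewrite rsum_const; ring.
Qed.

Lemma rsum_abs N f : Rabs (rsum N f) <= rsum N (fun i => Rabs (f i)).
Proof.
  induction N as [|N IH]; simpl; [rewrite Rabs_R0; lra|].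
  eapply Rle_trans; [apply Rabs_triang|]. lra.
Qed.

Lemma rsum_abs_nonneg N f : 0 <= rsum N (fun i => Rabs (f i)).
Proof. eapply Rle_trans; [apply Rabs_pos | apply rsum_abs]. Qed.

Lemma rsum_term N f i : (i < N)%nat -> Rabs (f i) <= rsum N (fun i => Rabs (f i)).
Proof.
  induction N as [|N IH]; intros H; [lia|]. simpl.
  pose proof (rsum_abs_nonneg N f). pose proof (Rabs_pos (f N)).
  destruct (Nat.eq_dec i N) as [->|]; [lra|]. specialize (IH ltac:(lia)); lra.
Qed.

Lemma rsum_swap N K (f : nat -> nat -> R) :
  rsum N (fun i => rsum K (fun j => f i j)) = rsum K (fun j => rsum N (fun i => f i j)).
Proof.
  induction N as [|N IH]; simpl; [symmetry; now apply rsum_0|].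
  rewrite IH, <- rsum_plus. now apply rsum_ext.
Qed.

Lemma rsum_linear_bound N (m e : nat -> R) B :
  (forall j, (j < N)%nat -> Rabs (m j) <= B) ->
  Rabs (rsum N (fun j => m j * e j)) <= B * rsum N (fun j => Rabs (e j)).
Proof.
  intros H. eapply Rle_trans; [apply rsum_abs|]. rewrite <- rsum_scal.
  apply rsum_le; intros j Hj. rewrite Rabs_mult.
  apply Rmult_le_compat_r; [apply Rabs_pos | auto].
Qed.

Lemma is_derive_rsum N (f df : nat -> R -> R) t :
  (forall i, (i < N)%nat -> is_derive (f i) t (df i t)) ->
  is_derive (fun s => rsum N (fun i => f i s)) t (rsum N (fun i => df i t)).
Proof.
  induction N as [|N IH]; intros H; simpl; [apply (is_derive_const 0)|].
  apply (is_derive_plus (V := R_NormedModule)); [apply IH; intros; apply H; lia | apply H; lia].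
Qed.

Lemma continuity_pt_rsum N (f : nat -> R -> R) t :
  (forall i, (i < N)%nat -> continuity_pt (f i) t) ->
  continuity_pt (fun s => rsum N (fun i => f i s)) t.
Proof.
  induction N as [|N IH]; intros H; simpl.
  - apply continuity_pt_const; intros x y; reflexivity.
  - apply (continuity_pt_plus (fun s => rsum N (fun i => f i s)) (f N));
      [apply IH; intros; apply H; lia | apply H; lia].
Qed.

Lemma is_derive_continuity_pt f t l : is_derive f t l -> continuity_pt f t.
Proof.
  intros H. apply continuity_pt_filterlim.
  apply (ex_derive_continuous (K := R_AbsRing) (V := R_NormedModule) f t). now exists l.
Qed.

Lemma between_dist a b c : Rmin a b <= c <= Rmax a b -> Rabs (c - a) <= Rabs (b - a).
Proof.
  unfold Rmin, Rmax; destruct (Rle_dec a b); intros H; unfold Rabs;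
    destruct (Rcase_abs (c - a)), (Rcase_abs (b - a)); lra.
Qed.

Lemma mean_value_bound (f df : R -> R) a b B :
  (forall t, Rmin a b <= t <= Rmax a b -> is_derive f t (df t)) ->
  (forall t, Rmin a b <= t <= Rmax a b -> Rabs (df t) <= B) ->
  Rabs (f b - f a) <= B * Rabs (b - a).
Proof.
  intros H HB. destruct (MVT_gen f a b df) as [c [Hc ->]].
  - intros t Ht; apply H; lra.
  - intros t Ht. eapply is_derive_continuity_pt, H, Ht.
  - rewrite Rabs_mult. apply Rmult_le_compat_r; [apply Rabs_pos | auto].
Qed.

(* On a short interval the maximum m of the sum of the |e_i| satisfies
   m <= m_0 + m / 2 + N L eps, by the mean value theorem. *)
Lemma gronwall_short N (M : nat -> nat -> R -> R) (f e : nat -> R -> R) t0 t1 B L eps :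
  0 <= B -> Rabs (t1 - t0) <= L -> INR N * B * L <= 1 / 2 ->
  (forall i t, (i < N)%nat -> Rmin t0 t1 <= t <= Rmax t0 t1 ->
     is_derive (e i) t (rsum N (fun j => M i j t * e j t) + f i t) /\ Rabs (f i t) <= eps) ->
  (forall i j t, (i < N)%nat -> (j < N)%nat -> Rmin t0 t1 <= t <= Rmax t0 t1 ->
     Rabs (M i j t) <= B) ->
  rsum N (fun i => Rabs (e i t1)) <= 2 * (rsum N (fun i => Rabs (e i t0)) + INR N * L * eps).
Proof.
  intros B0 HL HNB He HM.
  assert (L0 : 0 <= L) by (eapply Rle_trans; [apply Rabs_pos | exact HL]).
  set (s := fun t => rsum N (fun i => Rabs (e i t))).
  destruct (continuity_ab_maj s (Rmin t0 t1) (Rmax t0 t1)) as [ts [Hmax Hts]].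
  { apply Rle_trans with t0; [apply Rmin_l | apply Rmax_l]. }
  { intros t Ht. apply (continuity_pt_rsum N (fun i u => Rabs (e i u))). intros i Hi.
    apply (continuity_pt_comp (e i) Rabs); [|apply Rcontinuity_abs].
    eapply is_derive_continuity_pt, He; assumption. }
  assert (Hend : s t1 <= s ts) by (apply Hmax; split; [apply Rmin_r | apply Rmax_r]).
  assert (Hdist : Rabs (ts - t0) <= L).
  { eapply Rle_trans; [apply between_dist; exact Hts | exact HL]. }
  assert (Hstep : forall i, (i < N)%nat ->
            Rabs (e i ts) <= Rabs (e i t0) + (B * s ts + eps) * L).
  { intros i Hi.
    assert (Hsub : forall t, Rmin t0 ts <= t <= Rmax t0 ts -> Rmin t0 t1 <= t <= Rmax t0 t1).
    { intros t. revert Hts. unfold Rmin, Rmax.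
      destruct (Rle_dec t0 t1), (Rle_dec t0 ts); lra. }
    assert (Hpos : 0 <= B * s ts + eps).
    { destruct (He i t0 Hi) as [_ H0]; [split; [apply Rmin_l | apply Rmax_l]|].
      pose proof (Rabs_pos (f i t0)).
      pose proof (Rmult_le_pos B (s ts) B0 (rsum_abs_nonneg N (fun i => e i ts))). lra. }
    assert (Hd : Rabs (e i ts - e i t0) <= (B * s ts + eps) * L).
    { apply Rle_trans with ((B * s ts + eps) * Rabs (ts - t0)).
      - apply mean_value_bound with
          (df := fun t => rsum N (fun j => M i j t * e j t) + f i t).
        + intros t Ht. apply He; auto.
        + intros t Ht. eapply Rle_trans; [apply Rabs_triang|].
          apply Rplus_le_compat; [|apply He; auto].
          eapply Rle_trans;
            [apply (rsum_linear_bound N (fun j => M i j t) (fun j => e j t) B); intros; apply HM; auto|].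
          apply Rmult_le_compat_l; [exact B0|]. apply Hmax; auto.
      - apply Rmult_le_compat_l; auto. }
    replace (e i ts) with (e i t0 + (e i ts - e i t0)) at 1 by ring.
    eapply Rle_trans; [apply Rabs_triang|]. lra. }
  assert (Hs : s ts <= s t0 + INR N * ((B * s ts + eps) * L)).
  { unfold s at 1 2. rewrite <- rsum_const, <- rsum_plus. now apply rsum_le. }
  assert (0 <= s ts) by apply rsum_abs_nonneg.
  change (s t1 <= 2 * (s t0 + INR N * L * eps)).
  assert (INR N * B * L * s ts <= 1 / 2 * s ts) by (apply Rmult_le_compat_r; auto).
  nra.
Qed.

Section LinearODE.
Variables (N : nat) (M : nat -> nat -> R -> R) (t0 rho B : R) (c : nat -> R).

Fixpoint picard (k : nat) (i : nat) (t : R) : R :=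
  match k with
  | O => c i
  | S k => c i + RInt (fun s => rsum N (fun j => M i j s * picard k j s)) t0 t
  end.

Definition lin_sol (i : nat) (t : R) : R := real (Lim_seq (fun k => picard k i t)).

Hypothesis Hrho : 0 < rho.
Hypothesis HB : 0 <= B.
Hypothesis HNB : INR N * B * rho <= 1 / 2.
Hypothesis HM : forall i j t, (i < N)%nat -> (j < N)%nat -> Rabs (t - t0) < rho ->
  continuity_pt (M i j) t /\ Rabs (M i j t) <= B.

Lemma ball_between a t : Rabs (a - t0) < rho -> Rmin t0 a <= t <= Rmax t0 a ->
  Rabs (t - t0) < rho.
Proof. intros Ha Ht. eapply Rle_lt_trans; [apply between_dist; exact Ht | exact Ha]. Qed.

(** Continuity of the iterate is a hypothesis because the next lemma obtains it from this formula,
    by induction. *)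
Lemma picard_derive k : (forall i t, (i < N)%nat -> Rabs (t - t0) < rho ->
  continuity_pt (picard k i) t) ->
  forall i t, (i < N)%nat -> Rabs (t - t0) < rho ->
  is_derive (picard (S k) i) t (rsum N (fun j => M i j t * picard k j t)).
Proof.
  intros Hc i t Hi Ht.
  set (g := fun s => rsum N (fun j => M i j s * picard k j s)).
  assert (Hg : forall s, Rabs (s - t0) < rho -> continuous g s).
  { intros s Hs. apply continuity_pt_filterlim.
    apply (continuity_pt_rsum N (fun j s => M i j s * picard k j s)). intros j Hj.
    apply (continuity_pt_mult (M i j) (picard k j)); [now apply HM | now apply Hc]. }
  change (is_derive (fun t => c i + RInt g t0 t) t (g t)).
  replace (g t) with (0 + g t) by ring.
  apply (is_derive_plus (V := R_NormedModule) (fun _ => c i)); [apply (is_derive_const (c i))|].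
  apply is_derive_RInt with (a := t0); [|now apply Hg].
  assert (Hl : locally t (fun s => Rabs (s - t0) < rho)).
  { assert (Hp : 0 < rho - Rabs (t - t0)) by lra.
    exists (mkposreal _ Hp). intros s Hs. change (Rabs (s - t) < rho - Rabs (t - t0)) in Hs.
    replace (s - t0) with ((s - t) + (t - t0)) by ring.
    eapply Rle_lt_trans; [apply Rabs_triang|]. lra. }
  apply filter_imp with (2 := Hl). intros s Hs.
  apply (RInt_correct (V := R_CompleteNormedModule)).
  apply (ex_RInt_continuous (V := R_CompleteNormedModule)).
  intros z Hz. apply Hg. now apply ball_between with s.
Qed.

Lemma picard_continuous k i t : (i < N)%nat -> Rabs (t - t0) < rho ->
  continuity_pt (picard k i) t.
Proof.
  revert i t. induction k as [|k IH]; intros i t Hi Ht.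
  - apply continuity_pt_const; intros x y; reflexivity.
  - eapply is_derive_continuity_pt, picard_derive; auto.
Qed.

Lemma picard_t0 k i : picard k i t0 = c i.
Proof. destruct k; simpl; [reflexivity|]. rewrite RInt_point. unfold zero; simpl. ring. Qed.

Let C := rho * (B * rsum N (fun j => Rabs (c j))).

(** The zeroth iterate is the constant [c], so the first increment is at most [C] by the mean value
    theorem; afterwards [INR N * B * rho <= 1 / 2] makes each integration at least halve the
    increment. *)
Lemma picard_step k i t : (i < N)%nat -> Rabs (t - t0) < rho ->
  Rabs (picard (S k) i t - picard k i t) <= C * (1 / 2) ^ k.
Proof.
  assert (C0 : 0 <= C).
  { unfold C. apply Rmult_le_pos; [lra|]. apply Rmult_le_pos; [exact HB|]. apply rsum_abs_nonneg. }
  revert i t. induction k as [|k IH]; intros i t Hi Ht.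
  - replace (picard 0 i t) with (picard 1 i t0) by (rewrite picard_t0; reflexivity).
    apply Rle_trans with (B * rsum N (fun j => Rabs (c j)) * Rabs (t - t0)).
    + apply mean_value_bound with
        (df := fun t => rsum N (fun j => M i j t * picard 0 j t)).
      * intros s Hs. apply picard_derive; auto; [intros; now apply picard_continuous|].
        now apply ball_between with t.
      * intros s Hs. apply (rsum_linear_bound N (fun j => M i j s) c B).
        intros j Hj. apply HM; auto. now apply ball_between with t.
    + unfold C. rewrite pow_O, Rmult_1_r, (Rmult_comm rho).
      apply Rmult_le_compat_l; [|lra].
      apply Rmult_le_pos; [exact HB|]. apply rsum_abs_nonneg.
  - set (w := fun t => picard (S (S k)) i t - picard (S k) i t).
    replace (picard (S (S k)) i t - picard (S k) i t) with (w t - w t0)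
      by (unfold w; rewrite !picard_t0; ring).
    set (D := C * (1 / 2) ^ k) in *.
    assert (D0 : 0 <= D) by (apply Rmult_le_pos; [exact C0 | apply pow_le; lra]).
    apply Rle_trans with (B * (INR N * D) * Rabs (t - t0)).
    + apply mean_value_bound with
        (df := fun t => rsum N (fun j => M i j t * picard (S k) j t)
                        - rsum N (fun j => M i j t * picard k j t)).
      * intros s Hs. assert (Rabs (s - t0) < rho) by now apply ball_between with t.
        apply (is_derive_minus (V := R_NormedModule));
          apply picard_derive; auto; intros; now apply picard_continuous.
      * intros s Hs. assert (Rabs (s - t0) < rho) by now apply ball_between with t.
        rewrite <- rsum_minus.
        rewrite (rsum_ext N _ (fun j => M i j s * (picard (S k) j s - picard k j s)))
          by (intros; ring).
        eapply Rle_trans; [apply (rsum_linear_bound N (fun j => M i j s) _ B)|].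
        { intros j Hj. now apply HM. }
        apply Rmult_le_compat_l; [exact HB|]. rewrite <- rsum_const.
        apply rsum_le; intros j Hj. now apply IH.
    + replace (C * (1 / 2) ^ S k) with (D * (1 / 2)) by (unfold D; simpl; ring).
      assert (B * (INR N * D) * Rabs (t - t0) <= B * (INR N * D) * rho).
      { apply Rmult_le_compat_l; [|lra].
        apply Rmult_le_pos; [exact HB|]. apply Rmult_le_pos; [apply pos_INR | exact D0]. }
      assert (INR N * B * rho * D <= 1 / 2 * D) by (apply Rmult_le_compat_r; auto).
      lra.
Qed.

Lemma picard_dist k p i t : (i < N)%nat -> Rabs (t - t0) < rho ->
  Rabs (picard (k + p) i t - picard k i t) <= 2 * C * (1 / 2) ^ k.
Proof.
  intros Hi Ht.
  assert (C0 : 0 <= C * (1/2) ^ k).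
  { eapply Rle_trans; [apply Rabs_pos|]. apply (picard_step k i t Hi Ht). }
  assert (H : Rabs (picard (k + p) i t - picard k i t)
              <= 2 * C * (1 / 2) ^ k * (1 - (1 / 2) ^ p)).
  { induction p as [|p IH].
    - rewrite Nat.add_0_r, Rminus_diag, Rabs_R0. simpl. lra.
    - replace (picard (k + S p) i t - picard k i t) with
        ((picard (S (k + p)) i t - picard (k + p) i t) + (picard (k + p) i t - picard k i t))
        by (replace (k + S p)%nat with (S (k + p)) by lia; ring).
      eapply Rle_trans; [apply Rabs_triang|].
      eapply Rle_trans; [apply Rplus_le_compat; [apply picard_step; auto | exact IH]|].
      rewrite pow_add. simpl. lra. }
  eapply Rle_trans; [exact H|].
  assert (0 <= (1 / 2) ^ p) by (apply pow_le; lra). nra.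
Qed.

Lemma picard_cauchy (eps : R) : 0 < eps -> exists K, forall i t n m,
  (i < N)%nat -> Rabs (t - t0) < rho -> (K <= n)%nat -> (K <= m)%nat ->
  Rabs (picard n i t - picard m i t) < eps.
Proof.
  intros Heps.
  assert (C0 : 0 <= C).
  { unfold C. apply Rmult_le_pos; [lra|]. apply Rmult_le_pos; [exact HB|]. apply rsum_abs_nonneg. }
  (* Comparing two iterates with the [K]-th one costs [4 * C * (1 / 2) ^ K]; the [+ 1] covers
     [C = 0]. *)
  destruct (pow_lt_1_zero (1 / 2) ltac:(rewrite Rabs_pos_eq; lra) (eps / (4 * C + 1)))
    as [K HK]; [apply Rdiv_lt_0_compat; lra|].
  exists K. intros i t n m Hi Ht Hn Hm.
  pose proof (picard_dist K (n - K) i t Hi Ht) as H1.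
  pose proof (picard_dist K (m - K) i t Hi Ht) as H2.
  replace (K + (n - K))%nat with n in H1 by lia.
  replace (K + (m - K))%nat with m in H2 by lia.
  specialize (HK K (Nat.le_refl _)). rewrite Rabs_pos_eq in HK by (apply pow_le; lra).
  apply Rlt_div_r in HK; [|lra].
  replace (picard n i t - picard m i t) with
    ((picard n i t - picard K i t) - (picard m i t - picard K i t)) by ring.
  eapply Rle_lt_trans; [apply Rabs_triang|]. rewrite Rabs_Ropp.
  assert (0 < (1 / 2) ^ K) by (apply pow_lt; lra). nra.
Qed.

Lemma picard_lim i t : (i < N)%nat -> Rabs (t - t0) < rho ->
  is_lim_seq (fun k => picard k i t) (lin_sol i t).
Proof.
  intros Hi Ht. apply Lim_seq_correct'. apply ex_lim_seq_cauchy_corr.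
  intros eps. destruct (picard_cauchy eps (cond_pos eps)) as [K HK].
  exists K. intros n m Hn Hm. now apply HK.
Qed.

Lemma lin_sol_t0 i : lin_sol i t0 = c i.
Proof.
  unfold lin_sol. rewrite (Lim_seq_ext _ (fun _ => c i)) by (intros; apply picard_t0).
  now rewrite Lim_seq_const.
Qed.

Lemma is_lim_seq_rsum K (u : nat -> nat -> R) (l : nat -> R) :
  (forall j, (j < K)%nat -> is_lim_seq (u j) (l j)) ->
  is_lim_seq (fun k => rsum K (fun j => u j k)) (rsum K l).
Proof.
  induction K as [|K IH]; intros H; simpl; [apply is_lim_seq_const|].
  apply is_lim_seq_plus'; [apply IH; intros; apply H; lia | apply H; lia].
Qed.

Lemma lin_sol_derive i t : (i < N)%nat -> Rabs (t - t0) < rho ->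
  is_derive (lin_sol i) t (rsum N (fun j => M i j t * lin_sol j t)).
Proof.
  intros Hi Ht.
  set (Dm := fun t => Rabs (t - t0) < rho).
  assert (HD : forall k s, Dm s ->
            Derive (picard (S k) i) s = rsum N (fun j => M i j s * picard k j s)).
  { intros k s Hs. apply is_derive_unique, picard_derive; auto.
    intros; now apply picard_continuous. }
  assert (Hlim : Lim_seq (fun k => Derive (picard (S k) i) t)
                 = Finite (rsum N (fun j => M i j t * lin_sol j t))).
  { apply is_lim_seq_unique.
    apply is_lim_seq_ext with (fun k => rsum N (fun j => M i j t * picard k j t)).
    { intros k; symmetry; now apply HD. }
    apply (is_lim_seq_rsum N (fun j k => M i j t * picard k j t)). intros j Hj.
    apply (is_lim_seq_scal_l _ (M i j t) (lin_sol j t)). now apply picard_lim. }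
  (* After a shift by one the derivative of each term is [M] applied to the preceding iterate, so
     uniform convergence of the iterates gives that of the derivatives. *)
  apply is_derive_ext with (fun y => real (Lim_seq (fun k => picard (S k) i y))).
  { intros s. unfold lin_sol. f_equal.
    exact (Lim_seq_incr_1 (fun k => picard k i s)). }
  replace (rsum N (fun j => M i j t * lin_sol j t))
    with (real (Lim_seq (fun k => Derive (picard (S k) i) t))) by now rewrite Hlim.
  apply (CVU_Derive (fun k => picard (S k) i) Dm); [ | | | | | | exact Ht].
  - apply (open_ext (T := R_UniformSpace) (fun s => t0 - rho < s /\ s < t0 + rho)).
    { intros s. unfold Dm. split; intros H; [apply Rabs_def1; lra|].
      apply Rabs_def2 in H; lra. }
    apply open_and; [apply open_gt | apply open_lt].
  - intros a b x Ha Hb Hx. unfold Dm in *. apply Rabs_def1; apply Rabs_def2 in Ha, Hb; lra.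
  - apply CVU_dom_cauchy. intros eps.
    destruct (picard_cauchy eps (cond_pos eps)) as [K HK].
    exists K. intros n m x Hx Hn Hm. apply HK; auto.
  - intros n x Hx. eexists. apply picard_derive; auto. intros; now apply picard_continuous.
  - intros n x Hx.
    apply continuity_pt_ext_loc with (fun s => rsum N (fun j => M i j s * picard n j s)).
    { assert (Hp : 0 < rho - Rabs (x - t0)) by (unfold Dm in Hx; lra).
      exists (mkposreal _ Hp). intros s Hs. change (Rabs (s - x) < rho - Rabs (x - t0)) in Hs.
      symmetry. apply HD. unfold Dm. replace (s - t0) with ((s - x) + (x - t0)) by ring.
      eapply Rle_lt_trans; [apply Rabs_triang|]. lra. }
    apply (continuity_pt_rsum N (fun j s => M i j s * picard n j s)). intros j Hj.
    apply (continuity_pt_mult (M i j) (picard n j)); [now apply HM | now apply picard_continuous].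
  - apply CVU_dom_cauchy. intros eps.
    destruct (picard_cauchy (eps / (B * INR N + 1))) as [K HK].
    { apply Rdiv_lt_0_compat; [apply cond_pos|].
      pose proof (Rmult_le_pos B (INR N) HB (pos_INR N)); lra. }
    exists K. intros n m x Hx Hn Hm. rewrite !HD by exact Hx. rewrite <- rsum_minus.
    rewrite (rsum_ext N _ (fun j => M i j x * (picard n j x - picard m j x)))
      by (intros; ring).
    eapply Rle_lt_trans; [apply (rsum_linear_bound N (fun j => M i j x) _ B)|].
    { intros j Hj. now apply HM. }
    set (d := eps / (B * INR N + 1)) in *.
    apply Rle_lt_trans with (B * (INR N * d)).
    + apply Rmult_le_compat_l; [exact HB|]. rewrite <- rsum_const.
      apply rsum_le; intros j Hj. apply Rlt_le. now apply HK.
    + pose proof (Rmult_le_pos B (INR N) HB (pos_INR N)).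
      assert (0 < d) by (apply Rdiv_lt_0_compat; [apply cond_pos | lra]).
      replace (pos eps) with (d * (B * INR N + 1)) by (unfold d; field; lra). lra.
Qed.

End LinearODE.

(** * Flat linear connections in the plane *)

Definition sq (x0 y0 r : R) : R * R -> Prop :=
  fun p => Rabs (fst p - x0) < r /\ Rabs (snd p - y0) < r.

Lemma sq_open x0 y0 r : open (sq x0 y0 r).
Proof.
  intros [x y] [Hx Hy]; simpl in Hx, Hy.
  assert (Hp : 0 < Rmin (r - Rabs (x - x0)) (r - Rabs (y - y0)))
    by (apply Rmin_glb_lt; lra).
  exists (mkposreal _ Hp). intros [u v] [Hu Hv]; simpl in Hu, Hv.
  change (Rabs (u - x) < Rmin (r - Rabs (x - x0)) (r - Rabs (y - y0))) in Hu.
  change (Rabs (v - y) < Rmin (r - Rabs (x - x0)) (r - Rabs (y - y0))) in Hv.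
  pose proof (Rmin_l (r - Rabs (x - x0)) (r - Rabs (y - y0))).
  pose proof (Rmin_r (r - Rabs (x - x0)) (r - Rabs (y - y0))).
  split; simpl.
  - replace (u - x0) with ((u - x) + (x - x0)) by ring.
    eapply Rle_lt_trans; [apply Rabs_triang|]. lra.
  - replace (v - y0) with ((v - y) + (y - y0)) by ring.
    eapply Rle_lt_trans; [apply Rabs_triang|]. lra.
Qed.

Lemma sq_center x0 y0 r : 0 < r -> sq x0 y0 r (x0, y0).
Proof. intros Hr; split; simpl; rewrite Rminus_diag, Rabs_R0; exact Hr. Qed.

Lemma sq_le x0 y0 r r' p : r <= r' -> sq x0 y0 r p -> sq x0 y0 r' p.
Proof. intros Hr [H1 H2]; split; lra. Qed.

Lemma finite_bound (K : nat) (Q : nat -> R -> R -> Prop) :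
  (forall i b b' d d', b <= b' -> d' <= d -> Q i b d -> Q i b' d') ->
  (forall i, (i < K)%nat -> exists b d, 0 < d /\ Q i b d) ->
  exists b d, 0 <= b /\ 0 < d /\ forall i, (i < K)%nat -> Q i b d.
Proof.
  intros Hm. induction K as [|K IH]; intros H.
  - exists 0, 1. repeat split; try lra. intros; lia.
  - destruct IH as [b [d [Hb [Hd HQ]]]]; [intros; apply H; lia|].
    destruct (H K ltac:(lia)) as [b' [d' [Hd' HQ']]].
    exists (Rmax b b'), (Rmin d d').
    split; [eapply Rle_trans; [exact Hb | apply Rmax_l]|].
    split; [now apply Rmin_glb_lt|]. intros i Hi.
    destruct (Nat.eq_dec i K) as [->|].
    + eapply Hm; [apply Rmax_r | apply Rmin_r | exact HQ'].
    + eapply Hm; [apply Rmax_l | apply Rmin_l | apply HQ; lia].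
Qed.

Lemma local_bound (N : nat) (f : nat -> nat -> R -> R -> R) x0 y0 :
  (forall i j, (i < N)%nat -> (j < N)%nat -> continuity_2d_pt (f i j) x0 y0) ->
  exists b d, 0 <= b /\ 0 < d /\ forall i j x y, (i < N)%nat -> (j < N)%nat ->
    sq x0 y0 d (x, y) -> Rabs (f i j x y) <= b.
Proof.
  intros Hc.
  destruct (finite_bound N (fun i b d => forall j x y, (j < N)%nat ->
    sq x0 y0 d (x, y) -> Rabs (f i j x y) <= b)) as [b [d [Hb [Hd H]]]].
  - intros i b b' d d' Hb Hd H j x y Hj Hxy. eapply Rle_trans; [|exact Hb].
    apply H; auto. now apply sq_le with d'.
  - intros i Hi.
    destruct (finite_bound N (fun j b d => forall x y,
      sq x0 y0 d (x, y) -> Rabs (f i j x y) <= b)) as [b [d [Hb [Hd H]]]].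
    + intros j b b' d d' Hb Hd H x y Hxy. eapply Rle_trans; [|exact Hb].
      apply H. now apply sq_le with d'.
    + intros j Hj. destruct (Hc i j Hi Hj (mkposreal 1 Rlt_0_1)) as [d Hd].
      exists (Rabs (f i j x0 y0) + 1), d. split; [apply cond_pos|].
      intros x y [Hx Hy]; simpl in Hx, Hy.
      specialize (Hd x y Hx Hy); simpl in Hd.
      replace (f i j x y) with (f i j x0 y0 + (f i j x y - f i j x0 y0)) by ring.
      eapply Rle_trans; [apply Rabs_triang|]. lra.
    + exists b, d. split; [exact Hd|]. intros j x y Hj. now apply H.
  - exists b, d. split; [exact Hb|]. split; [exact Hd|]. intros i j x y Hi Hj. now apply H.
Qed.

Definition bounded_on (N : nat) (D : R * R -> Prop) (B : R)
    (f : nat -> nat -> R -> R -> R) : Prop :=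
  forall i j x y, (i < N)%nat -> (j < N)%nat -> D (x, y) -> Rabs (f i j x y) <= B.

Section Transport.
Variables (N : nat) (X Y : nat -> nat -> R -> R -> R) (x0 y0 rho B : R).
Hypothesis Hrho : 0 < rho.
Hypothesis HB : 0 <= B.
Hypothesis HNB : INR N * B * (2 * rho) <= 1 / 2.
Hypothesis HX : forall i j, (i < N)%nat -> (j < N)%nat -> smooth_on (sq x0 y0 rho) (X i j).
Hypothesis HY : forall i j, (i < N)%nat -> (j < N)%nat -> smooth_on (sq x0 y0 rho) (Y i j).
Hypothesis HXB : bounded_on N (sq x0 y0 rho) B X.
Hypothesis HYB : bounded_on N (sq x0 y0 rho) B Y.

Lemma sq_between_x x1 x2 y t : sq x0 y0 rho (x1, y) -> sq x0 y0 rho (x2, y) ->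
  Rmin x1 x2 <= t <= Rmax x1 x2 -> sq x0 y0 rho (t, y).
Proof.
  intros [H1 Hy] [H2 _] Ht. split; simpl in *; [|exact Hy].
  apply Rabs_def1; apply Rabs_def2 in H1, H2; revert Ht;
    unfold Rmin, Rmax; destruct (Rle_dec x1 x2); lra.
Qed.

Lemma sq_between_y x y1 y2 t : sq x0 y0 rho (x, y1) -> sq x0 y0 rho (x, y2) ->
  Rmin y1 y2 <= t <= Rmax y1 y2 -> sq x0 y0 rho (x, t).
Proof.
  intros [Hx H1] [_ H2] Ht. split; simpl in *; [exact Hx|].
  apply Rabs_def1; apply Rabs_def2 in H1, H2; revert Ht;
    unfold Rmin, Rmax; destruct (Rle_dec y1 y2); lra.
Qed.

Definition parallel (z : nat -> R -> R -> R) : Prop :=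
  forall i x y, (i < N)%nat -> sq x0 y0 rho (x, y) ->
    is_derive (fun t => z i t y) x (rsum N (fun j => X i j x y * z j x y)) /\
    is_derive (fun t => z i x t) y (rsum N (fun j => Y i j x y * z j x y)).

Lemma dist2 a b c : Rabs (a - c) < rho -> Rabs (b - c) < rho -> Rabs (b - a) <= 2 * rho.
Proof. intros H1 H2. apply Rabs_def2 in H1, H2. apply Rabs_le; lra. Qed.

Lemma zero_of_rsum_abs (z : nat -> R) S : rsum N (fun i => Rabs (z i)) <= S -> S = 0 ->
  forall i, (i < N)%nat -> z i = 0.
Proof.
  intros H -> i Hi. pose proof (rsum_term N z i Hi). pose proof (Rabs_pos (z i)).
  destruct (Req_dec (z i) 0) as [|Hne]; [assumption|].
  apply Rabs_pos_lt in Hne. lra.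
Qed.

(** Gronwall with zero data, along a horizontal and then a vertical segment. The base point is any
    point of the square, so a segment may be as long as [2 * rho]; this is needed to treat jets at
    all points near the centre on one square. *)
Lemma parallel_unique z x1 y1 : parallel z -> sq x0 y0 rho (x1, y1) ->
  (forall i, (i < N)%nat -> z i x1 y1 = 0) ->
  forall i x y, (i < N)%nat -> sq x0 y0 rho (x, y) -> z i x y = 0.
Proof.
  intros Hz H1 Hz1 i x y Hi Hxy.
  assert (Hmid : sq x0 y0 rho (x, y1)) by (destruct H1, Hxy; now split).
  assert (HS : INR N * (2 * rho) * 0 = 0) by ring.
  assert (K1 : forall i, (i < N)%nat -> z i x y1 = 0).
  { eapply (zero_of_rsum_abs (fun i => z i x y1)).
    - apply (gronwall_short N (fun i j t => X i j t y1) (fun _ _ => 0) (fun i t => z i t y1)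
               x1 x B (2 * rho) 0); auto.
      + apply (dist2 x1 x x0); [apply H1 | apply Hxy].
      + intros k t Hk Ht. rewrite Rplus_0_r. split; [|rewrite Rabs_R0; lra].
        apply Hz; auto. now apply sq_between_x with x1 x.
      + intros k j t Hk Hj Ht. apply HXB; auto. now apply sq_between_x with x1 x.
    - rewrite (rsum_0 N) by (intros k Hk; rewrite Hz1, Rabs_R0; auto). lra. }
  eapply (zero_of_rsum_abs (fun i => z i x y)); [| |exact Hi].
  - apply (gronwall_short N (fun i j t => Y i j x t) (fun _ _ => 0) (fun i t => z i x t)
             y1 y B (2 * rho) 0); auto.
    + apply (dist2 y1 y y0); [apply H1 | apply Hxy].
    + intros k t Hk Ht. rewrite Rplus_0_r. split; [|rewrite Rabs_R0; lra].
      apply Hz; auto. now apply sq_between_y with y1 y.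
    + intros k j t Hk Hj Ht. apply HYB; auto. now apply sq_between_y with y1 y.
  - rewrite (rsum_0 N) by (intros k Hk; rewrite K1, Rabs_R0; auto). lra.
Qed.

Hypothesis HYxB : bounded_on N (sq x0 y0 rho) B (fun i j => pdx (Y i j)).
Hypothesis HYxxB : bounded_on N (sq x0 y0 rho) B (fun i j => pdx (pdx (Y i j))).
Hypothesis flat : forall i j x y, (i < N)%nat -> (j < N)%nat -> sq x0 y0 rho (x, y) ->
  pdy (X i j) x y + rsum N (fun k => X i k x y * Y k j x y)
  = pdx (Y i j) x y + rsum N (fun k => Y i k x y * X k j x y).
Variable c : nat -> R.

(** Transport by [X] along the axis y = y0 and then by [Y] up every vertical line. The y-equation
    holds by construction; the x-equation off the axis is what flatness has to provide. *)
Definition base_sol (i : nat) (x : R) : R := lin_sol N (fun i j t => X i j t y0) x0 c i x.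
Definition flat_sol (i : nat) (x y : R) : R :=
  lin_sol N (fun i j t => Y i j x t) y0 (fun i => base_sol i x) i y.

Lemma HNB1 : INR N * B * rho <= 1 / 2.
Proof.
  pose proof (Rmult_le_pos _ _ (Rmult_le_pos _ _ (pos_INR N) HB) (Rlt_le _ _ Hrho)). lra.
Qed.

Lemma continuity_2d_x f x y : continuity_2d_pt f x y -> continuity_pt (fun t => f t y) x.
Proof.
  intros H. apply continuity_pt_locally. intros eps. destruct (H eps) as [d Hd].
  exists d. intros u Hu. apply Hd; [exact Hu|].
  rewrite Rminus_diag, Rabs_R0. apply cond_pos.
Qed.

Lemma continuity_2d_y f x y : continuity_2d_pt f x y -> continuity_pt (fun t => f x t) y.
Proof.
  intros H. apply continuity_pt_locally. intros eps. destruct (H eps) as [d Hd].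
  exists d. intros u Hu. apply Hd; [|exact Hu].
  rewrite Rminus_diag, Rabs_R0. apply cond_pos.
Qed.

Lemma sq_axis x : Rabs (x - x0) < rho -> sq x0 y0 rho (x, y0).
Proof. intros H; split; simpl; [exact H|]. now rewrite Rminus_diag, Rabs_R0. Qed.

Lemma base_sol_derive i x : (i < N)%nat -> Rabs (x - x0) < rho ->
  is_derive (base_sol i) x (rsum N (fun j => X i j x y0 * base_sol j x)).
Proof.
  intros Hi Hx.
  apply (lin_sol_derive N (fun i j t => X i j t y0) x0 rho B c); auto; [exact HNB1|].
  intros k j t Hk Hj Ht. split; [|apply HXB; auto; now apply sq_axis].
  apply continuity_2d_x. apply (smooth_on_cont (sq x0 y0 rho)); [now apply HX | now apply sq_axis].
Qed.

Lemma flat_sol_derive_y i x y : (i < N)%nat -> sq x0 y0 rho (x, y) ->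
  is_derive (fun t => flat_sol i x t) y (rsum N (fun j => Y i j x y * flat_sol j x y)).
Proof.
  intros Hi [Hx Hy]; simpl in Hx, Hy.
  apply (lin_sol_derive N (fun i j t => Y i j x t) y0 rho B (fun i => base_sol i x));
    auto; [exact HNB1|].
  intros k j t Hk Hj Ht.
  assert (sq x0 y0 rho (x, t)) by (split; simpl; assumption).
  split; [|apply HYB; auto].
  apply continuity_2d_y. apply (smooth_on_cont (sq x0 y0 rho)); [now apply HY | assumption].
Qed.

Lemma flat_sol_y0 i x : flat_sol i x y0 = base_sol i x.
Proof. apply lin_sol_t0. Qed.

Lemma flat_sol_center i : flat_sol i x0 y0 = c i.
Proof. rewrite flat_sol_y0. apply lin_sol_t0. Qed.

(** The factor 4 collects one factor 2 of [gronwall_short] for each of the two segments leading from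
    the centre to a point. *)
Let V := 4 * rsum N (fun i => Rabs (c i)).

Lemma flat_sol_bound x y : sq x0 y0 rho (x, y) ->
  rsum N (fun i => Rabs (flat_sol i x y)) <= V.
Proof.
  intros [Hx Hy]; simpl in Hx, Hy.
  assert (H1 : rsum N (fun i => Rabs (base_sol i x))
               <= 2 * (rsum N (fun i => Rabs (base_sol i x0)) + INR N * (2 * rho) * 0)).
  { apply (gronwall_short N (fun i j t => X i j t y0) (fun _ _ => 0) base_sol
             x0 x B (2 * rho) 0); auto; [lra | |].
    - intros k t Hk Ht. rewrite Rplus_0_r. split; [|rewrite Rabs_R0; lra].
      apply base_sol_derive; auto. eapply Rle_lt_trans; [apply between_dist; exact Ht | exact Hx].
    - intros k j t Hk Hj Ht. apply HXB; auto. apply sq_axis.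
      eapply Rle_lt_trans; [apply between_dist; exact Ht | exact Hx]. }
  assert (H2 : rsum N (fun i => Rabs (flat_sol i x y))
               <= 2 * (rsum N (fun i => Rabs (flat_sol i x y0)) + INR N * (2 * rho) * 0)).
  { apply (gronwall_short N (fun i j t => Y i j x t) (fun _ _ => 0) (fun i t => flat_sol i x t)
             y0 y B (2 * rho) 0); auto; [lra | |].
    - intros k t Hk Ht. rewrite Rplus_0_r. split; [|rewrite Rabs_R0; lra].
      apply flat_sol_derive_y; auto. split; simpl; [exact Hx|].
      eapply Rle_lt_trans; [apply between_dist; exact Ht | exact Hy].
    - intros k j t Hk Hj Ht. apply HYB; auto. split; simpl; [exact Hx|].
      eapply Rle_lt_trans; [apply between_dist; exact Ht | exact Hy]. }
  rewrite (rsum_ext N (fun i => Rabs (base_sol i x0)) (fun i => Rabs (c i))) in H1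
    by (intros; f_equal; apply lin_sol_t0).
  rewrite (rsum_ext N (fun i => Rabs (flat_sol i x y0)) (fun i => Rabs (base_sol i x))) in H2
    by (intros; now rewrite flat_sol_y0).
  unfold V. lra.
Qed.

Lemma Y_increment i j x x' y : (i < N)%nat -> (j < N)%nat ->
  sq x0 y0 rho (x, y) -> sq x0 y0 rho (x', y) ->
  Rabs (Y i j x' y - Y i j x y) <= B * Rabs (x' - x).
Proof.
  intros Hi Hj H H'.
  apply (mean_value_bound (fun t => Y i j t y) (fun t => pdx (Y i j) t y)); intros t Ht.
  - apply Derive_correct. apply (smooth_on_ex_x (sq x0 y0 rho)); [now apply HY|].
    now apply sq_between_x with x x'.
  - apply (HYxB i j); auto. now apply sq_between_x with x x'.
Qed.

(** The mean value theorem twice: the quotient is the x-derivative at an intermediate point, and the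
    second x-derivative bounds its distance from the value at x. *)
Lemma Y_quotient i j x x' y : (i < N)%nat -> (j < N)%nat -> x' <> x ->
  sq x0 y0 rho (x, y) -> sq x0 y0 rho (x', y) ->
  Rabs ((Y i j x' y - Y i j x y) / (x' - x) - pdx (Y i j) x y) <= B * Rabs (x' - x).
Proof.
  intros Hi Hj Hne H H'.
  destruct (MVT_gen (fun t => Y i j t y) x x' (fun t => pdx (Y i j) t y)) as [xi [Hxi E]].
  - intros t Ht. apply Derive_correct. apply (smooth_on_ex_x (sq x0 y0 rho)); [now apply HY|].
    apply sq_between_x with x x'; auto; lra.
  - intros t Ht. eapply is_derive_continuity_pt. apply Derive_correct.
    apply (smooth_on_ex_x (sq x0 y0 rho)); [now apply HY|].
    apply sq_between_x with x x'; auto.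
  - rewrite E. replace (pdx (Y i j) xi y * (x' - x) / (x' - x)) with (pdx (Y i j) xi y)
      by (field; lra).
    apply Rle_trans with (B * Rabs (xi - x)).
    + assert (Hsq : sq x0 y0 rho (xi, y)) by now apply sq_between_x with x x'.
      apply (mean_value_bound (fun t => pdx (Y i j) t y) (fun t => pdx (pdx (Y i j)) t y)); intros t Ht.
      * apply Derive_correct. apply (smooth_on_ex_x (sq x0 y0 rho)).
        { apply smooth_on_pdx. now apply HY. }
        now apply sq_between_x with x xi.
      * apply (HYxxB i j); auto. now apply sq_between_x with x xi.
    + apply Rmult_le_compat_l; [exact HB|]. now apply between_dist.
Qed.

(* The error e of the difference quotient in x against X v satisfies
   d e / d y = Y(x') e + f, where flatness makes f small with x' - x. *)
Lemma flat_sol_quotient x x' y : x' <> x -> sq x0 y0 rho (x, y) -> sq x0 y0 rho (x', y) ->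
  rsum N (fun i => Rabs ((flat_sol i x' y - flat_sol i x y) / (x' - x)
                         - rsum N (fun j => X i j x y * flat_sol j x y)))
  <= 2 * (rsum N (fun i => Rabs ((base_sol i x' - base_sol i x) / (x' - x)
                         - rsum N (fun j => X i j x y0 * base_sol j x)))
          + INR N * (2 * rho) * (B * (V + INR N * (B * V)) * Rabs (x' - x))).
Proof.
  intros Hne H H'. set (h := x' - x). assert (h0 : h <> 0) by (unfold h; lra).
  set (e := fun i s => (flat_sol i x' s - flat_sol i x s) / h
                       - rsum N (fun j => X i j x s * flat_sol j x s)).
  (* The remainder left after [Y i j x' s] applied to [e] is split off. Both sums are of size h: the
     first by [Y_quotient], the second by [Y_increment]. Difference quotients are used because
     differentiability of [flat_sol] in x is not yet known. *)
  set (f := fun i s => rsum N (fun j => ((Y i j x' s - Y i j x s) / h - pdx (Y i j) x s)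
                                        * flat_sol j x s)
            + rsum N (fun j => (Y i j x' s - Y i j x s)
                               * rsum N (fun k => X j k x s * flat_sol k x s))).
  assert (Hseg : forall t, Rmin y0 y <= t <= Rmax y0 y ->
                   sq x0 y0 rho (x, t) /\ sq x0 y0 rho (x', t)).
  { intros t Ht. destruct H as [Hx Hy], H' as [Hx' _]; simpl in *.
    split; split; simpl; auto;
      (eapply Rle_lt_trans; [apply between_dist; exact Ht | exact Hy]). }
  assert (V0 : 0 <= V).
  { unfold V. pose proof (rsum_abs_nonneg N c). lra. }
  replace (rsum N (fun i => Rabs ((base_sol i x' - base_sol i x) / h
                         - rsum N (fun j => X i j x y0 * base_sol j x))))
    with (rsum N (fun i => Rabs (e i y0))).
  2:{ apply rsum_ext; intros i Hi. unfold e. f_equal. rewrite !flat_sol_y0. f_equal.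
      apply rsum_ext; intros j Hj. now rewrite flat_sol_y0. }
  change (rsum N (fun i => Rabs (e i y)) <= 2 * (rsum N (fun i => Rabs (e i y0))
          + INR N * (2 * rho) * (B * (V + INR N * (B * V)) * Rabs h))).
  apply (gronwall_short N (fun i j t => Y i j x' t) f e y0 y B (2 * rho)); auto.
  - destruct H as [_ Hy]; simpl in Hy. lra.
  - intros i t Hi Ht. destruct (Hseg t Ht) as [Hs Hs']. split.
    + assert (Hd : is_derive (e i) t
        ((rsum N (fun j => Y i j x' t * flat_sol j x' t)
          - rsum N (fun j => Y i j x t * flat_sol j x t)) / h
         - rsum N (fun j => pdy (X i j) x t * flat_sol j x t
                            + X i j x t * rsum N (fun k => Y j k x t * flat_sol k x t)))).
      { unfold e. apply (is_derive_minus (V := R_NormedModule)).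
        - apply (is_derive_ext (fun s => / h * (flat_sol i x' s - flat_sol i x s))).
          { intros s. exact (Rmult_comm _ _). }
          replace ((rsum N (fun j => Y i j x' t * flat_sol j x' t)
             - rsum N (fun j => Y i j x t * flat_sol j x t)) / h)
            with (/ h * (rsum N (fun j => Y i j x' t * flat_sol j x' t)
             - rsum N (fun j => Y i j x t * flat_sol j x t))) by (unfold Rdiv; ring).
          apply is_derive_scal.
          apply (is_derive_minus (V := R_NormedModule)); now apply flat_sol_derive_y.
        - apply (is_derive_rsum N (fun j s => X i j x s * flat_sol j x s)
            (fun j t => pdy (X i j) x t * flat_sol j x t
                            + X i j x t * rsum N (fun k => Y j k x t * flat_sol k x t))).
          intros j Hj.
          apply (is_derive_mult (fun s => X i j x s) (fun s => flat_sol j x s));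
            [|now apply flat_sol_derive_y | intros; apply Rmult_comm].
          apply Derive_correct. apply (smooth_on_ex_y (sq x0 y0 rho)); auto. }
      replace (rsum N (fun j => Y i j x' t * e j t) + f i t) with
        ((rsum N (fun j => Y i j x' t * flat_sol j x' t)
          - rsum N (fun j => Y i j x t * flat_sol j x t)) / h
         - rsum N (fun j => pdy (X i j) x t * flat_sol j x t
                            + X i j x t * rsum N (fun k => Y j k x t * flat_sol k x t)));
        [exact Hd|].
      assert (Hflat : rsum N (fun j => pdy (X i j) x t * flat_sol j x t
                            + X i j x t * rsum N (fun k => Y j k x t * flat_sol k x t))
        = rsum N (fun j => pdx (Y i j) x t * flat_sol j x t
                            + Y i j x t * rsum N (fun k => X j k x t * flat_sol k x t))).
      { rewrite !rsum_plus.
        assert (Hsw : forall P Q : nat -> nat -> R -> R -> R,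
          rsum N (fun j => P i j x t * rsum N (fun k => Q j k x t * flat_sol k x t))
          = rsum N (fun k => rsum N (fun j => P i j x t * Q j k x t) * flat_sol k x t)).
        { intros P Q.
          rewrite (rsum_ext N _ (fun j => rsum N (fun k => P i j x t * Q j k x t * flat_sol k x t))).
          2:{ intros j Hj. rewrite <- rsum_scal. apply rsum_ext; intros; ring. }
          rewrite rsum_swap. apply rsum_ext; intros k Hk.
          rewrite Rmult_comm, <- rsum_scal. apply rsum_ext; intros; ring. }
        rewrite (Hsw X Y), (Hsw Y X), <- !rsum_plus. apply rsum_ext; intros j Hj.
        rewrite <- !Rmult_plus_distr_r. now rewrite flat. }
      rewrite Hflat. unfold f, e.
      assert (Hquo : forall A A', (rsum N A' - rsum N A) / h = rsum N (fun j => (A' j - A j) / h)).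
      { intros A A'. unfold Rdiv. rewrite Rmult_comm, <- rsum_minus, <- rsum_scal.
        apply rsum_ext; intros; ring. }
      rewrite Hquo, <- !rsum_plus, <- rsum_minus. apply rsum_ext; intros j Hj.
      set (S := rsum N _). field. exact h0.
    + unfold f. pose proof (flat_sol_bound x t Hs) as HV.
      assert (Hxv : forall j, (j < N)%nat ->
        Rabs (rsum N (fun k => X j k x t * flat_sol k x t)) <= B * V).
      { intros j Hj. eapply Rle_trans;
          [apply (rsum_linear_bound N (fun k => X j k x t) (fun k => flat_sol k x t) B)|].
        - intros k Hk. now apply HXB.
        - apply Rmult_le_compat_l; auto. }
      eapply Rle_trans; [apply Rabs_triang|].
      replace (B * (V + INR N * (B * V)) * Rabs h)
        with (B * Rabs h * V + B * Rabs h * (INR N * (B * V))) by ring.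
      assert (Bh : 0 <= B * Rabs h) by (apply Rmult_le_pos; [exact HB | apply Rabs_pos]).
      apply Rplus_le_compat.
      * eapply Rle_trans; [apply (rsum_linear_bound N _ (fun j => flat_sol j x t) (B * Rabs h))|].
        { intros j Hj. now apply Y_quotient. }
        now apply Rmult_le_compat_l.
      * eapply Rle_trans; [apply (rsum_linear_bound N _ _ (B * Rabs h))|].
        { intros j Hj. now apply Y_increment. }
        apply Rmult_le_compat_l; [exact Bh|]. rewrite <- rsum_const.
        apply rsum_le; intros j Hj. now apply Hxv.
  - intros i j t Hi Hj Ht. apply HYB; auto. now apply Hseg.
Qed.

Lemma flat_sol_derive_x i x y : (i < N)%nat -> sq x0 y0 rho (x, y) ->
  is_derive (fun t => flat_sol i t y) x (rsum N (fun j => X i j x y * flat_sol j x y)).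
Proof.
  intros Hi Hxy. apply is_derive_Reals. intros eps Heps.
  destruct Hxy as [Hx Hy]; simpl in Hx, Hy.
  set (K := INR N * (2 * rho) * (B * (V + INR N * (B * V)))).
  assert (K0 : 0 <= K).
  { assert (0 <= V) by (unfold V; pose proof (rsum_abs_nonneg N c); lra).
    pose proof (pos_INR N). unfold K.
    apply Rmult_le_pos; [apply Rmult_le_pos; lra|]. apply Rmult_le_pos; [lra|].
    apply Rplus_le_le_0_compat; [lra|]. apply Rmult_le_pos; [lra|]. apply Rmult_le_pos; lra. }
  (* The estimate of [flat_sol_quotient] is twice a sum of two terms; [eta] and the bound on h below
     keep each of them under [eps / 4]. *)
  set (eta := eps / (4 * (INR N + 1))).
  pose proof (pos_INR N) as HN.
  assert (Heta : 0 < eta) by (apply Rdiv_lt_0_compat; lra).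
  destruct (finite_bound N (fun j b d => forall h, h <> 0 -> Rabs h < d ->
     Rabs ((base_sol j (x + h) - base_sol j x) / h
           - rsum N (fun k => X j k x y0 * base_sol k x)) < eta)) as [_ [d [_ [Hd Hbase]]]].
  { intros j b b' d d' _ Hdd H h Hh Hhd. apply H; auto; lra. }
  { intros j Hj. pose proof (base_sol_derive j x Hj Hx) as Hder.
    apply is_derive_Reals in Hder. destruct (Hder eta Heta) as [d Hd].
    exists 0, d. split; [apply cond_pos|]. exact Hd. }
  set (d' := Rmin d (Rmin (rho - Rabs (x - x0)) (eps / (4 * (K + 1))))).
  assert (Hd' : 0 < d').
  { unfold d'. repeat apply Rmin_glb_lt; try lra. apply Rdiv_lt_0_compat; lra. }
  exists (mkposreal d' Hd'). intros h Hh Hhd; simpl in Hhd.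
  assert (h1 : Rabs h < d) by (eapply Rlt_le_trans; [exact Hhd | apply Rmin_l]).
  assert (h2 : Rabs h < rho - Rabs (x - x0)).
  { eapply Rlt_le_trans; [exact Hhd|]. eapply Rle_trans; [apply Rmin_r | apply Rmin_l]. }
  assert (h3 : Rabs h < eps / (4 * (K + 1))).
  { eapply Rlt_le_trans; [exact Hhd|]. eapply Rle_trans; [apply Rmin_r | apply Rmin_r]. }
  assert (Hs : sq x0 y0 rho (x, y)) by (split; assumption).
  assert (Hs' : sq x0 y0 rho (x + h, y)).
  { split; simpl; [|exact Hy]. replace (x + h - x0) with ((x - x0) + h) by ring.
    eapply Rle_lt_trans; [apply Rabs_triang|]. lra. }
  pose proof (flat_sol_quotient x (x + h) y ltac:(lra) Hs Hs') as HQ.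
  replace (x + h - x) with h in HQ by ring.
  eapply Rle_lt_trans.
  { apply (rsum_term N (fun i => (flat_sol i (x + h) y - flat_sol i x y) / h
                         - rsum N (fun j => X i j x y * flat_sol j x y)) i Hi). }
  eapply Rle_lt_trans; [exact HQ|].
  assert (Hb : rsum N (fun i => Rabs ((base_sol i (x + h) - base_sol i x) / h
                         - rsum N (fun j => X i j x y0 * base_sol j x))) <= INR N * eta).
  { rewrite <- rsum_const. apply rsum_le; intros j Hj. apply Rlt_le. now apply Hbase. }
  assert (He : INR N * eta < eps / 4).
  { unfold eta. apply Rmult_lt_reg_r with (4 * (INR N + 1)); [lra|].
    replace (INR N * (eps / (4 * (INR N + 1))) * (4 * (INR N + 1))) with (INR N * eps)
      by (field; lra).
    nra. }
  assert (HK : K * Rabs h < eps / 4).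
  { apply Rle_lt_trans with (K * (eps / (4 * (K + 1)))).
    - apply Rmult_le_compat_l; lra.
    - apply Rmult_lt_reg_r with (4 * (K + 1)); [lra|].
      replace (K * (eps / (4 * (K + 1))) * (4 * (K + 1))) with (K * eps) by (field; lra).
      nra. }
  unfold K in HK. lra.
Qed.

Lemma flat_sol_parallel : parallel flat_sol.
Proof. intros i x y Hi H; split; [now apply flat_sol_derive_x | now apply flat_sol_derive_y]. Qed.

(** The partial derivatives of a bounded parallel section are at most [B * W], so it is Lipschitz.
    Joint continuity is the starting point for [smooth_on_system]. *)
Lemma parallel_continuous z W : (forall x y, sq x0 y0 rho (x, y) ->
    rsum N (fun i => Rabs (z i x y)) <= W) -> parallel z ->
  forall i x y, (i < N)%nat -> sq x0 y0 rho (x, y) -> continuity_2d_pt (z i) x y.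
Proof.
  intros HW Hz i x y Hi Hxy eps.
  set (K := B * W). assert (W0 : 0 <= W).
  { eapply Rle_trans; [apply rsum_abs_nonneg | apply (HW x y Hxy)]. }
  assert (K0 : 0 <= K) by (apply Rmult_le_pos; assumption).
  destruct (open_locally_2d _ _ _ (sq_open x0 y0 rho) Hxy) as [d0 Hd0].
  pose proof (cond_pos eps). pose proof (cond_pos d0).
  assert (Hd : 0 < Rmin d0 (eps / (2 * K + 1))).
  { apply Rmin_glb_lt; [assumption|]. apply Rdiv_lt_0_compat; lra. }
  exists (mkposreal _ Hd). intros u v Hu Hv; simpl in Hu, Hv.
  pose proof (Rmin_l d0 (eps / (2 * K + 1))). pose proof (Rmin_r d0 (eps / (2 * K + 1))).
  assert (Huv : sq x0 y0 rho (u, v)) by (apply Hd0; lra).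
  assert (Hxv : sq x0 y0 rho (x, v)) by (destruct Hxy, Huv; now split).
  assert (E1 : Rabs (z i u v - z i x v) <= K * Rabs (u - x)).
  { apply (mean_value_bound (fun t => z i t v)
             (fun t => rsum N (fun j => X i j t v * z j t v))); intros t Ht;
      assert (Ht' : sq x0 y0 rho (t, v)) by (now apply sq_between_x with x u).
    - now apply Hz.
    - eapply Rle_trans; [apply (rsum_linear_bound N (fun j => X i j t v) (fun j => z j t v) B)|].
      + intros j Hj. now apply HXB.
      + apply Rmult_le_compat_l; auto. }
  assert (E2 : Rabs (z i x v - z i x y) <= K * Rabs (v - y)).
  { apply (mean_value_bound (fun t => z i x t)
             (fun t => rsum N (fun j => Y i j x t * z j x t))); intros t Ht;
      assert (Ht' : sq x0 y0 rho (x, t)) by (now apply sq_between_y with y v).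
    - now apply Hz.
    - eapply Rle_trans; [apply (rsum_linear_bound N (fun j => Y i j x t) (fun j => z j x t) B)|].
      + intros j Hj. now apply HYB.
      + apply Rmult_le_compat_l; auto. }
  set (q := eps / (2 * K + 1)) in *.
  assert (Hq : q * (2 * K + 1) = eps) by (unfold q; field; lra).
  assert (0 < q) by (apply Rdiv_lt_0_compat; lra).
  replace (z i u v - z i x y) with ((z i u v - z i x v) + (z i x v - z i x y)) by ring.
  eapply Rle_lt_trans; [apply Rabs_triang|].
  assert (K * Rabs (u - x) <= K * q) by (apply Rmult_le_compat_l; lra).
  assert (K * Rabs (v - y) <= K * q) by (apply Rmult_le_compat_l; lra).
  lra.
Qed.

Lemma Cn_on_rsum D (oD : open D) n K (F : nat -> R -> R -> R) :
  (forall j, (j < K)%nat -> Cn_on D n (F j)) ->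
  Cn_on D n (fun x y => rsum K (fun j => F j x y)).
Proof.
  induction K as [|K IH]; intros H; simpl; [now apply Cn_on_const|].
  apply Cn_on_plus; auto.
Qed.

Lemma flat_sol_smooth i : (i < N)%nat -> smooth_on (sq x0 y0 rho) (flat_sol i).
Proof.
  intros Hi.
  apply (smooth_on_system (sq x0 y0 rho) (sq_open _ _ _) N flat_sol
    (fun i x y => rsum N (fun j => X i j x y * flat_sol j x y))
    (fun i x y => rsum N (fun j => Y i j x y * flat_sol j x y))); [| |exact Hi].
  - intros k Hk x y Hxy. split.
    + apply (parallel_continuous flat_sol V); auto; [exact flat_sol_bound | exact flat_sol_parallel].
    + now apply flat_sol_parallel.
  - intros n H k Hk. split.
    + apply (Cn_on_rsum _ (sq_open _ _ _) n N (fun j x y => X k j x y * flat_sol j x y)).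
      intros j Hj. apply Cn_on_mult; [apply sq_open | | now apply H].
      apply smooth_on_Cn. now apply HX.
    + apply (Cn_on_rsum _ (sq_open _ _ _) n N (fun j x y => Y k j x y * flat_sol j x y)).
      intros j Hj. apply Cn_on_mult; [apply sq_open | | now apply H].
      apply smooth_on_Cn. now apply HY.
Qed.

End Transport.

Lemma smooth_on_sub (D D' : R * R -> Prop) f :
  (forall p, D' p -> D p) -> smooth_on D f -> smooth_on D' f.
Proof. intros H Hf x y Hxy. now apply Hf, H. Qed.

Lemma small_square N b : 0 <= b -> exists rho, 0 < rho /\ INR N * b * (2 * rho) <= 1 / 2.
Proof.
  intros Hb. pose proof (Rmult_le_pos _ _ (pos_INR N) Hb) as H0.
  exists (/ (4 * (INR N * b + 1))). split; [apply Rinv_0_lt_compat; lra|].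
  apply Rmult_le_reg_r with (4 * (INR N * b + 1)); [lra|].
  replace (INR N * b * (2 * / (4 * (INR N * b + 1))) * (4 * (INR N * b + 1)))
    with (2 * (INR N * b)) by (field; lra).
  lra.
Qed.

Theorem parallel_unique_near N X Y x0 y0 r : 0 < r ->
  (forall i j, (i < N)%nat -> (j < N)%nat -> smooth_on (sq x0 y0 r) (X i j)) ->
  (forall i j, (i < N)%nat -> (j < N)%nat -> smooth_on (sq x0 y0 r) (Y i j)) ->
  exists rho, 0 < rho <= r /\ forall z x1 y1, parallel N X Y x0 y0 rho z ->
    sq x0 y0 rho (x1, y1) -> (forall i, (i < N)%nat -> z i x1 y1 = 0) ->
    forall i x y, (i < N)%nat -> sq x0 y0 rho (x, y) -> z i x y = 0.
Proof.
  intros Hr HX HY.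
  assert (Hc : sq x0 y0 r (x0, y0)) by now apply sq_center.
  destruct (local_bound N X x0 y0) as [b1 [d1 [Hb1 [Hd1 H1]]]].
  { intros i j Hi Hj. apply (smooth_on_cont (sq x0 y0 r)); auto. }
  destruct (local_bound N Y x0 y0) as [b2 [d2 [Hb2 [Hd2 H2]]]].
  { intros i j Hi Hj. apply (smooth_on_cont (sq x0 y0 r)); auto. }
  destruct (small_square N (b1 + b2)) as [d3 [Hd3 Hsm]]; [lra|].
  set (rho := Rmin (Rmin d1 d2) (Rmin d3 r)).
  assert (Hrho : 0 < rho) by (repeat apply Rmin_glb_lt; assumption).
  assert (L1 : rho <= d1) by (eapply Rle_trans; [apply Rmin_l | apply Rmin_l]).
  assert (L2 : rho <= d2) by (eapply Rle_trans; [apply Rmin_l | apply Rmin_r]).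
  assert (L3 : rho <= d3) by (eapply Rle_trans; [apply Rmin_r | apply Rmin_l]).
  assert (L4 : rho <= r) by (eapply Rle_trans; [apply Rmin_r | apply Rmin_r]).
  exists rho. split; [lra|]. intros z x1 y1 Hz Hp Hz1.
  apply (parallel_unique N X Y x0 y0 rho (b1 + b2)) with (x1 := x1) (y1 := y1); auto.
  - lra.
  - eapply Rle_trans; [|exact Hsm]. apply Rmult_le_compat_l; [|lra].
    apply Rmult_le_pos; [apply pos_INR | lra].
  - intros i j x y Hi Hj Hxy. apply Rle_trans with b1; [|lra].
    apply H1; auto. now apply sq_le with rho.
  - intros i j x y Hi Hj Hxy. apply Rle_trans with b2; [|lra].
    apply H2; auto. now apply sq_le with rho.
Qed.

(** Linearity allows the square to be chosen before the initial value [c], so that a whole basis of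
    parallel sections lives on one square. The bounds on two x-derivatives of [Y] serve the
    difference quotients. *)
Theorem frobenius_linear N X Y x0 y0 r : 0 < r ->
  (forall i j, (i < N)%nat -> (j < N)%nat -> smooth_on (sq x0 y0 r) (X i j)) ->
  (forall i j, (i < N)%nat -> (j < N)%nat -> smooth_on (sq x0 y0 r) (Y i j)) ->
  (forall i j x y, (i < N)%nat -> (j < N)%nat -> sq x0 y0 r (x, y) ->
    pdy (X i j) x y + rsum N (fun k => X i k x y * Y k j x y)
    = pdx (Y i j) x y + rsum N (fun k => Y i k x y * X k j x y)) ->
  exists rho, 0 < rho <= r /\ forall c : nat -> R, exists z,
    (forall i, z i x0 y0 = c i) /\
    (forall i, (i < N)%nat -> smooth_on (sq x0 y0 rho) (z i)) /\
    parallel N X Y x0 y0 rho z.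
Proof.
  intros Hr HX HY Hflat.
  assert (Hc : sq x0 y0 r (x0, y0)) by now apply sq_center.
  destruct (local_bound N X x0 y0) as [b1 [d1 [Hb1 [Hd1 H1]]]].
  { intros i j Hi Hj. apply (smooth_on_cont (sq x0 y0 r)); auto. }
  destruct (local_bound N Y x0 y0) as [b2 [d2 [Hb2 [Hd2 H2]]]].
  { intros i j Hi Hj. apply (smooth_on_cont (sq x0 y0 r)); auto. }
  destruct (local_bound N (fun i j => pdx (Y i j)) x0 y0) as [b3 [d3 [Hb3 [Hd3 H3]]]].
  { intros i j Hi Hj. apply (smooth_on_cont (sq x0 y0 r)); auto. apply smooth_on_pdx; auto. }
  destruct (local_bound N (fun i j => pdx (pdx (Y i j))) x0 y0) as [b4 [d4 [Hb4 [Hd4 H4]]]].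
  { intros i j Hi Hj. apply (smooth_on_cont (sq x0 y0 r)); auto.
    apply smooth_on_pdx, smooth_on_pdx; auto. }
  destruct (small_square N (b1 + b2 + b3 + b4)) as [d5 [Hd5 Hsm]]; [lra|].
  set (rho := Rmin (Rmin (Rmin d1 d2) (Rmin d3 d4)) (Rmin d5 r)).
  assert (Hrho : 0 < rho) by (repeat apply Rmin_glb_lt; assumption).
  assert (L1 : rho <= d1).
  { eapply Rle_trans; [apply Rmin_l|]. eapply Rle_trans; [apply Rmin_l | apply Rmin_l]. }
  assert (L2 : rho <= d2).
  { eapply Rle_trans; [apply Rmin_l|]. eapply Rle_trans; [apply Rmin_l | apply Rmin_r]. }
  assert (L3 : rho <= d3).
  { eapply Rle_trans; [apply Rmin_l|]. eapply Rle_trans; [apply Rmin_r | apply Rmin_l]. }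
  assert (L4 : rho <= d4).
  { eapply Rle_trans; [apply Rmin_l|]. eapply Rle_trans; [apply Rmin_r | apply Rmin_r]. }
  assert (L5 : rho <= d5) by (eapply Rle_trans; [apply Rmin_r | apply Rmin_l]).
  assert (L6 : rho <= r) by (eapply Rle_trans; [apply Rmin_r | apply Rmin_r]).
  set (B := b1 + b2 + b3 + b4) in *.
  assert (HB : 0 <= B) by (unfold B; lra).
  assert (HNB : INR N * B * (2 * rho) <= 1 / 2).
  { eapply Rle_trans; [|exact Hsm]. apply Rmult_le_compat_l; [|lra].
    apply Rmult_le_pos; [apply pos_INR | lra]. }
  assert (HX' : forall i j, (i < N)%nat -> (j < N)%nat -> smooth_on (sq x0 y0 rho) (X i j)).
  { intros i j Hi Hj. apply smooth_on_sub with (2 := HX i j Hi Hj).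
    intros p; now apply sq_le. }
  assert (HY' : forall i j, (i < N)%nat -> (j < N)%nat -> smooth_on (sq x0 y0 rho) (Y i j)).
  { intros i j Hi Hj. apply smooth_on_sub with (2 := HY i j Hi Hj).
    intros p; now apply sq_le. }
  assert (B1 : bounded_on N (sq x0 y0 rho) B X).
  { intros i j x y Hi Hj Hxy. apply Rle_trans with b1; [|unfold B; lra].
    apply H1; auto. now apply sq_le with rho. }
  assert (B2 : bounded_on N (sq x0 y0 rho) B Y).
  { intros i j x y Hi Hj Hxy. apply Rle_trans with b2; [|unfold B; lra].
    apply H2; auto. now apply sq_le with rho. }
  assert (B3 : bounded_on N (sq x0 y0 rho) B (fun i j => pdx (Y i j))).
  { intros i j x y Hi Hj Hxy. apply Rle_trans with b3; [|unfold B; lra].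
    apply (H3 i j); auto. now apply sq_le with rho. }
  assert (B4 : bounded_on N (sq x0 y0 rho) B (fun i j => pdx (pdx (Y i j)))).
  { intros i j x y Hi Hj Hxy. apply Rle_trans with b4; [|unfold B; lra].
    apply (H4 i j); auto. now apply sq_le with rho. }
  assert (Hflat' : forall i j x y, (i < N)%nat -> (j < N)%nat -> sq x0 y0 rho (x, y) ->
    pdy (X i j) x y + rsum N (fun k => X i k x y * Y k j x y)
    = pdx (Y i j) x y + rsum N (fun k => Y i k x y * X k j x y)).
  { intros i j x y Hi Hj Hxy. apply Hflat; auto. now apply sq_le with rho. }
  exists rho. split; [lra|]. intros c. exists (flat_sol N X Y x0 y0 c). split; [|split].
  - intros i. apply flat_sol_center.
  - intros i Hi. now apply (flat_sol_smooth N X Y x0 y0 rho B).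
  - now apply (flat_sol_parallel N X Y x0 y0 rho B).
Qed.

(** * The ring of smooth functions on a square *)

Record square := Square { sq_x : R; sq_y : R; sq_r : R; sq_pos : 0 < sq_r }.
Definition dom (s : square) : R * R -> Prop := sq (sq_x s) (sq_y s) (sq_r s).

Lemma dom_open s : open (dom s).
Proof. apply sq_open. Qed.

Lemma dom_center s : dom s (sq_x s, sq_y s).
Proof. apply sq_center, sq_pos. Qed.

(* Smooth functions on a square, represented by their extension by zero. *)
Record sfun (s : square) := SFun {
  sfv : R -> R -> R;
  sfv_smooth : smooth_on (dom s) sfv;
  sfv_out : forall x y, ~ dom s (x, y) -> sfv x y = 0 }.
Arguments SFun {s}.
Arguments sfv {s}.
Arguments sfv_smooth {s}.
Arguments sfv_out {s}.

Section SFunOps.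
Variable s : square.

(** Values off the square are fixed to be zero, so agreement on the square is Leibniz equality. The
    ring axioms and the division-free algebra below rest on this. *)
Lemma sfun_eq (f g : sfun s) :
  (forall x y, dom s (x, y) -> sfv f x y = sfv g x y) -> f = g.
Proof.
  intros H. destruct f as [f f1 f2], g as [g g1 g2]; simpl in H.
  assert (E : f = g).
  { apply functional_extensionality; intros x; apply functional_extensionality; intros y.
    destruct (classic (dom s (x, y))) as [Hd|Hd]; [now apply H|]. now rewrite f2, g2. }
  subst g. f_equal; apply proof_irrelevance.
Qed.

Definition cut (f : R -> R -> R) (x y : R) : R :=
  if excluded_middle_informative (dom s (x, y)) then f x y else 0.

Lemma cut_eq f : eq_on (dom s) f (cut f).
Proof.
  intros x y H. unfold cut. destruct (excluded_middle_informative _); [reflexivity | contradiction].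
Qed.

Lemma cut_out f x y : ~ dom s (x, y) -> cut f x y = 0.
Proof.
  intros H. unfold cut. destruct (excluded_middle_informative _); [contradiction | reflexivity].
Qed.

Definition smk (f : R -> R -> R) (H : smooth_on (dom s) f) : sfun s :=
  SFun (cut f) (smooth_on_ext _ (dom_open s) _ _ (cut_eq f) H) (cut_out f).

Lemma smkE f H x y : dom s (x, y) -> sfv (smk f H) x y = f x y.
Proof. intros Hd. symmetry. now apply cut_eq. Qed.

Definition szero : sfun s := SFun (fun _ _ => 0) (smooth_on_const _ (dom_open s) 0) (fun _ _ _ => eq_refl).
Definition sconst (c : R) : sfun s := smk (fun _ _ => c) (smooth_on_const _ (dom_open s) c).
Definition splus (f g : sfun s) : sfun s :=
  SFun (fun x y => sfv f x y + sfv g x y)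
    (smooth_on_plus _ (dom_open s) _ _ (sfv_smooth f) (sfv_smooth g))
    (fun x y H => eq_trans (f_equal2 Rplus (sfv_out f x y H) (sfv_out g x y H)) (Rplus_0_l 0)).
Definition smult (f g : sfun s) : sfun s :=
  SFun (fun x y => sfv f x y * sfv g x y)
    (smooth_on_mult _ (dom_open s) _ _ (sfv_smooth f) (sfv_smooth g))
    (fun x y H => eq_trans (f_equal2 Rmult (sfv_out f x y H) (sfv_out g x y H)) (Rmult_0_l 0)).
Definition sopp (f : sfun s) : sfun s := smult (sconst (-1)) f.
Definition spdx (f : sfun s) : sfun s := smk (pdx (sfv f)) (smooth_on_pdx _ _ (sfv_smooth f)).
Definition spdy (f : sfun s) : sfun s := smk (pdy (sfv f)) (smooth_on_pdy _ _ (sfv_smooth f)).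

Lemma sconstE c x y : dom s (x, y) -> sfv (sconst c) x y = c.
Proof. apply smkE. Qed.
Lemma spdxE f x y : dom s (x, y) -> sfv (spdx f) x y = pdx (sfv f) x y.
Proof. apply smkE. Qed.
Lemma spdyE f x y : dom s (x, y) -> sfv (spdy f) x y = pdy (sfv f) x y.
Proof. apply smkE. Qed.

Lemma splusA f g h : splus f (splus g h) = splus (splus f g) h.
Proof. apply sfun_eq; intros; simpl; ring. Qed.
Lemma splusC f g : splus f g = splus g f.
Proof. apply sfun_eq; intros; simpl; ring. Qed.
Lemma splus0 f : splus szero f = f.
Proof. apply sfun_eq; intros; simpl; ring. Qed.
Lemma splusN f : splus (sopp f) f = szero.
Proof. apply sfun_eq; intros x y H; unfold sopp; cbn -[sconst]; rewrite sconstE by exact H; ring. Qed.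
Lemma smultA f g h : smult f (smult g h) = smult (smult f g) h.
Proof. apply sfun_eq; intros; simpl; ring. Qed.
Lemma smultC f g : smult f g = smult g f.
Proof. apply sfun_eq; intros; simpl; ring. Qed.
Lemma smult1 f : smult (sconst 1) f = f.
Proof. apply sfun_eq; intros x y H; cbn -[sconst]; rewrite sconstE by exact H; ring. Qed.
Lemma smultD f g h : smult (splus f g) h = splus (smult f h) (smult g h).
Proof. apply sfun_eq; intros; simpl; ring. Qed.
Lemma sconst1_neq0 : sconst 1 <> szero.
Proof.
  intros E. apply (f_equal (fun f => sfv f (sq_x s) (sq_y s))) in E.
  rewrite sconstE in E by apply dom_center. simpl in E. lra.
Qed.
Lemma spdxD f g : spdx (splus f g) = splus (spdx f) (spdx g).
Proof.
  apply sfun_eq; intros x y H. cbn -[spdx]. rewrite !spdxE by exact H.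
  apply (pdx_plus (dom s)); auto using sfv_smooth.
Qed.
Lemma spdyD f g : spdy (splus f g) = splus (spdy f) (spdy g).
Proof.
  apply sfun_eq; intros x y H. cbn -[spdy]. rewrite !spdyE by exact H.
  apply (pdy_plus (dom s)); auto using sfv_smooth.
Qed.
Lemma spdxM f g : spdx (smult f g) = splus (smult (spdx f) g) (smult f (spdx g)).
Proof.
  apply sfun_eq; intros x y H. cbn -[spdx]. rewrite !spdxE by exact H.
  apply (pdx_mult (dom s)); auto using sfv_smooth.
Qed.
Lemma spdyM f g : spdy (smult f g) = splus (smult (spdy f) g) (smult f (spdy g)).
Proof.
  apply sfun_eq; intros x y H. cbn -[spdy]. rewrite !spdyE by exact H.
  apply (pdy_mult (dom s)); auto using sfv_smooth.
Qed.
Lemma spdx_spdy f : spdx (spdy f) = spdy (spdx f).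
Proof.
  apply sfun_eq; intros x y H. rewrite spdxE, spdyE by exact H.
  rewrite <- (pdx_ext (dom s) (dom_open s) (pdy (sfv f)) (sfv (spdy f)) (cut_eq _) x y H).
  rewrite <- (pdy_ext (dom s) (dom_open s) (pdx (sfv f)) (sfv (spdx f)) (cut_eq _) x y H).
  apply (pdx_pdy (dom s) (dom_open s)); auto using sfv_smooth.
Qed.
Lemma spdx_const c : spdx (sconst c) = szero.
Proof.
  apply sfun_eq; intros x y H. rewrite spdxE by exact H.
  rewrite <- (pdx_ext (dom s) (dom_open s) (fun _ _ => c) (sfv (sconst c)) (cut_eq _) x y H).
  exact (Derive_const _ _).
Qed.
Lemma spdy_const c : spdy (sconst c) = szero.
Proof.
  apply sfun_eq; intros x y H. rewrite spdyE by exact H.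
  rewrite <- (pdy_ext (dom s) (dom_open s) (fun _ _ => c) (sfv (sconst c)) (cut_eq _) x y H).
  exact (Derive_const _ _).
Qed.

(** Nowhere vanishing functions are units; this is the form in which the general position of the web
    enters the algebra. *)
Lemma sfun_inverse (f : sfun s) : (forall x y, dom s (x, y) -> sfv f x y <> 0) ->
  exists g, smult f g = sconst 1.
Proof.
  intros H. exists (smk _ (smooth_on_inv _ (dom_open s) _ H (sfv_smooth f))).
  apply sfun_eq; intros x y Hd. rewrite sconstE by exact Hd. cbn -[smk].
  rewrite smkE by exact Hd. apply Rinv_r. now apply H.
Qed.

Definition sfst (c : R) : sfun s := smk (fun x _ => x + - c)
  (smooth_on_plus _ (dom_open s) _ _ (smooth_on_fst _ (dom_open s)) (smooth_on_const _ (dom_open s) (- c))).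
Definition ssnd (c : R) : sfun s := smk (fun _ y => y + - c)
  (smooth_on_plus _ (dom_open s) _ _ (smooth_on_snd _ (dom_open s)) (smooth_on_const _ (dom_open s) (- c))).

Lemma spdx_fst c : spdx (sfst c) = sconst 1.
Proof.
  apply sfun_eq; intros x y H. rewrite spdxE, sconstE by exact H.
  rewrite <- (pdx_ext (dom s) (dom_open s) _ (sfv (sfst c)) (cut_eq _) x y H).
  apply is_derive_unique. auto_derive; [exact I | ring].
Qed.
Lemma spdy_fst c : spdy (sfst c) = szero.
Proof.
  apply sfun_eq; intros x y H. rewrite spdyE by exact H.
  rewrite <- (pdy_ext (dom s) (dom_open s) _ (sfv (sfst c)) (cut_eq _) x y H).
  exact (Derive_const _ _).
Qed.
Lemma spdx_snd c : spdx (ssnd c) = szero.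
Proof.
  apply sfun_eq; intros x y H. rewrite spdxE by exact H.
  rewrite <- (pdx_ext (dom s) (dom_open s) _ (sfv (ssnd c)) (cut_eq _) x y H).
  exact (Derive_const _ _).
Qed.
Lemma spdy_snd c : spdy (ssnd c) = sconst 1.
Proof.
  apply sfun_eq; intros x y H. rewrite spdyE, sconstE by exact H.
  rewrite <- (pdy_ext (dom s) (dom_open s) _ (sfv (ssnd c)) (cut_eq _) x y H).
  apply is_derive_unique. auto_derive; [exact I | ring].
Qed.

End SFunOps.

Arguments smk {s}.
Arguments spdx {s}.
Arguments spdy {s}.
Arguments smkE {s}.
Arguments spdxE {s}.
Arguments spdyE {s}.

Definition sof (s : square) (f : R -> R -> R) : sfun s :=
  match excluded_middle_informative (smooth_on (dom s) f) with
  | left H => smk f H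
  | right _ => szero s
  end.

(** The bridge between the total functions of the statement, meaningful only on the domain, and
    elements of the ring. *)
Definition rep (s : square) (u : R -> R -> R) (f : sfun s) : Prop := eq_on (dom s) u (sfv f).
Arguments rep {s}.

Lemma rep_sof s f : smooth_on (dom s) f -> rep f (sof s f).
Proof.
  intros H. unfold sof. destruct (excluded_middle_informative _) as [H'|H']; [|contradiction].
  intros x y Hd. symmetry. now apply smkE.
Qed.

Lemma rep_smooth s u (f : sfun s) : rep u f -> smooth_on (dom s) u.
Proof.
  intros H. apply (smooth_on_ext (dom s) (dom_open s) (sfv f)); [|apply sfv_smooth].
  intros x y Hd; symmetry; now apply H.
Qed.

Lemma rep_pdx s u (f : sfun s) : rep u f -> rep (pdx u) (spdx f).
Proof.
  intros H x y Hd. rewrite spdxE by exact Hd. now apply (pdx_ext (dom s) (dom_open s)).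
Qed.

Lemma rep_pdy s u (f : sfun s) : rep u f -> rep (pdy u) (spdy f).
Proof.
  intros H x y Hd. rewrite spdyE by exact Hd. now apply (pdy_ext (dom s) (dom_open s)).
Qed.

Lemma rep_iter s m n u (f : sfun s) : rep u f ->
  rep (partial_derive m n u) (Nat.iter m spdx (Nat.iter n spdy f)).
Proof.
  intros H. rewrite partial_derive_iter.
  assert (H1 : rep (Nat.iter n pdy u) (Nat.iter n spdy f)).
  { induction n as [|n IH]; [exact H|]. now apply rep_pdy. }
  induction m as [|m IH]; [exact H1|]. now apply rep_pdx.
Qed.

Lemma rep_plus s u v (f g : sfun s) : rep u f -> rep v g ->
  rep (fun x y => u x y + v x y) (splus s f g).
Proof. intros Hf Hg x y H. simpl. now rewrite Hf, Hg. Qed.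

Lemma rep_mult s u v (f g : sfun s) : rep u f -> rep v g ->
  rep (fun x y => u x y * v x y) (smult s f g).
Proof. intros Hf Hg x y H. simpl. now rewrite Hf, Hg. Qed.

(** * The frame and the abelian equation *)

Section WebOnSquare.
Variables (d : nat) (D : R * R -> Prop) (om : nat -> one_form)
  (a : nat -> R -> R -> R) (gam : one_form).
Hypothesis hd : (3 <= d)%nat.
Hypothesis hweb : is_web d D om.
Hypothesis hnorm : is_normalized d D om a.
Hypothesis hgam : is_chern_connection D om gam.
Variable s : square.
Hypothesis Hs : forall p, dom s p -> D p.

Definition al1 := sof s (dx_coef (om 1%nat)).
Definition be1 := sof s (dy_coef (om 1%nat)).
Definition al2 := sof s (dx_coef (om 2%nat)).
Definition be2 := sof s (dy_coef (om 2%nat)).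
Definition gax := sof s (dx_coef gam).
Definition gay := sof s (dy_coef gam).
Definition inva (i : nat) := sof s (a (S i)).
Definition winv := sof s (fun x y => / wedge (om 1%nat) (om 2%nat) x y).

Lemma smooth_om i : (1 <= i <= d)%nat ->
  smooth_on (dom s) (dx_coef (om i)) /\ smooth_on (dom s) (dy_coef (om i)).
Proof.
  intros Hi. split; intros x y H; destruct (hweb x y (Hs _ H)) as [H1 _];
    destruct (H1 i Hi) as [[? ?] _]; assumption.
Qed.

Lemma rep_al1 : rep (dx_coef (om 1%nat)) al1.
Proof. apply rep_sof, smooth_om; lia. Qed.
Lemma rep_be1 : rep (dy_coef (om 1%nat)) be1.
Proof. apply rep_sof, smooth_om; lia. Qed.
Lemma rep_al2 : rep (dx_coef (om 2%nat)) al2.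
Proof. apply rep_sof, smooth_om; lia. Qed.
Lemma rep_be2 : rep (dy_coef (om 2%nat)) be2.
Proof. apply rep_sof, smooth_om; lia. Qed.
Lemma rep_gax : rep (dx_coef gam) gax.
Proof. apply rep_sof; intros x y H; now destruct (hgam x y (Hs _ H)) as [[? ?] _]. Qed.
Lemma rep_gay : rep (dy_coef gam) gay.
Proof. apply rep_sof; intros x y H; now destruct (hgam x y (Hs _ H)) as [[? ?] _]. Qed.
Lemma rep_inva i : (i < d - 2)%nat -> rep (a (S i)) (inva i).
Proof.
  intros Hi. apply rep_sof; intros x y H.
  destruct (hnorm x y (Hs _ H)) as [H1 _]. apply H1. lia.
Qed.

Lemma w_neq0 x y : dom s (x, y) -> wedge (om 1%nat) (om 2%nat) x y <> 0.
Proof. intros H. destruct (hweb x y (Hs _ H)) as [_ H1]. apply H1; lia. Qed.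

Definition wdg : sfun s := splus s (smult s al1 be2) (sopp s (smult s be1 al2)).

Lemma rep_opp u (f : sfun s) : rep u f -> rep (fun x y => - u x y) (sopp s f).
Proof.
  intros H x y Hd. unfold sopp. cbn -[sconst]. rewrite sconstE, <- H by exact Hd. ring.
Qed.

Lemma rep_wdg : rep (wedge (om 1%nat) (om 2%nat)) wdg.
Proof.
  exact (rep_plus s _ _ _ _ (rep_mult s _ _ _ _ rep_al1 rep_be2)
     (rep_opp _ _ (rep_mult s _ _ _ _ rep_be1 rep_al2))).
Qed.

Lemma rep_winv : rep (fun x y => / wedge (om 1%nat) (om 2%nat) x y) winv.
Proof.
  apply rep_sof. apply smooth_on_inv; [apply dom_open | exact w_neq0 |].
  exact (rep_smooth _ _ _ rep_wdg).
Qed.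

Lemma winv_wdg : smult s winv wdg = sconst s 1.
Proof.
  apply sfun_eq; intros x y H. cbn -[wdg winv sconst]. rewrite sconstE by exact H.
  rewrite <- rep_winv, <- rep_wdg by exact H. apply Rinv_l. now apply w_neq0.
Qed.

Definition sg1 : sfun s := smult s winv (splus s (smult s gax be2) (sopp s (smult s gay al2))).
Definition sg2 : sfun s := smult s winv (splus s (smult s al1 gay) (sopp s (smult s be1 gax))).

Lemma rep_g1 : rep (coef1 om gam) sg1.
Proof.
  intros x y H. unfold sg1. change (coef1 om gam x y =
    sfv winv x y * sfv (splus s (smult s gax be2) (sopp s (smult s gay al2))) x y).
  rewrite <- (rep_winv x y H).
  rewrite <- (rep_plus s _ _ _ _ (rep_mult s _ _ _ _ rep_gax rep_be2)
     (rep_opp _ _ (rep_mult s _ _ _ _ rep_gay rep_al2)) x y H).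
  unfold coef1, Rdiv. rewrite Rmult_comm. f_equal.
Qed.

Lemma rep_g2 : rep (coef2 om gam) sg2.
Proof.
  intros x y H. unfold sg2. change (coef2 om gam x y =
    sfv winv x y * sfv (splus s (smult s al1 gay) (sopp s (smult s be1 gax))) x y).
  rewrite <- (rep_winv x y H).
  rewrite <- (rep_plus s _ _ _ _ (rep_mult s _ _ _ _ rep_al1 rep_gay)
     (rep_opp _ _ (rep_mult s _ _ _ _ rep_be1 rep_gax)) x y H).
  unfold coef2, Rdiv. rewrite Rmult_comm. f_equal.
Qed.

(** The equation d omega_1 = omega_1 /\ gamma in coordinates. Together with [struct_eq2] it amounts
    to the commutation rule [d1, d2] = g1 d2 - g2 d1 of the dual frame. *)
Lemma struct_eq1 :
  splus s (spdx be1) (sopp s (spdy al1)) = smult s wdg sg2.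
Proof.
  apply sfun_eq; intros x y H.
  change (sfv (splus s (spdx be1) (sopp s (spdy al1))) x y = sfv wdg x y * sfv sg2 x y).
  rewrite <- (rep_plus s _ _ _ _ (rep_pdx _ _ _ rep_be1) (rep_opp _ _ (rep_pdy _ _ _ rep_al1)) x y H).
  rewrite <- (rep_wdg x y H), <- (rep_g2 x y H).
  destruct (hgam x y (Hs _ H)) as [_ Hg]. specialize (Hg 1%nat ltac:(lia)).
  unfold d_form in Hg. rewrite !partial_derive_iter in Hg. cbn [Nat.iter nat_rect] in Hg.
  transitivity (wedge (om 1%nat) gam x y); [rewrite <- Hg; ring|].
  unfold coef2. field. now apply w_neq0.
Qed.

Lemma struct_eq2 :
  splus s (spdx be2) (sopp s (spdy al2)) = sopp s (smult s wdg sg1).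
Proof.
  apply sfun_eq; intros x y H.
  rewrite <- (rep_opp _ _ (rep_mult s _ _ _ _ rep_wdg rep_g1) x y H).
  rewrite <- (rep_plus s _ _ _ _ (rep_pdx _ _ _ rep_be2) (rep_opp _ _ (rep_pdy _ _ _ rep_al2)) x y H).
  destruct (hgam x y (Hs _ H)) as [_ Hg]. specialize (Hg 2%nat ltac:(lia)).
  unfold d_form in Hg. rewrite !partial_derive_iter in Hg. cbn [Nat.iter nat_rect] in Hg.
  transitivity (wedge (om 2%nat) gam x y); [rewrite <- Hg; ring|].
  transitivity (- wedge gam (om 2%nat) x y); [unfold wedge; ring|].
  unfold coef1. field. now apply w_neq0.
Qed.

Lemma normal_form i x y : (i < d - 2)%nat -> D (x, y) ->
  dx_coef (om (i + 3)%nat) x y = - (a (S i) x y * dx_coef (om 1%nat) x y + dx_coef (om 2%nat) x y) /\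
  dy_coef (om (i + 3)%nat) x y = - (a (S i) x y * dy_coef (om 1%nat) x y + dy_coef (om 2%nat) x y).
Proof.
  intros Hi H. destruct (hnorm x y H) as [H1 _].
  destruct (H1 (S i) ltac:(lia)) as [_ [E1 E2]].
  replace (S i + 2)%nat with (i + 3)%nat in E1, E2 by lia. lra.
Qed.

(** Where the function vanished, [om (i + 3)] would be proportional to [om 2]; in the next lemma
    equal values would make [om (i + 3)] and [om (j + 3)] proportional. Unknowns are counted from 0
    here, so [inva i] belongs to [om (i + 3)]. *)
Lemma inva_unit i : (i < d - 2)%nat -> exists b, smult s (inva i) b = sconst s 1.
Proof.
  intros Hi. apply sfun_inverse; intros x y H.
  rewrite <- rep_inva by assumption. intros E.
  destruct (hweb x y (Hs _ H)) as [_ Hw].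
  apply (Hw 2%nat (i + 3)%nat); [lia | lia | lia |].
  destruct (normal_form i x y Hi (Hs _ H)) as [E1 E2].
  unfold wedge. rewrite E1, E2, E. ring.
Qed.

Lemma inva_diff_unit i j : (i < d - 2)%nat -> (j < d - 2)%nat -> i <> j ->
  exists b, smult s (splus s (inva i) (sopp s (inva j))) b = sconst s 1.
Proof.
  intros Hi Hj Hij. apply sfun_inverse; intros x y H.
  rewrite <- (rep_plus s _ _ _ _ (rep_inva i Hi) (rep_opp _ _ (rep_inva j Hj)) x y H).
  intros E. destruct (hweb x y (Hs _ H)) as [_ Hw].
  apply (Hw (i + 3)%nat (j + 3)%nat); [lia | lia | lia |].
  destruct (normal_form i x y Hi (Hs _ H)) as [E1 E2].
  destruct (normal_form j x y Hj (Hs _ H)) as [E3 E4].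
  unfold wedge. rewrite E1, E2, E3, E4.
  replace (a (S i) x y) with (a (S j) x y) by lra. ring.
Qed.

Definition sd1 (f : sfun s) : sfun s :=
  splus s (smult s (smult s winv be2) (spdx f)) (smult s (sopp s (smult s winv al2)) (spdy f)).
Definition sd2 (f : sfun s) : sfun s :=
  splus s (smult s (sopp s (smult s winv be1)) (spdx f)) (smult s (smult s winv al1) (spdy f)).

Lemma coef1_d_fun u x y : coef1 om (d_fun u) x y =
  (pdx u x y * dy_coef (om 2%nat) x y - pdy u x y * dx_coef (om 2%nat) x y)
  / wedge (om 1%nat) (om 2%nat) x y.
Proof. unfold coef1, wedge at 1, d_fun; simpl. now rewrite !partial_derive_iter. Qed.

Lemma coef2_d_fun u x y : coef2 om (d_fun u) x y =
  (dx_coef (om 1%nat) x y * pdy u x y - dy_coef (om 1%nat) x y * pdx u x y)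
  / wedge (om 1%nat) (om 2%nat) x y.
Proof. unfold coef2, wedge at 1, d_fun; simpl. now rewrite !partial_derive_iter. Qed.

Lemma rep_coef1 u f : rep u f -> rep (coef1 om (d_fun u)) (sd1 f).
Proof.
  intros Hf x y H. rewrite coef1_d_fun. unfold sd1.
  rewrite <- (rep_plus s _ _ _ _
    (rep_mult s _ _ _ _ (rep_mult s _ _ _ _ rep_winv rep_be2) (rep_pdx _ _ _ Hf))
    (rep_mult s _ _ _ _ (rep_opp _ _ (rep_mult s _ _ _ _ rep_winv rep_al2)) (rep_pdy _ _ _ Hf)) x y H).
  field. now apply w_neq0.
Qed.

Lemma rep_coef2 u f : rep u f -> rep (coef2 om (d_fun u)) (sd2 f).
Proof.
  intros Hf x y H. rewrite coef2_d_fun. unfold sd2.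
  rewrite <- (rep_plus s _ _ _ _
    (rep_mult s _ _ _ _ (rep_opp _ _ (rep_mult s _ _ _ _ rep_winv rep_be1)) (rep_pdx _ _ _ Hf))
    (rep_mult s _ _ _ _ (rep_mult s _ _ _ _ rep_winv rep_al1) (rep_pdy _ _ _ Hf)) x y H).
  field. now apply w_neq0.
Qed.

Definition sdelta1 (k : nat) (f : sfun s) : sfun s :=
  splus s (sd1 f) (sopp s (smult s (smult s (sconst s (INR k)) sg1) f)).
Definition sdelta2 (k : nat) (f : sfun s) : sfun s :=
  splus s (sd2 f) (sopp s (smult s (smult s (sconst s (INR k)) sg2) f)).

Lemma rep_const c : rep (fun _ _ => c) (sconst s c).
Proof. intros x y H. symmetry. now apply sconstE. Qed.

Lemma rep_delta1 k u f : rep u f -> rep (delta_1 om gam k u) (sdelta1 k f).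
Proof.
  intros Hf. exact (rep_plus s _ _ _ _ (rep_coef1 u f Hf)
    (rep_opp _ _ (rep_mult s _ _ _ _ (rep_mult s _ _ _ _ (rep_const (INR k)) rep_g1) Hf))).
Qed.

Lemma rep_delta2 k u f : rep u f -> rep (delta_2 om gam k u) (sdelta2 k f).
Proof.
  intros Hf. exact (rep_plus s _ _ _ _ (rep_coef2 u f Hf)
    (rep_opp _ _ (rep_mult s _ _ _ _ (rep_mult s _ _ _ _ (rep_const (INR k)) rep_g2) Hf))).
Qed.

Definition sDelta (i k : nat) (f : sfun s) : sfun s :=
  splus s (sdelta1 k f) (sopp s (sdelta2 k (smult s (inva i) f))).

Lemma rep_Delta i k u f : (i < d - 2)%nat -> rep u f ->
  rep (Delta_op om a gam (S i) k u) (sDelta i k f).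
Proof.
  intros Hi Hf. exact (rep_plus s _ _ _ _ (rep_delta1 k u f Hf)
    (rep_opp _ _ (rep_delta2 k _ _ (rep_mult s _ _ _ _ (rep_inva i Hi) Hf)))).
Qed.

Lemma d_form_scale u v x y : dom s (x, y) -> smooth_on (dom s) u ->
  smooth_on (dom s) (dx_coef v) -> smooth_on (dom s) (dy_coef v) ->
  d_form (form_scale u v) x y =
  pdx u x y * dy_coef v x y + u x y * pdx (dy_coef v) x y
  - (pdy u x y * dx_coef v x y + u x y * pdy (dx_coef v) x y).
Proof.
  intros H Hu H1 H2. unfold d_form. rewrite !partial_derive_iter. simpl.
  rewrite (pdx_mult (dom s) u (dy_coef v) Hu H2 x y H).
  now rewrite (pdy_mult (dom s) u (dx_coef v) Hu H1 x y H).
Qed.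

Lemma structure_at i x y : dom s (x, y) -> (1 <= i <= 3)%nat ->
  pdx (dy_coef (om i)) x y - pdy (dx_coef (om i)) x y = wedge (om i) gam x y.
Proof.
  intros H Hi. destruct (hgam x y (Hs _ H)) as [_ Hg]. specialize (Hg i Hi).
  unfold d_form in Hg. now rewrite !partial_derive_iter in Hg.
Qed.

(** Since omega_(i+3) = -(a omega_1 + omega_2), and the connection form expresses d omega_1 and d
    omega_2, closedness of u omega_(i+3) is the transport equation for u at weight 1. *)
Lemma d_form_Delta i u x y : (i < d - 2)%nat -> dom s (x, y) -> smooth_on (dom s) u ->
  d_form (form_scale u (om (i + 3)%nat)) x y =
  - (wedge (om 1%nat) (om 2%nat) x y * Delta_op om a gam (S i) 1%nat u x y).
Proof.
  intros Hi H Hu.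
  destruct (smooth_om (i + 3)%nat ltac:(lia)) as [S1 S2].
  destruct (smooth_om 1%nat ltac:(lia)) as [S3 S4].
  destruct (smooth_om 2%nat ltac:(lia)) as [S5 S6].
  assert (Sa : smooth_on (dom s) (a (S i))) by exact (rep_smooth _ _ _ (rep_inva i Hi)).
  assert (oD := dom_open s).
  rewrite (d_form_scale u _ x y H Hu S1 S2).
  assert (E1 : eq_on (dom s) (dx_coef (om (i + 3)%nat))
     (fun x y => -1 * (a (S i) x y * dx_coef (om 1%nat) x y + dx_coef (om 2%nat) x y))).
  { intros x' y' H'. destruct (normal_form i x' y' Hi (Hs _ H')) as [-> _]. ring. }
  assert (E2 : eq_on (dom s) (dy_coef (om (i + 3)%nat))
     (fun x y => -1 * (a (S i) x y * dy_coef (om 1%nat) x y + dy_coef (om 2%nat) x y))).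
  { intros x' y' H'. destruct (normal_form i x' y' Hi (Hs _ H')) as [_ ->]. ring. }
  rewrite (pdx_ext (dom s) oD _ _ E2 x y H), (pdy_ext (dom s) oD _ _ E1 x y H).
  rewrite (E1 x y H), (E2 x y H).
  assert (P1 : smooth_on (dom s) (fun x y => a (S i) x y * dx_coef (om 1%nat) x y))
    by now apply smooth_on_mult.
  assert (P2 : smooth_on (dom s) (fun x y => a (S i) x y * dy_coef (om 1%nat) x y))
    by now apply smooth_on_mult.
  assert (C1 : smooth_on (dom s) (fun _ _ => -1)) by now apply smooth_on_const.
  rewrite (pdx_mult (dom s) (fun _ _ => -1) _ C1 (smooth_on_plus _ oD _ _ P2 S6) x y H).
  rewrite (pdy_mult (dom s) (fun _ _ => -1) _ C1 (smooth_on_plus _ oD _ _ P1 S5) x y H).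
  rewrite (pdx_plus (dom s) _ _ P2 S6 x y H), (pdy_plus (dom s) _ _ P1 S5 x y H).
  rewrite (pdx_mult (dom s) _ _ Sa S4 x y H), (pdy_mult (dom s) _ _ Sa S3 x y H).
  replace (pdx (fun _ _ => -1) x y) with 0 by (symmetry; exact (Derive_const _ _)).
  replace (pdy (fun _ _ => -1) x y) with 0 by (symmetry; exact (Derive_const _ _)).
  pose proof (structure_at 1%nat x y H ltac:(lia)) as T1.
  pose proof (structure_at 2%nat x y H ltac:(lia)) as T2.
  unfold Delta_op, delta_1, delta_2. rewrite coef1_d_fun, coef2_d_fun.
  rewrite (pdx_mult (dom s) _ _ Sa Hu x y H), (pdy_mult (dom s) _ _ Sa Hu x y H).
  unfold coef1, coef2. simpl INR.
  pose proof (w_neq0 x y H) as W0.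
  replace (pdx (dy_coef (om 1%nat)) x y)
    with (pdy (dx_coef (om 1%nat)) x y + wedge (om 1%nat) gam x y) by lra.
  replace (pdx (dy_coef (om 2%nat)) x y)
    with (pdy (dx_coef (om 2%nat)) x y + wedge (om 2%nat) gam x y) by lra.
  unfold wedge in *. field. exact W0.
Qed.

Lemma d_form_delta1 u x y : dom s (x, y) -> smooth_on (dom s) u ->
  d_form (form_scale u (om 2%nat)) x y =
  wedge (om 1%nat) (om 2%nat) x y * delta_1 om gam 1%nat u x y.
Proof.
  intros H Hu. destruct (smooth_om 2%nat ltac:(lia)) as [S5 S6].
  rewrite (d_form_scale u _ x y H Hu S5 S6).
  pose proof (structure_at 2%nat x y H ltac:(lia)) as T2.
  unfold delta_1. rewrite coef1_d_fun. unfold coef1. simpl INR.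
  pose proof (w_neq0 x y H) as W0.
  replace (pdx (dy_coef (om 2%nat)) x y)
    with (pdy (dx_coef (om 2%nat)) x y + wedge (om 2%nat) gam x y) by lra.
  unfold wedge in *. field. exact W0.
Qed.

Lemma d_form_delta2 u x y : dom s (x, y) -> smooth_on (dom s) u ->
  d_form (form_scale u (om 1%nat)) x y =
  - (wedge (om 1%nat) (om 2%nat) x y * delta_2 om gam 1%nat u x y).
Proof.
  intros H Hu. destruct (smooth_om 1%nat ltac:(lia)) as [S5 S6].
  rewrite (d_form_scale u _ x y H Hu S5 S6).
  pose proof (structure_at 1%nat x y H ltac:(lia)) as T2.
  unfold delta_2. rewrite coef2_d_fun. unfold coef2. simpl INR.
  pose proof (w_neq0 x y H) as W0.
  replace (pdx (dy_coef (om 1%nat)) x y)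
    with (pdy (dx_coef (om 1%nat)) x y + wedge (om 1%nat) gam x y) by lra.
  unfold wedge in *. field. exact W0.
Qed.

(** The transport equation solved for the first frame derivative of u. Differentiability is asked at
    one point only, because the lemma is applied to functions that are smooth merely on a smaller
    square. *)
Lemma Delta_op_at i u x y :
  ex_derive (fun t => u t y) x -> ex_derive (fun t => u x t) y ->
  ex_derive (fun t => a (S i) t y) x -> ex_derive (fun t => a (S i) x t) y ->
  Delta_op om a gam (S i) 1%nat u x y =
  coef1 om (d_fun u) x y - a (S i) x y * coef2 om (d_fun u) x y
  - (coef2 om (d_fun (a (S i))) x y + coef1 om gam x y - coef2 om gam x y * a (S i) x y) * u x y.
Proof.
  intros H1 H2 H3 H4. unfold Delta_op, delta_1, delta_2. rewrite !coef1_d_fun, !coef2_d_fun.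
  replace (pdx (fun x' y' => a (S i) x' y' * u x' y') x y)
    with (pdx (a (S i)) x y * u x y + a (S i) x y * pdx u x y)
    by (symmetry; exact (Derive_mult (fun t => a (S i) t y) (fun t => u t y) x H3 H1)).
  replace (pdy (fun x' y' => a (S i) x' y' * u x' y') x y)
    with (pdy (a (S i)) x y * u x y + a (S i) x y * pdy u x y)
    by (symmetry; exact (Derive_mult (fun t => a (S i) x t) (fun t => u x t) y H4 H2)).
  simpl INR. unfold Rdiv. ring.
Qed.

End WebOnSquare.

Lemma smooth_on_rsum D (oD : open D) K (F : nat -> R -> R -> R) :
  (forall j, (j < K)%nat -> smooth_on D (F j)) ->
  smooth_on D (fun x y => rsum K (fun j => F j x y)).
Proof.
  intros H. apply smooth_on_Cn; intros n. apply Cn_on_rsum; [exact oD|].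
  intros j Hj. now apply smooth_on_Cn, H.
Qed.

Lemma sum_n_m_rsum N f : sum_n_m f 1 N = rsum N (fun i => f (S i)).
Proof.
  induction N as [|N IH]; [now rewrite sum_n_m_zero by lia|].
  rewrite sum_n_Sm by lia. now rewrite IH.
Qed.

Lemma rsum_shift2 n f : rsum (S (S n)) f = f 0%nat + f 1%nat + rsum n (fun i => f (S (S i))).
Proof.
  induction n as [|n IH]; [simpl; ring|].
  change (rsum (S (S n)) f + f (S (S n)) = f 0%nat + f 1%nat
     + (rsum n (fun i => f (S (S i))) + f (S (S n)))). rewrite IH. ring.
Qed.

(* [ring] does not recognize R as the carrier of the values of [sum_n_m]. *)
Ltac ring_R := match goal with |- @eq _ ?x ?y => change (@eq R x y) end; ring.

(** * The abelian equation in the unknowns u_1, ..., u_(d-2) *)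

Section Abelian.
Variables (d : nat) (D : R * R -> Prop) (om : nat -> one_form)
  (a : nat -> R -> R -> R) (gam : one_form).
Hypothesis hd : (3 <= d)%nat.
Hypothesis hweb : is_web d D om.
Hypothesis hnorm : is_normalized d D om a.
Hypothesis hgam : is_chern_connection D om gam.
Variable s : square.
Hypothesis Hs : forall p, dom s p -> D p.

Lemma pdx_rsum N (u : nat -> R -> R -> R) x y : dom s (x, y) ->
  (forall i, (i < N)%nat -> smooth_on (dom s) (u i)) ->
  pdx (fun x y => rsum N (fun i => u i x y)) x y = rsum N (fun i => pdx (u i) x y).
Proof.
  intros H Hu. apply is_derive_unique.
  apply (is_derive_rsum N (fun i t => u i t y) (fun i t => pdx (u i) t y)).
  intros i Hi. apply Derive_correct. now apply (smooth_on_ex_x (dom s)); [apply Hu|].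
Qed.

Lemma pdy_rsum N (u : nat -> R -> R -> R) x y : dom s (x, y) ->
  (forall i, (i < N)%nat -> smooth_on (dom s) (u i)) ->
  pdy (fun x y => rsum N (fun i => u i x y)) x y = rsum N (fun i => pdy (u i) x y).
Proof.
  intros H Hu. apply is_derive_unique.
  apply (is_derive_rsum N (fun i t => u i x t) (fun i t => pdy (u i) x t)).
  intros i Hi. apply Derive_correct. now apply (smooth_on_ex_y (dom s)); [apply Hu|].
Qed.

Lemma delta_1_rsum N k (u : nat -> R -> R -> R) x y : dom s (x, y) ->
  (forall i, (i < N)%nat -> smooth_on (dom s) (u i)) ->
  delta_1 om gam k (fun x y => rsum N (fun i => u i x y)) x y
  = rsum N (fun i => delta_1 om gam k (u i) x y).
Proof.
  intros H Hu. unfold delta_1. rewrite coef1_d_fun, pdx_rsum, pdy_rsum by assumption.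
  rewrite rsum_minus, rsum_scal. f_equal.
  rewrite (rsum_ext N (fun i => coef1 om (d_fun (u i)) x y)
    (fun i => dy_coef (om 2%nat) x y / wedge (om 1%nat) (om 2%nat) x y * pdx (u i) x y
            - dx_coef (om 2%nat) x y / wedge (om 1%nat) (om 2%nat) x y * pdy (u i) x y)).
  2:{ intros i Hi. rewrite coef1_d_fun. unfold Rdiv. ring. }
  rewrite rsum_minus, !rsum_scal. unfold Rdiv. ring.
Qed.

Lemma delta_2_rsum N k (u : nat -> R -> R -> R) x y : dom s (x, y) ->
  (forall i, (i < N)%nat -> smooth_on (dom s) (u i)) ->
  delta_2 om gam k (fun x y => rsum N (fun i => u i x y)) x y
  = rsum N (fun i => delta_2 om gam k (u i) x y).
Proof.
  intros H Hu. unfold delta_2. rewrite coef2_d_fun, pdx_rsum, pdy_rsum by assumption.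
  rewrite rsum_minus, rsum_scal. f_equal.
  rewrite (rsum_ext N (fun i => coef2 om (d_fun (u i)) x y)
    (fun i => dx_coef (om 1%nat) x y / wedge (om 1%nat) (om 2%nat) x y * pdy (u i) x y
            - dy_coef (om 1%nat) x y / wedge (om 1%nat) (om 2%nat) x y * pdx (u i) x y)).
  2:{ intros i Hi. rewrite coef2_d_fun. unfold Rdiv. ring. }
  rewrite rsum_minus, !rsum_scal. unfold Rdiv. ring.
Qed.

Definition lam_of (u : nat -> R -> R -> R) (l : nat) : R -> R -> R :=
  match l with
  | O => fun _ _ => 0
  | S O => fun x y => rsum (d - 2) (fun i => a (S i) x y * u i x y)
  | S (S O) => fun x y => rsum (d - 2) (fun i => u i x y)
  | S (S (S i)) => u i
  end.

Definition solves_on (u : nat -> R -> R -> R) : Prop :=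
  (forall i, (i < d - 2)%nat -> smooth_on (dom s) (u i)) /\
  (forall i x y, (i < d - 2)%nat -> dom s (x, y) -> Delta_op om a gam (S i) 1%nat (u i) x y = 0) /\
  (forall x y, dom s (x, y) -> rsum (d - 2) (fun i => delta_1 om gam 1%nat (u i) x y) = 0).

Lemma smooth_inva i : (i < d - 2)%nat -> smooth_on (dom s) (a (S i)).
Proof. intros Hi. exact (rep_smooth _ _ _ (rep_inva d D om a hd hnorm s Hs i Hi)). Qed.

(** With [c] either coefficient of a form, both coordinate components of the linear equation are
    treated by one computation. *)
Lemma lam_sum (v : nat -> R -> R -> R) (c : one_form -> R -> R -> R) (l : nat -> R -> R -> R) x y :
  (forall i, (i < d - 2)%nat -> c (om (i + 3)%nat) x y
     = - (a (S i) x y * c (om 1%nat) x y + c (om 2%nat) x y)) ->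
  (forall i, (i < d - 2)%nat -> l (i + 3)%nat x y = v i x y) ->
  sum_n_m (fun i => l i x y * c (om i) x y) 1 d =
  (l 1%nat x y - rsum (d - 2) (fun i => a (S i) x y * v i x y)) * c (om 1%nat) x y
  + (l 2%nat x y - rsum (d - 2) (fun i => v i x y)) * c (om 2%nat) x y.
Proof.
  intros Hc Hl. rewrite sum_n_m_rsum.
  replace d with (S (S (d - 2))) at 1 by lia. rewrite rsum_shift2.
  rewrite (rsum_ext (d - 2) _ (fun i => (- c (om 1%nat) x y) * (a (S i) x y * v i x y)
     - c (om 2%nat) x y * v i x y)).
  2:{ intros i Hi. replace (S (S (S i))) with (i + 3)%nat by lia.
      rewrite Hc, Hl by exact Hi. ring_R. }
  rewrite rsum_minus, !rsum_scal. ring_R.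
Qed.

Lemma abelian_of_solves u : solves_on u -> abelian_solution d om (sq_x s) (sq_y s) (lam_of u).
Proof.
  intros [Hu [HD Hg]]. exists (mkposreal _ (sq_pos s)). intros x y Hx Hy.
  assert (H : dom s (x, y)) by (split; assumption). clear Hx Hy.
  assert (oD := dom_open s).
  assert (Sau : forall i, (i < d - 2)%nat -> smooth_on (dom s) (fun x y => a (S i) x y * u i x y)).
  { intros i Hi. apply smooth_on_mult; auto. now apply smooth_inva. }
  assert (Hnf := fun i Hi => normal_form d D om a hd hnorm i x y Hi (Hs _ H)).
  split; [|split; [|split]].
  - intros i Hi. destruct i as [|[|[|i]]]; [lia| | |].
    + apply (smooth_on_rsum _ oD _ (fun i x y => a (S i) x y * u i x y) Sau x y H).
    + apply (smooth_on_rsum _ oD _ u Hu x y H).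
    + apply Hu; [lia | exact H].
  - rewrite (lam_sum u dx_coef); [simpl; ring | |].
    + intros i Hi. now apply Hnf.
    + intros i Hi. now replace (i + 3)%nat with (S (S (S i))) by lia.
  - rewrite (lam_sum u dy_coef); [simpl; ring | |].
    + intros i Hi. now apply Hnf.
    + intros i Hi. now replace (i + 3)%nat with (S (S (S i))) by lia.
  - intros i Hi. destruct i as [|[|[|i]]]; [lia| | |].
    + cbn [lam_of]. rewrite (d_form_delta2 d D om gam hd hweb hgam s Hs _ x y H
         (smooth_on_rsum _ oD _ (fun i x y => a (S i) x y * u i x y) Sau)).
      rewrite (delta_2_rsum _ _ (fun i x y => a (S i) x y * u i x y)) by assumption.
      (* Closedness of lambda_1 omega_1 follows from the other equations: Delta_i u_i = 0 replaces
         delta_2(a_i u_i) by delta_1(u_i), and the sum of these is zero. *)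
      rewrite (rsum_ext (d - 2) _ (fun i => delta_1 om gam 1%nat (u i) x y)).
      2:{ intros i Hi'. specialize (HD i x y Hi' H). unfold Delta_op in HD. lra. }
      rewrite Hg by exact H. ring.
    + cbn [lam_of].
      rewrite (d_form_delta1 d D om gam hd hweb hgam s Hs _ x y H (smooth_on_rsum _ oD _ u Hu)).
      rewrite delta_1_rsum by assumption. rewrite Hg by exact H. ring.
    + replace (S (S (S i))) with (i + 3)%nat at 2 by lia. cbn [lam_of].
      rewrite (d_form_Delta d D om a gam hd hweb hnorm hgam s Hs) by (auto; apply Hu || lia; lia).
      rewrite HD by (auto; lia). ring.
Qed.

Lemma solves_of_abelian lam :
  (forall x y, dom s (x, y) ->
    (forall i, (1 <= i <= d)%nat -> smooth_at (lam i) x y) /\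
    sum_n_m (fun i => lam i x y * dx_coef (om i) x y) 1 d = 0 /\
    sum_n_m (fun i => lam i x y * dy_coef (om i) x y) 1 d = 0 /\
    (forall i, (1 <= i <= d)%nat -> d_form (form_scale (lam i) (om i)) x y = 0)) ->
  solves_on (fun i => lam (i + 3)%nat) /\
  (forall l x y, (1 <= l <= d)%nat -> dom s (x, y) ->
     lam l x y = lam_of (fun i => lam (i + 3)%nat) l x y).
Proof.
  intros Hl. assert (oD := dom_open s).
  set (u := fun i => lam (i + 3)%nat).
  assert (Hu : forall i, (i < d - 2)%nat -> smooth_on (dom s) (u i)).
  { intros i Hi x y H. apply Hl; [exact H | lia]. }
  assert (E : forall x y, dom s (x, y) ->
    lam 1%nat x y = rsum (d - 2) (fun i => a (S i) x y * u i x y) /\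
    lam 2%nat x y = rsum (d - 2) (fun i => u i x y)).
  { intros x y H. destruct (Hl x y H) as [_ [E1 [E2 _]]].
    assert (Hnf := fun i Hi => normal_form d D om a hd hnorm i x y Hi (Hs _ H)).
    rewrite (lam_sum u dx_coef) in E1;
      [ | intros i Hi; now apply Hnf | reflexivity].
    rewrite (lam_sum u dy_coef) in E2;
      [ | intros i Hi; now apply Hnf | reflexivity].
    pose proof (w_neq0 d D om hd hweb s Hs x y H) as W0. unfold wedge in W0.
    (* The two coordinate equations read p omega_1 + q omega_2 = 0, and omega_1 and omega_2 are
       independent. *)
    set (p := lam 1%nat x y - _) in *. set (q := lam 2%nat x y - _) in *.
    assert (Hp : p * (dx_coef (om 1%nat) x y * dy_coef (om 2%nat) x y
                 - dy_coef (om 1%nat) x y * dx_coef (om 2%nat) x y) = 0).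
    { transitivity ((p * dx_coef (om 1%nat) x y + q * dx_coef (om 2%nat) x y) * dy_coef (om 2%nat) x y
        - (p * dy_coef (om 1%nat) x y + q * dy_coef (om 2%nat) x y) * dx_coef (om 2%nat) x y);
        [ring | rewrite E1, E2; ring]. }
    assert (Hq : q * (dx_coef (om 1%nat) x y * dy_coef (om 2%nat) x y
                 - dy_coef (om 1%nat) x y * dx_coef (om 2%nat) x y) = 0).
    { transitivity ((p * dy_coef (om 1%nat) x y + q * dy_coef (om 2%nat) x y) * dx_coef (om 1%nat) x y
        - (p * dx_coef (om 1%nat) x y + q * dx_coef (om 2%nat) x y) * dy_coef (om 1%nat) x y);
        [ring | rewrite E1, E2; ring]. }
    apply Rmult_integral in Hp, Hq.
    destruct Hp as [Hp|Hp]; [|contradiction]. destruct Hq as [Hq|Hq]; [|contradiction].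
    unfold p, q in *. split; lra. }
  split; [split; [exact Hu|split]|].
  - intros i x y Hi H. destruct (Hl x y H) as [_ [_ [_ Hd]]].
    specialize (Hd (i + 3)%nat ltac:(lia)).
    change (lam (i + 3)%nat) with (u i) in Hd.
    rewrite (d_form_Delta d D om a gam hd hweb hnorm hgam s Hs) in Hd by auto.
    pose proof (w_neq0 d D om hd hweb s Hs x y H) as W0.
    apply Ropp_eq_0_compat in Hd. rewrite Ropp_involutive in Hd.
    apply Rmult_integral in Hd. destruct Hd; [contradiction | assumption].
  - intros x y H. rewrite <- delta_1_rsum by assumption.
    destruct (Hl x y H) as [_ [_ [_ Hd]]]. specialize (Hd 2%nat ltac:(lia)).
    assert (Su := smooth_on_rsum _ oD _ u Hu).
    assert (Hd' : d_form (form_scale (fun x y => rsum (d - 2) (fun i => u i x y)) (om 2%nat)) x y = 0).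
    { rewrite <- Hd. unfold d_form. rewrite !partial_derive_iter. cbn [Nat.iter nat_rect].
      apply (f_equal2 Rminus).
      - apply (pdx_ext (dom s) oD); [|exact H]. intros x' y' H'. simpl.
        now rewrite (proj2 (E x' y' H')).
      - apply (pdy_ext (dom s) oD); [|exact H]. intros x' y' H'. simpl.
        now rewrite (proj2 (E x' y' H')). }
    rewrite (d_form_delta1 d D om gam hd hweb hgam s Hs _ x y H Su) in Hd'.
    pose proof (w_neq0 d D om hd hweb s Hs x y H) as W0.
    apply Rmult_integral in Hd'. destruct Hd'; [contradiction | assumption].
  - intros l x y Hlr H. destruct l as [|[|[|l]]]; [lia | | |].
    + apply E, H.
    + apply E, H.
    + cbn [lam_of]. unfold u. now replace (l + 3)%nat with (S (S (S l))) by lia.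
Qed.

End Abelian.

Module Web.
Import all_boot all_algebra ring zify Rstruct.
Set Implicit Arguments. Unset Strict Implicit. Unset Printing Implicit Defensive.
Import GRing.Theory Num.Theory.
Local Open Scope ring_scope.

(** * Operators modulo the transport equations *)

Section FormalModule.
Variables (F : comNzRingType) (d1 d2 : {additive F -> F}) (g1 g2 : F).
Hypothesis d1M : forall f g, d1 (f * g) = d1 f * g + f * d1 g.
Hypothesis d2M : forall f g, d2 (f * g) = d2 f * g + f * d2 g.
Hypothesis d12 : forall f, d1 (d2 f) = d2 (d1 f) + g1 * d2 f - g2 * d1 f.
Variables (n : nat) (a e : nat -> F).

Lemma der1_0 (d : {additive F -> F}) :
  (forall f g, d (f * g) = d f * g + f * d g) -> d 1 = 0.
Proof.
move=> dM; have := dM 1 1; rewrite !mulr1 mul1r => /(congr1 (fun t => t - d 1)).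
by rewrite subrr addrK.
Qed.

Lemma map_polyD (d : {additive F -> F}) (P Q : {poly F}) :
  map_poly d (P + Q) = map_poly d P + map_poly d Q.
Proof. by apply/polyP=> i; rewrite coefD !coef_map_id0 ?raddf0 // coefD raddfD. Qed.

Lemma map_poly_leibniz (d : {additive F -> F}) (P : {poly F}) h :
  (forall f g, d (f * g) = d f * g + f * d g) ->
  map_poly d (h *: P) = d h *: P + h *: map_poly d P.
Proof.
move=> dM; apply/polyP=> i.
by rewrite coefD !coefZ !coef_map_id0 ?raddf0 // coefZ dM.
Qed.

Lemma map_poly_Xn (d : {additive F -> F}) j :
  (forall f g, d (f * g) = d f * g + f * d g) -> map_poly d 'X^j = 0.
Proof.
move=> dM; apply/polyP=> i; rewrite coef_map_id0 ?raddf0 // coefXn coef0.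
by case: (_ == _); rewrite /= ?raddf0 ?der1_0.
Qed.

Lemma map_poly_size (d : {additive F -> F}) (P : {poly F}) k :
  (size P <= k)%N -> (size (map_poly d P) <= k)%N.
Proof.
move=> /leq_sizeP sP; apply/leq_sizeP=> j kj.
by rewrite coef_map_id0 ?raddf0 // sP // raddf0.
Qed.

(* A polynomial sum_l p_l X^l stands for the operator sum_l p_l d2^l on solutions f
   of the transport equation d1 f = a_i d2 f + e_i f; then [tder2] and [tder1 i] are
   composition with d2 and d1 on the left, and [pcoef i j] is d1 d2^j. *)
Definition tder2 (P : {poly F}) := map_poly d2 P + 'X * P.

Fixpoint pcoef (i j : nat) : {poly F} :=
  if j is j0.+1 then tder2 (pcoef i j0) - g2 *: pcoef i j0 + g1 *: 'X^(j0.+1)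
  else a i *: 'X + (e i)%:P.

Definition tder1 i (P : {poly F}) :=
  map_poly d1 P + \sum_(j < size P) P`_j *: pcoef i j.

Lemma tder1E i (P : {poly F}) k : (size P <= k)%N ->
  tder1 i P = map_poly d1 P + \sum_(j < k) P`_j *: pcoef i j.
Proof.
move=> sP; congr (_ + _); rewrite (big_ord_widen k (fun j => P`_j *: pcoef i j) sP).
rewrite [RHS](bigID (fun j : 'I_k => (j < size P)%N)) /= [X in _ = _ + X]big1 ?addr0 //.
by move=> j; rewrite -leqNgt => /leq_sizeP -> //; rewrite scale0r.
Qed.

Lemma tder2D P Q : tder2 (P + Q) = tder2 P + tder2 Q.
Proof. by rewrite /tder2 map_polyD mulrDr addrACA. Qed.

Lemma tder2Z h P : tder2 (h *: P) = d2 h *: P + h *: tder2 P.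
Proof. by rewrite /tder2 map_poly_leibniz // -scalerAr scalerDr addrA. Qed.

Lemma tder1D i P Q : tder1 i (P + Q) = tder1 i P + tder1 i Q.
Proof.
pose k := maxn (size P) (size Q).
rewrite !(@tder1E i _ k) ?leq_maxl ?leq_maxr ?size_polyD //.
rewrite map_polyD addrACA; congr (_ + _); rewrite -big_split /=.
by apply: eq_bigr => j _; rewrite coefD scalerDl.
Qed.

Lemma tder1Z i h P : tder1 i (h *: P) = d1 h *: P + h *: tder1 i P.
Proof.
rewrite !(@tder1E i _ (size P)) ?size_scale_leq //.
rewrite map_poly_leibniz // scalerDr addrA; congr (_ + _); rewrite scaler_sumr.
by apply: eq_bigr => j _; rewrite coefZ scalerA.
Qed.

Lemma tder2Xn j : tder2 'X^j = 'X^(j.+1).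
Proof. by rewrite /tder2 map_poly_Xn // add0r exprS. Qed.

Lemma tder1Xn i j : tder1 i 'X^j = pcoef i j.
Proof.
rewrite (@tder1E i _ j.+1) ?size_polyXn // map_poly_Xn // add0r big_ord_recr /=.
rewrite coefXn eqxx scale1r big1 ?add0r // => k _.
by rewrite coefXn ltn_eqF ?scale0r.
Qed.

Lemma tder2_0 : tder2 0 = 0.
Proof. by have := tder2Z 0 0; rewrite !(scale0r, raddf0, addr0). Qed.

Lemma tder1_0 i : tder1 i 0 = 0.
Proof. by have := tder1Z i 0 0; rewrite !(scale0r, raddf0, addr0). Qed.

Lemma poly_mono_ind (K : {poly F} -> Prop) :
  K 0 -> (forall P Q, K P -> K Q -> K (P + Q)) -> (forall h j, K (h *: 'X^j)) ->
  forall P, K P.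
Proof.
move=> K0 KD KX P; rewrite -[P]coefK poly_def.
by elim/big_ind: _ => // i _; apply: KX.
Qed.

(** On monomials this is the recursion defining [pcoef]; the Leibniz rules and [d12] extend it to
    coefficients. Commuting past [d2] is therefore consistent with eliminating [d1] by the transport
    equation. *)
Lemma tder12 i P : tder1 i (tder2 P) =
  tder2 (tder1 i P) + g1 *: tder2 P - g2 *: tder1 i P.
Proof.
elim/poly_mono_ind: P => [|P Q hP hQ|h j].
- by rewrite !(tder2_0, tder1_0) !scaler0 !addr0 subr0.
- rewrite (tder2D P Q) (tder1D i P Q) (tder1D i (tder2 P)) hP hQ (tder2D (tder1 i P)) !scalerDr.
  ring.
- rewrite (tder2Z h) (tder1D i (d2 h *: _)) !(tder1Z i) (tder2D (d1 h *: _)) !tder2Z tder2Xn !tder1Xn /= d12.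
  rewrite -!mul_polyC; ring.
Qed.

Lemma tder2_size (P : {poly F}) k : (size P <= k.+1)%N -> (size (tder2 P) <= k.+2)%N.
Proof.
move=> sP; apply: (leq_trans (size_polyD _ _)); rewrite geq_max.
rewrite (leq_trans (map_poly_size _ sP)) //=.
by apply: (leq_trans (size_polyMleq _ _)); rewrite size_polyX.
Qed.

Lemma tder2_lead (P : {poly F}) k : (size P <= k.+1)%N -> (tder2 P)`_k.+1 = P`_k.
Proof.
move=> sP; rewrite coefD coefXM /= coef_map_id0 ?raddf0 //.
by rewrite (leq_sizeP _ _ sP) // raddf0 add0r.
Qed.

(** Modulo lower order [d1] acts on the i-th unknown as [a i] times [d2], the principal symbol of
    its transport equation. *)
Lemma pcoef_size_lead i j : (size (pcoef i j) <= j.+2)%N /\ (pcoef i j)`_j.+1 = a i.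
Proof.
elim: j => [|j [IHs IHl]] /=.
  split; last by rewrite coefD coefZ coefX coefC /= addr0 mulr1.
  apply: (leq_trans (size_polyD _ _)); rewrite geq_max.
  rewrite (leq_trans (size_scale_leq _ _)) ?size_polyX //.
  by apply: (leq_trans (size_polyC_leq1 _)).
split.
  apply: (leq_trans (size_polyD _ _)); rewrite geq_max; apply/andP; split.
    apply: (leq_trans (size_polyD _ _)); rewrite geq_max tder2_size //= size_polyN.
    by rewrite (leq_trans (size_scale_leq _ _)) // leqW.
  by rewrite (leq_trans (size_scale_leq _ _)) // size_polyXn.
rewrite coefD coefB !coefZ tder2_lead // coefXn IHl (leq_sizeP _ _ IHs) //.
by rewrite gtn_eqF // !mulr0 subr0 addr0.
Qed.

Lemma tder1_size i (P : {poly F}) k : (size P <= k.+1)%N -> (size (tder1 i P) <= k.+2)%N.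
Proof.
move=> sP; apply: (leq_trans (size_polyD _ _)); rewrite geq_max.
rewrite (leq_trans (map_poly_size _ sP)) //=.
apply: (leq_trans (size_sum _ _ _)); apply/bigmax_leqP => j _.
apply: (leq_trans (size_scale_leq _ _)).
have [sc _] := pcoef_size_lead i j; apply: (leq_trans sc).
by rewrite ltnS (leq_trans (ltn_ord j)).
Qed.

Lemma tder1_lead i (P : {poly F}) k : (size P <= k.+1)%N -> (tder1 i P)`_k.+1 = a i * P`_k.
Proof.
move=> sP; rewrite (@tder1E i P k.+1) // coefD coef_map_id0 ?raddf0 //.
rewrite (leq_sizeP _ _ sP) // raddf0 add0r big_ord_recr /= coefD coefZ.
have [_ ->] := pcoef_size_lead i k; rewrite mulrC coef_sum big1 ?add0r // => j _.
have [/leq_sizeP sc _] := pcoef_size_lead i j.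
by rewrite coefZ sc ?mulr0 // !ltnS.
Qed.

Local Notation M := {ffun 'I_n -> {poly F}}.

(* The derivations are locked because unification would otherwise unfold them. *)
Fact fder_key : unit. Proof. by []. Qed.
Definition fder2 : M -> M :=
  locked_with fder_key (fun Q => [ffun m => tder2 (Q m)]).
Definition fder1 : M -> M :=
  locked_with fder_key (fun Q => [ffun m : 'I_n => tder1 m (Q m)]).

Lemma fder2E Q m : fder2 Q m = tder2 (Q m).
Proof. by rewrite /fder2 unlock ffunE. Qed.
Lemma fder1E Q m : fder1 Q m = tder1 m (Q m).
Proof. by rewrite /fder1 unlock ffunE. Qed.

Lemma fder2D P Q : fder2 (P + Q) = fder2 P + fder2 Q.
Proof. by apply/ffunP=> m; rewrite !(fder2E, ffunE) tder2D. Qed.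
Lemma fder1D P Q : fder1 (P + Q) = fder1 P + fder1 Q.
Proof. by apply/ffunP=> m; rewrite !(fder1E, ffunE) tder1D. Qed.
Lemma fder2Z h P : fder2 (h *: P) = d2 h *: P + h *: fder2 P.
Proof. by apply/ffunP=> m; rewrite !(fder2E, ffunE) tder2Z. Qed.
Lemma fder1Z h P : fder1 (h *: P) = d1 h *: P + h *: fder1 P.
Proof. by apply/ffunP=> m; rewrite !(fder1E, ffunE) tder1Z. Qed.
Lemma fder12 P : fder1 (fder2 P) = fder2 (fder1 P) + g1 *: fder2 P - g2 *: fder1 P.
Proof. by apply/ffunP=> m; rewrite !(fder1E, fder2E, ffunE) tder12. Qed.

Definition ford k (Q : M) := forall m, (size (Q m) <= k.+1)%N.

Lemma ford_fder2 k Q : ford k Q -> ford k.+1 (fder2 Q).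
Proof. by move=> oQ m; rewrite fder2E tder2_size. Qed.
Lemma ford_fder1 k Q : ford k Q -> ford k.+1 (fder1 Q).
Proof. by move=> oQ m; rewrite fder1E tder1_size. Qed.
Lemma fder2_lead k Q m : ford k Q -> (fder2 Q m)`_k.+1 = (Q m)`_k.
Proof. by move=> oQ; rewrite fder2E tder2_lead. Qed.
Lemma fder1_lead k Q m : ford k Q -> (fder1 Q m)`_k.+1 = a m * (Q m)`_k.
Proof. by move=> oQ; rewrite fder1E tder1_lead. Qed.
Lemma ford_lin k h P Q : ford k P -> ford k Q -> ford k (h *: P + Q).
Proof.
move=> oP oQ m; rewrite !ffunE (leq_trans (size_polyD _ _)) // geq_max.
by rewrite (leq_trans (size_scale_leq _ _)) //=.
Qed.
Lemma ford_leq k l Q : (k <= l)%N -> ford k Q -> ford l Q.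
Proof. by move=> kl oQ m; apply: leq_trans (oQ m) _; rewrite ltnS. Qed.

Definition fgen : M := [ffun m : 'I_n => pcoef m 0 - g1%:P].

(* [fgen] is sum_m delta_1(u_m) reduced by the transport equations, and [inC k] is
   the span of its derivatives of order less than k. *)
Inductive inC : nat -> M -> Prop :=
| inC_gen : inC 1 fgen
| inC_0 k : inC k 0
| inC_lin k h P Q : inC k P -> inC k Q -> inC k (h *: P + Q)
| inC_up k P : inC k P -> inC k.+1 P
| inC_der1 k P : inC k P -> inC k.+1 (fder1 P)
| inC_der2 k P : inC k P -> inC k.+1 (fder2 P).

Lemma inC_D k P Q : inC k P -> inC k Q -> inC k (P + Q).
Proof. by move=> hP hQ; rewrite -[P]scale1r; apply: inC_lin. Qed.
Lemma inC_Z k h P : inC k P -> inC k (h *: P).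
Proof. by move=> hP; rewrite -[_ *: _]addr0; apply: inC_lin => //; apply: inC_0. Qed.
Lemma inC_B k P Q : inC k P -> inC k Q -> inC k (P - Q).
Proof. by move=> hP hQ; rewrite addrC -scaleN1r; apply: inC_lin. Qed.
Lemma inC_leq k l P : (k <= l)%N -> inC k P -> inC l P.
Proof.
move=> /subnK <-; elim: (l - k)%N => [|m IH] // hP.
by rewrite addSn; apply: inC_up; apply: IH.
Qed.
Lemma inC_sum k (I : finType) (f : I -> M) :
  (forall i, inC k (f i)) -> inC k (\sum_i f i).
Proof.
by move=> hf; elim/big_ind: _ => // [|x y hx hy]; [exact: inC_0 | exact: inC_D].
Qed.

Lemma fder1_0 : fder1 0 = 0.
Proof. by have := fder1Z 0 0; rewrite !(scale0r, addr0, raddf0). Qed.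
Lemma fder2_0 : fder2 0 = 0.
Proof. by have := fder2Z 0 0; rewrite !(scale0r, addr0, raddf0). Qed.

Lemma fder1_sum (I : finType) (f : I -> M) : fder1 (\sum_i f i) = \sum_i fder1 (f i).
Proof. by apply: (big_morph fder1); [exact: fder1D | exact: fder1_0]. Qed.
Lemma fder2_sum (I : finType) (f : I -> M) : fder2 (\sum_i f i) = \sum_i fder2 (f i).
Proof. by apply: (big_morph fder2); [exact: fder2D | exact: fder2_0]. Qed.

Lemma inC0 P : inC 0 P -> P = 0.
Proof.
move: {1 3}0%N (erefl 0%N) => k k0 hP; elim: hP k0 => // {}k h {}P Q _ IP _ IQ k0.
by rewrite IP // IQ // scaler0 addr0.
Qed.

Lemma fgen_ord : ford 1 fgen.
Proof.
move=> m; rewrite ffunE; apply: (leq_trans (size_polyD _ _)); rewrite geq_max size_polyN.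
have [-> _] := pcoef_size_lead m 0; rewrite (leq_trans (size_polyC_leq1 _)) //.
Qed.

Lemma fgen_lead m : (fgen m)`_1 = a m.
Proof.
rewrite ffunE coefB coefC subr0; have [_ ->] := pcoef_size_lead m 0; by [].
Qed.

Lemma inC_ford k P : inC k P -> ford k P.
Proof.
elim=> {k P} [|k|k h P Q _ hP _ hQ|k P _ hP|k P _ hP|k P _ hP].
- exact: fgen_ord.
- by move=> m; rewrite ffunE size_poly0.
- exact: ford_lin.
- exact: ford_leq hP.
- exact: ford_fder1.
- exact: ford_fder2.
Qed.

(** On leading coefficients this operator multiplies component m by [a m - a l]; it thus removes
    component l and keeps the others up to units. *)
Definition sg l (Q : M) : M := fder1 Q - a l *: fder2 Q.

Lemma inC_sg k l Q : inC k Q -> inC k.+1 (sg l Q).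
Proof.
by move=> hQ; apply: inC_B; [exact: inC_der1 | apply: inC_Z; exact: inC_der2].
Qed.

Lemma fder1_opp Q : fder1 (- Q) = - fder1 Q.
Proof. by apply/eqP; rewrite -subr_eq0 opprK -fder1D addNr fder1_0. Qed.
Lemma fder2_opp Q : fder2 (- Q) = - fder2 Q.
Proof. by apply/eqP; rewrite -subr_eq0 opprK -fder2D addNr fder2_0. Qed.

Lemma sgB l P Q : sg l (P - Q) = sg l P - sg l Q.
Proof.
rewrite /sg !fder1D !fder2D !fder1_opp !fder2_opp.
by apply/ffunP=> m; rewrite !ffunE -!mul_polyC; ring.
Qed.

(** The bracket of two vector fields is a vector field: a combination of first derivatives of [Q]
    remains, one filtration step below what two derivatives would give. *)
Lemma inC_sg_comm k i j Q : inC k Q -> inC k.+1 (sg i (sg j Q) - sg j (sg i Q)).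
Proof.
move=> hQ.
suff -> : sg i (sg j Q) - sg j (sg i Q) =
    (d1 (a i) - d1 (a j) + a i * d2 (a j) - a j * d2 (a i) + (a i - a j) * g1) *: fder2 Q
    + (- (a i - a j) * g2) *: fder1 Q.
  by apply: inC_D; apply: inC_Z; [exact: inC_der2 | exact: inC_der1].
rewrite /sg !fder1D !fder2D !fder1_opp !fder2_opp !fder1Z !fder2Z !fder12.
by apply/ffunP=> m; rewrite !ffunE -!mul_polyC; ring.
Qed.

(* [Ew j i] is the product of the [sg l], l < j and l <> i, applied to [fgen].  The
   leading coefficients of its components m < j vanish except for m = i. *)
Fixpoint Wd j : M := if j is j0.+1 then sg j0 (Wd j0) else fgen.

Fixpoint Ew j i : M :=
  if j is j0.+1 then if i == j0 then Wd j0 else sg j0 (Ew j0 i) else 0.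

Arguments Ew : simpl never.
Lemma EwS j i : Ew j.+1 i = if i == j then Wd j else sg j (Ew j i).
Proof. by []. Qed.

Lemma inC_Wd j : inC j.+1 (Wd j).
Proof. by elim: j => [|j IH]; [exact: inC_gen | exact: inC_sg]. Qed.

Lemma inC_Ew j i : inC j (Ew j i).
Proof.
elim: j => [|j IH]; first exact: inC_0.
by rewrite EwS; case: eqP => _; [exact: inC_Wd | exact: inC_sg].
Qed.

Lemma sg_lead k l Q m : ford k Q -> (sg l Q m)`_k.+1 = (a m - a l) * (Q m)`_k.
Proof.
by move=> oQ; rewrite !ffunE coefD coefN coefZ fder1_lead // fder2_lead // mulrBl.
Qed.

Lemma Wd_lead j m : (Wd j m)`_j.+1 = a m * \prod_(l < j) (a m - a l).
Proof.
elim: j => [|j IH]; first by rewrite fgen_lead big_ord0 mulr1.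
rewrite [Wd _]/= (sg_lead _ _ (inC_ford (inC_Wd j))) IH big_ord_recr /=.
ring.
Qed.

Lemma Ew_lead j i m : (i < j)%N ->
  (Ew j i m)`_j = a m * \prod_(l < j | l != i :> nat) (a m - a l).
Proof.
elim: j => // j IH; rewrite ltnS EwS => ij; rewrite big_mkcond big_ord_recr /=.
case: eqP => [->|/eqP nij].
  rewrite eqxx mulr1 Wd_lead; congr (_ * _); apply: eq_bigr => l _.
  by rewrite ltn_eqF.
rewrite (sg_lead _ _ (inC_ford (inC_Ew _ _))) IH; last by rewrite ltn_neqAle nij.
rewrite eq_sym nij -big_mkcond; ring.
Qed.

Hypothesis n_gt0 : (0 < n)%N.
Hypothesis a_unit : forall i, (i < n)%N -> exists b, a i * b = 1.
Hypothesis ad_unit : forall i j, (i < n)%N -> (j < n)%N -> i != j ->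
  exists b, (a i - a j) * b = 1.

Lemma Ew_lead_diag j i : (i < j <= n)%N -> forall m : 'I_n, m = i :> nat ->
  exists b, (Ew j i m)`_j * b = 1.
Proof.
move=> /andP[ij jn] m mi; rewrite Ew_lead // mi.
have [b0 h0] := a_unit (leq_trans ij jn).
suff [b1 h1] : exists b, (\prod_(l < j | l != i :> nat) (a i - a l)) * b = 1.
  by exists (b0 * b1); rewrite mulrACA h0 h1 mulr1.
elim/big_ind: _ => [|x y [bx hx] [by_ hy]|l li]; first by exists 1; rewrite mulr1.
  by exists (bx * by_); rewrite mulrACA hx hy mulr1.
apply: ad_unit; [exact: leq_trans jn | exact: leq_trans (ltn_ord l) jn | by rewrite eq_sym].
Qed.

Lemma Ew_lead_off j i (m : 'I_n) : (i < j)%N -> (m < j)%N -> m != i :> nat ->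
  (Ew j i m)`_j = 0.
Proof.
move=> ij mj mi; rewrite Ew_lead // (bigD1 (Ordinal mj)) //=.
by rewrite subrr mul0r mulr0.
Qed.

(* The sg_l commute up to lower order. *)
Lemma inC_sg_Ew j i : (i < j)%N -> inC j (sg i (Ew j i) - Wd j).
Proof.
elim: j => // j IH; rewrite ltnS EwS => ij /=.
case: eqP => [->|/eqP nij]; first by rewrite subrr; apply: inC_0.
have {}ij : (i < j)%N by rewrite ltn_neqAle nij.
rewrite -[X in inC _ X](subrKA (sg j (sg i (Ew j i)))) -[sg j _ - sg j _]sgB.
apply: inC_D; first by apply: inC_sg_comm; exact: inC_Ew.
by apply: inC_sg; apply: IH.
Qed.

Lemma fder1_sg l Q : fder1 Q = sg l Q + a l *: fder2 Q.
Proof. by rewrite subrK. Qed.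

(** From [sg i - sg j = (a j - a i) d2]: the factor [sg j] gives [Ew j.+1 i] exactly, while the
    missing factor [sg i] gives [Wd j], that is [Ew j.+1 j], modulo [inC j]. Dividing by the unit
    [a j - a i] expresses the [d2]-derivative in the next layer. *)
Lemma inC_fder2_Ew j i : (i < j < n)%N ->
  exists b, inC j (fder2 (Ew j i) - b *: (Ew j.+1 j - Ew j.+1 i)).
Proof.
move=> /andP[ij jn]; have [|b hb] := @ad_unit j i jn (ltn_trans ij jn).
  by rewrite gtn_eqF.
exists b; rewrite !EwS eqxx ltn_eqF //.
have -> : fder2 (Ew j i) - b *: (Wd j - sg j (Ew j i)) = b *: (sg i (Ew j i) - Wd j).
  have -> : fder2 (Ew j i) = b *: (sg i (Ew j i) - sg j (Ew j i)).
    have -> : sg i (Ew j i) - sg j (Ew j i) = (a j - a i) *: fder2 (Ew j i).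
      by rewrite /sg; apply/ffunP=> m; rewrite !ffunE -!mul_polyC; ring.
    by rewrite scalerA mulrC hb scale1r.
  by rewrite -scalerBr; congr (_ *: _); rewrite (opprB (Wd j)) addrA subrK.
by apply: inC_Z; apply: inC_sg_Ew.
Qed.

(** The k elements [Ew k i] take the place of the k derivatives d1^i d2^(k-1-i) of [fgen]: a basis
    of the top derivatives with triangular symbols. *)
Definition in_layer k Q := exists x : nat -> F, inC k.-1 (Q - \sum_(i < k) x i *: Ew k i).

Lemma in_layer_inC k Q : inC k.-1 Q -> in_layer k Q.
Proof.
move=> hQ; exists (fun _ => 0); rewrite big1 ?subr0 // => i _; exact: scale0r.
Qed.

Lemma in_layer_Ew k i : (i < k)%N -> in_layer k (Ew k i).
Proof.
move=> ik; exists (fun l => (l == i)%:R); rewrite (bigD1 (Ordinal ik)) //= eqxx scale1r.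
rewrite big1 ?addr0 ?subrr; first exact: inC_0.
by move=> l; rewrite -val_eqE /= => /negPf ->; rewrite scale0r.
Qed.

Lemma in_layer_lin k h P Q : in_layer k P -> in_layer k Q -> in_layer k (h *: P + Q).
Proof.
move=> [x hx] [y hy]; exists (fun i => h * x i + y i).
have := inC_lin h hx hy; congr inC; rewrite scalerBr addrACA -opprD; congr (_ - _).
rewrite scaler_sumr -big_split /=; apply: eq_bigr => i _.
by rewrite scalerA scalerDl.
Qed.

Lemma in_layer_sum k (I : finType) (f : I -> M) :
  (forall i, in_layer k (f i)) -> in_layer k (\sum_i f i).
Proof.
move=> hf; elim/big_ind: _ => // [|x y hx hy].
  by apply: in_layer_inC; apply: inC_0.
by rewrite -[x]scale1r; apply: in_layer_lin.
Qed.

Lemma in_layer_D k P Q : in_layer k P -> in_layer k Q -> in_layer k (P + Q).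
Proof. by move=> hP hQ; rewrite -[P]scale1r; apply: in_layer_lin. Qed.

Lemma in_layer_Z k h P : in_layer k P -> in_layer k (h *: P).
Proof.
move=> hP; rewrite -[_ *: _]addr0; apply: in_layer_lin => //.
by apply: in_layer_inC; apply: inC_0.
Qed.

Lemma in_layer_fder2_Ew k i : (i < k < n)%N -> in_layer k.+1 (fder2 (Ew k i)).
Proof.
move=> ikn; have [b hb] := inC_fder2_Ew ikn; have /andP[ik _] := ikn.
rewrite -[X in in_layer _ X](subrK (b *: (Ew k.+1 k - Ew k.+1 i))).
apply: in_layer_D; first exact: in_layer_inC.
apply: in_layer_Z; rewrite addrC -scaleN1r.
apply: in_layer_lin; apply: in_layer_Ew => //; exact: ltnW.
Qed.

(** Layers are stable under [d2] by [inC_fder2_Ew], and under [d1] because [d1] is [sg k] plus [a k]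
    times [d2] and [sg k] sends [Ew k i] to [Ew k.+1 i]. For k <= n the differences needed are
    units. *)
Lemma inC_layer k Q : inC k Q -> (k <= n)%N -> in_layer k Q.
Proof.
elim=> {k Q} [|k|k h P Q _ hP _ hQ|k P hP _|k P hP IH|k P hP IH] kn.
- exact: (@in_layer_Ew 1 0).
- by apply: in_layer_inC; exact: inC_0.
- by apply: in_layer_lin; auto.
- exact: in_layer_inC.
- case: k => [|k] in hP IH kn *.
    by rewrite (inC0 hP) fder1_0; apply: in_layer_inC; apply: inC_0.
  have [x hx] := IH (ltnW kn).
  rewrite -[P](subrK (\sum_(i < k.+1) x i *: Ew k.+1 i)) fder1D fder1_sum.
  apply: in_layer_D; first by apply: in_layer_inC; apply: inC_der1.
  apply: in_layer_sum => i; rewrite fder1Z (fder1_sg k.+1 (Ew _ _)).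
  apply: in_layer_lin; first by apply: in_layer_inC; exact: inC_Ew.
  apply: in_layer_Z; apply: in_layer_D; last first.
    by apply: in_layer_Z; apply: in_layer_fder2_Ew; rewrite ltn_ord.
  have := @in_layer_Ew k.+2 i (leqW (ltn_ord i)).
  by rewrite EwS ltn_eqF.
- case: k => [|k] in hP IH kn *.
    by rewrite (inC0 hP) fder2_0; apply: in_layer_inC; apply: inC_0.
  have [x hx] := IH (ltnW kn).
  rewrite -[P](subrK (\sum_(i < k.+1) x i *: Ew k.+1 i)) fder2D fder2_sum.
  apply: in_layer_D; first by apply: in_layer_inC; apply: inC_der2.
  apply: in_layer_sum => i; rewrite fder2Z.
  apply: in_layer_lin; first by apply: in_layer_inC; exact: inC_Ew.
  by apply: in_layer_Z; apply: in_layer_fder2_Ew; rewrite ltn_ord.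
Qed.

(* Only the free derivatives d2^l u_m with l <= m occur in Q. *)
Definition ffree (Q : M) := forall (m : 'I_n) l, (m < l)%N -> (Q m)`_l = 0.

Lemma ffree_reduce k P : (k <= n)%N -> ford k P -> exists Q, ffree Q /\ inC k (P - Q).
Proof.
elim: k P => [|k IH] P kn oP.
  exists P; split; last by rewrite subrr; apply: inC_0.
  by move=> m l ml; apply: (leq_sizeP _ _ (oP m)); apply: leq_trans ml.
have [x hx] : exists x : nat -> F, forall m : 'I_n, (m < k.+1)%N ->
    ((P - \sum_(i < k.+1) x i *: Ew k.+1 i) m)`_k.+1 = 0.
  have /= [b hb] : exists b : {ffun 'I_n -> F}, forall m : 'I_n, (m < k.+1)%N ->
      (Ew k.+1 m m)`_k.+1 * b m = 1.
    have H (m : 'I_n) : exists b, (m < k.+1)%N ==> ((Ew k.+1 m m)`_k.+1 * b == 1).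
      case: (ltnP m k.+1) => [mk|_]; last by exists 0.
      have [|b hb] := @Ew_lead_diag k.+1 m _ m (erefl _); first by rewrite mk.
      by exists b; apply/eqP.
    exists [ffun m => xchoose (H m)] => m mk; rewrite ffunE.
    by have /implyP/(_ mk)/eqP := xchooseP (H m).
  (* Component m < k.+1 is cleared by [Ew k.+1 m] alone, since the other generators have no top
     coefficient there; [b m] inverts the diagonal one. *)
  exists (fun i => if insub i is Some m then (P m)`_k.+1 * b m else 0) => m mk.
  rewrite !ffunE coefB sum_ffunE coef_sum (bigD1 (Ordinal mk)) //.
  rewrite [X in _ - (_ + X)]big1 => [|i im].
    by rewrite addr0 ffunE coefZ (valK m) -mulrA [b m * _]mulrC hb // mulr1 subrr.
  by rewrite ffunE coefZ Ew_lead_off ?mulr0 // eq_sym.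
set P' := P - _ in hx; have defP' : P' = P - _ := erefl; clearbody P'.
(* The surviving top coefficients sit in components m >= k.+1, where degree k.+1 is free; only lower
   order is left for the induction. *)
pose T : M := [ffun m => (P' m)`_k.+1 *: 'X^(k.+1)].
have oP' : ford k.+1 P'.
  have oS : inC k.+1 (\sum_(i < k.+1) x i *: Ew k.+1 i).
    by apply: inC_sum => i; apply: inC_Z; apply: inC_Ew.
  by rewrite defP' addrC -scaleN1r; apply: ford_lin => //; apply: inC_ford.
have [|Q [fQ cQ]] := IH (P' - T) (ltnW kn).
  move=> m; apply/leq_sizeP=> j; rewrite leq_eqVlt => /orP[/eqP <-|kj].
    by rewrite !ffunE coefB coefZ coefXn eqxx mulr1 subrr.
  rewrite !ffunE coefB coefZ coefXn gtn_eqF // mulr0 subr0.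
  exact: (leq_sizeP _ _ (oP' m)).
exists (T + Q); split.
  move=> m l ml; rewrite !ffunE coefD coefZ coefXn fQ // addr0.
  by case: eqP ml => [->|_] ml; rewrite ?mulr0 // hx // mul0r.
have -> : P - (T + Q) = (P' - T - Q) + \sum_(i < k.+1) x i *: Ew k.+1 i.
  by apply/ffunP=> m; rewrite defP' !ffunE; ring.
apply: inC_D; first exact: inC_up.
by apply: inC_sum => i; apply: inC_Z; apply: inC_Ew.
Qed.

(** Uniqueness of the normal form. In degree k.+1 the component i < k.+1 of a free element is zero,
    and the generators are diagonal there up to units, so all coefficients of its layer
    decomposition vanish and the element descends to [inC k]. *)
Lemma ffree_inC k Q : (k <= n)%N -> inC k Q -> ffree Q -> Q = 0.
Proof.
elim: k Q => [|k IH] Q kn cQ fQ; first exact: inC0.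
have [x hx] := inC_layer cQ kn.
apply: IH => //; first exact: ltnW.
suff x0 (i : 'I_k.+1) : x i = 0.
  by move: hx; rewrite big1 ?subr0 // => i _; rewrite x0 scale0r.
have im : (i < n)%N by apply: leq_trans (ltn_ord i) kn.
have := inC_ford hx (Ordinal im) => /leq_sizeP/(_ k.+1 (leqnn _)).
rewrite !ffunE coefB fQ; last exact: (ltn_ord i).
rewrite sub0r sum_ffunE coef_sum (bigD1 i) //= big1 ?addr0.
  rewrite ffunE coefZ => /eqP; rewrite oppr_eq0 => /eqP.
  have [|b hb] := @Ew_lead_diag k.+1 i _ (Ordinal im) (erefl _); first by rewrite ltn_ord.
  by move=> /(congr1 (fun t => t * b)); rewrite -mulrA hb mulr1 mul0r.
move=> l li; rewrite ffunE coefZ Ew_lead_off ?mulr0 //.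
  exact: (ltn_ord i).
by rewrite eq_sym.
Qed.

(** The n + 1 derivatives of order n, in a basis where n of them keep independent symbols of degree
    n.+1 and the last one, [Wd n], has none. The pattern of [in_layer] stops here, as it would
    require an (n + 1)-st unknown. *)
Definition in_top Q := exists (y : nat -> F) z,
  inC n (Q - (\sum_(i < n) y i *: fder2 (Ew n i) + z *: Wd n)).

Lemma in_top_lin h P Q : in_top P -> in_top Q -> in_top (h *: P + Q).
Proof.
move=> [y [z hP]] [y' [z' hQ]]; exists (fun i => h * y i + y' i), (h * z + z').
have := inC_lin h hP hQ; congr inC; rewrite scalerBr addrACA -opprD; congr (_ - _).
rewrite scalerDr addrACA; congr (_ + _); last by rewrite scalerA scalerDl.
rewrite scaler_sumr -big_split /=; apply: eq_bigr => i _.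
by rewrite scalerA scalerDl.
Qed.

Lemma in_top_inC Q : inC n Q -> in_top Q.
Proof.
move=> hQ; exists (fun _ => 0), 0; rewrite big1 ?scale0r ?addr0 ?subr0 // => i _.
exact: scale0r.
Qed.

Lemma in_top_sum (I : finType) (f : I -> M) :
  (forall i, in_top (f i)) -> in_top (\sum_i f i).
Proof.
move=> hf; elim/big_ind: _ => // [|x y hx hy].
  by apply: in_top_inC; apply: inC_0.
by rewrite -[x]scale1r; apply: in_top_lin.
Qed.

Lemma in_top_fder2_Ew i : (i < n)%N -> in_top (fder2 (Ew n i)).
Proof.
move=> ik; exists (fun l => (l == i)%:R), 0.
rewrite (bigD1 (Ordinal ik)) //= eqxx scale1r scale0r addr0.
rewrite big1 ?addr0 ?subrr; first exact: inC_0.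
by move=> l; rewrite -val_eqE /= => /negPf ->; rewrite scale0r.
Qed.

Lemma in_top_Wd : in_top (Wd n).
Proof.
exists (fun _ => 0), 1; rewrite scale1r big1 ?add0r ?subrr; first exact: inC_0.
by move=> i _; rewrite scale0r.
Qed.

Lemma inC_top Q : inC n.+1 Q -> in_top Q.
Proof.
suff: forall k, inC k Q -> k = n.+1 -> in_top Q by move=> hk cQ; exact: hk cQ erefl.
move=> k hQ; elim: hQ => [[n0]|l ln|l h P P' _ hP _ hP' ln|l P hP _ [ln]|l P hP _ [ln]|l P hP _ [ln]].
- by exfalso; move: n_gt0; rewrite -n0.
- by apply: in_top_inC; apply: inC_0.
- by apply: in_top_lin; auto.
- by apply: in_top_inC; rewrite -ln.
- subst l; have [x hx] := inC_layer hP (leqnn n).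
  rewrite -[P](subrK (\sum_(i < n) x i *: Ew n i)) fder1D fder1_sum -[fder1 (_ - _)]scale1r.
  apply: in_top_lin.
    by apply: in_top_inC; have := inC_der1 hx; rewrite prednK.
  (* Here [d1] is split by the factor missing from [Ew n i], which completes [Ew n i] to [Wd n]
     modulo [inC n]. *)
  apply: in_top_sum => i; rewrite fder1Z (fder1_sg i (Ew _ _)).
  apply: in_top_lin; first by apply: in_top_inC; apply: inC_Ew.
  rewrite -[_ *: _]addr0; apply: in_top_lin; last by apply: in_top_inC; apply: inC_0.
  rewrite addrC; apply: in_top_lin; first exact: in_top_fder2_Ew.
  rewrite -[sg _ _](subrK (Wd n)) addrC -[Wd n]scale1r.
  apply: in_top_lin; first exact: in_top_Wd.
  by apply: in_top_inC; rewrite scale1r; apply: inC_sg_Ew.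
- subst l; have [x hx] := inC_layer hP (leqnn n).
  rewrite -[P](subrK (\sum_(i < n) x i *: Ew n i)) fder2D fder2_sum -[fder2 (_ - _)]scale1r.
  apply: in_top_lin.
    by apply: in_top_inC; have := inC_der2 hx; rewrite prednK.
  apply: in_top_sum => i; rewrite fder2Z.
  apply: in_top_lin; first by apply: in_top_inC; apply: inC_Ew.
  rewrite -[_ *: _]addr0; apply: in_top_lin; last by apply: in_top_inC; apply: inC_0.
  exact: in_top_fder2_Ew.
Qed.

(* The leading coefficients of the product over all l < n vanish. *)
Lemma Wd_ford : ford n (Wd n).
Proof.
move=> m; apply/leq_sizeP=> j; rewrite leq_eqVlt => /orP[/eqP <-|nj].
  by rewrite Wd_lead (bigD1 m) //= subrr mul0r mulr0.
by apply: (leq_sizeP _ _ (inC_ford (inC_Wd n) m)).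
Qed.

(** A free element has no coefficient of degree n.+1, so every [y i] is zero; the remaining multiple
    of [Wd n] lies in [inC n] by assumption, and uniqueness in order n applies. *)
Lemma ffree_inC_top Q : inC n (Wd n) -> inC n.+1 Q -> ffree Q -> Q = 0.
Proof.
move=> cW cQ fQ; have [y [z hyz]] := inC_top cQ.
apply: (@ffree_inC n) => //.
suff y0 (i : 'I_n) : y i = 0.
  move: hyz; rewrite big1 => [|i _]; last by rewrite y0 scale0r.
  rewrite add0r => hz; rewrite -[Q](subrK (z *: Wd n)).
  by apply: inC_D => //; apply: inC_Z.
have := inC_ford hyz i => /leq_sizeP/(_ n.+1 (leqnn _)).
rewrite !ffunE coefB fQ // ?leqW // sub0r coefD coefZ (leq_sizeP _ _ (Wd_ford i)) //.
rewrite mulr0 addr0 sum_ffunE coef_sum (bigD1 i) //= big1 ?addr0.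
  rewrite ffunE coefZ fder2_lead; last by apply: inC_ford; apply: inC_Ew.
  move=> /eqP; rewrite oppr_eq0 => /eqP.
  have [|b hb] := @Ew_lead_diag n i _ i (erefl _); first by rewrite ltn_ord leqnn.
  by move=> /(congr1 (fun t => t * b)); rewrite -mulrA hb mulr1 mul0r.
move=> l li; rewrite ffunE coefZ fder2_lead; last by apply: inC_ford; apply: inC_Ew.
by rewrite Ew_lead_off ?mulr0 // eq_sym.
Qed.

End FormalModule.

(** * Jets of solutions of a transport equation *)

Section Contact.
Variables (F : comNzRingType) (K : numFieldType).
Variables (d1 d2 : {additive F -> F}) (g1 g2 : F).
Hypothesis d1M : forall f g, d1 (f * g) = d1 f * g + f * d1 g.
Hypothesis d2M : forall f g, d2 (f * g) = d2 f * g + f * d2 g.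
Hypothesis d12 : forall f, d1 (d2 f) = d2 (d1 f) + g1 * d2 f - g2 * d1 f.
Variable ep : {rmorphism F -> K}.

(* f vanishes to order k at the point of evaluation [ep]. *)
Fixpoint van k f : Prop :=
  if k is k0.+1 then [/\ ep f = 0, van k0 (d1 f) & van k0 (d2 f)] else True.

Lemma van0 k : van k 0.
Proof. by elim: k => //= k IH; rewrite !raddf0. Qed.

Lemma van_le1 k f : van k.+1 f -> van k f.
Proof.
by elim: k f => //= k IH f [h0 [h1 h2 h3] [h4 h5 h6]]; split=> //; exact: IH.
Qed.

Lemma van_leq k l f : (k <= l)%N -> van l f -> van k f.
Proof.
by move=> /subnK <-; elim: (l - k)%N => [|m IH] //; rewrite addSn => /van_le1.
Qed.

Lemma van_D k f g : van k f -> van k g -> van k (f + g).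
Proof.
elim: k f g => //= k IH f g [h0 h1 h2] [h3 h4 h5].
by rewrite !raddfD /= h0 h3 addr0; split=> //; exact: IH.
Qed.

Lemma van_Ml k h f : van k f -> van k (h * f).
Proof.
elim: k h f => //= k IH h f [h0 h1 h2]; rewrite d1M d2M rmorphM h0 mulr0.
have vf : van k f by apply: van_le1; split.
by split=> //; apply: van_D; apply: IH.
Qed.

Lemma van_N k f : van k f -> van k (- f).
Proof. by rewrite -mulN1r; exact: van_Ml. Qed.

Lemma van_B k f g : van k f -> van k g -> van k (f - g).
Proof. by move=> hf /van_N; apply: van_D. Qed.

Lemma van_sum k (I : Type) (r : seq I) (P : pred I) (f : I -> F) :
  (forall i, P i -> van k (f i)) -> van k (\sum_(i <- r | P i) f i).
Proof.
by move=> hf; elim/big_ind: _ => // [|x y]; [exact: van0 | exact: van_D].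
Qed.

Lemma van_d1 k f : van k f -> van k.-1 (d1 f).
Proof. by case: k => //= k []. Qed.
Lemma van_d2 k f : van k f -> van k.-1 (d2 f).
Proof. by case: k => //= k []. Qed.

Lemma van1 f : ep f = 0 -> van 1 f. Proof. by []. Qed.
Lemma van_ep k f : van k.+1 f -> ep f = 0. Proof. by case. Qed.

Lemma van_mul1 k f g : ep f = 0 -> van k g -> van k.+1 (f * g).
Proof.
elim: k f g => [|k IH] f g hf hg; first by apply: van1; rewrite rmorphM hf mul0r.
split; first by rewrite rmorphM hf mul0r.
  rewrite d1M; apply: van_D; first exact: van_Ml.
  by apply: IH => //; exact: van_d1 hg.
rewrite d2M; apply: van_D; first exact: van_Ml.
by apply: IH => //; exact: van_d2 hg.
Qed.

Lemma van_exp k f h : ep f = 0 -> van k (f ^+ k * h).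
Proof.
move=> hf; elim: k => //= k IH; rewrite exprS -mulrA; exact: van_mul1.
Qed.

Lemma van_iter_d2 j k f : van k f -> (j < k)%N -> ep (iter j d2 f) = 0.
Proof.
elim: j k f => [|j IH] [|k] f //; first by move=> [].
by rewrite iterSr ltnS; move=> [_ _ v2] jk; apply: IH jk.
Qed.

Definition sig (a : F) (f : F) := d1 f - a * d2 f.

Lemma sigM a f g : sig a (f * g) = sig a f * g + f * sig a g.
Proof. by rewrite /sig d1M d2M; ring. Qed.
Lemma sigD a f g : sig a (f + g) = sig a f + sig a g.
Proof. by rewrite /sig !raddfD; ring. Qed.
Lemma sigB a f g : sig a (f - g) = sig a f - sig a g.
Proof. by rewrite /sig !raddfB /=; ring. Qed.

Lemma sig_exp a f k : sig a (f ^+ k.+1) = k.+1%:R * f ^+ k * sig a f.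
Proof.
elim: k => [|k IH]; first by rewrite expr1 expr0 !mul1r.
by rewrite exprS sigM IH -natr1 exprS; ring.
Qed.

Lemma van_sig a k f : van k.+1 f -> van k (sig a f).
Proof. by move=> vf; apply: van_B; [exact: van_d1 vf | apply: van_Ml; exact: van_d2 vf]. Qed.

(** The transport equation trades [d1] for [d2], so one pure [d2]-derivative decides whether f
    vanishes to one more order. The induction passes to [d2 f], which satisfies a transport equation
    with the commutator terms absorbed. *)
Lemma van_transport a k f :
  van k f -> van k (sig a f) -> ep (iter k d2 f) = 0 -> van k.+1 f.
Proof.
elim: k f => [|k IH] f vf vs hf; first exact: van1.
have v2 : van k (d2 f) by exact: van_d2 vf.
have v2' : van k.+1 (d2 f).
  apply: IH => //; last by rewrite -iterSr.
  have -> : sig a (d2 f) = d2 (sig a f) + (d2 a + g1) * d2 f - g2 * d1 f.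
    by rewrite /sig d12 raddfB /= d2M; ring.
  apply: van_B; last by apply: van_Ml; exact: van_d1 vf.
  by apply: van_D; [exact: van_d2 vs | exact: van_Ml].
split; [exact: van_ep vf | | exact: v2'].
have -> : d1 f = sig a f + a * d2 f by rewrite /sig subrK.
by apply: van_D => //; apply: van_Ml.
Qed.

(* [cst] are the constants and [xi1], [xi2] coordinates adapted to the frame at
   the point [ep]. *)
Variable cst : {rmorphism K -> F}.
Hypothesis ep_cst : forall c, ep (cst c) = c.
Hypothesis d1_cst : forall c, d1 (cst c) = 0.
Hypothesis d2_cst : forall c, d2 (cst c) = 0.
Variables xi1 xi2 : F.
Hypothesis ep_xi1 : ep xi1 = 0.
Hypothesis ep_xi2 : ep xi2 = 0.
Hypothesis d1_xi1 : ep (d1 xi1) = 1.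
Hypothesis d2_xi1 : ep (d2 xi1) = 0.
Hypothesis d2_xi2 : ep (d2 xi2) = 1.

Lemma sig_cst a c : sig a (cst c) = 0.
Proof. by rewrite /sig d1_cst d2_cst mulr0 subr0. Qed.

(** A truncated geometric series in [1 - u], which vanishes at the point. It replaces division by
    functions known to be nonzero only there. *)
Lemma approx_inverse k u : ep u = 1 -> exists t, van k (1 - t * u).
Proof.
move=> hu; exists (\sum_(i < k) (1 - u) ^+ i).
suff -> : 1 - (\sum_(i < k) (1 - u) ^+ i) * u = (1 - u) ^+ k * 1.
  by apply: van_exp; rewrite rmorphB rmorph1 hu subrr.
by rewrite mulr1; have := subrX1 (1 - u) k => /(canRL (subrK _)) ->; ring.
Qed.

(* Successive corrections by multiples of the powers of [xi1]. *)
Lemma approx_solution a b k g0 :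
  exists g, (exists t, g = g0 + xi1 * t) /\ van k (sig a g - b * g).
Proof.
have su : ep (sig a xi1) = 1 by rewrite /sig rmorphB rmorphM d1_xi1 d2_xi1 mulr0 subr0.
have [t ht] := approx_inverse k su.
suff /(_ k) [g [hg [s [r [hs hr]]]]] : forall l, exists g, (exists t, g = g0 + xi1 * t) /\
    exists s r, sig a g - b * g = xi1 ^+ l * s + r /\ van k r.
  by exists g; split=> //; rewrite hs; apply: van_D => //; apply: van_exp.
elim=> [|l [g [[q ->] [s [r [hg hr]]]]]].
  exists g0; split; first by exists 0; rewrite mulr0 addr0.
  by exists (sig a g0 - b * g0), 0; rewrite mul1r addr0; split=> //; exact: van0.
(* Integrating the error [xi1 ^+ l * s] in the direction of [sig a]: the constant [c] divides by l +
   1, and [t] divides by [sig a xi1] up to order k. *)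
pose c := cst (l.+1%:R^-1).
have hc : c * l.+1%:R = 1.
  have -> : l.+1%:R = cst l.+1%:R by rewrite rmorph_nat.
  by rewrite /c -rmorphM mulVf ?rmorph1 // pnatr_eq0.
exists (g0 + xi1 * q - xi1 ^+ l.+1 * (c * s * t)); split.
  by exists (q - xi1 ^+ l * (c * s * t)); rewrite exprS; ring.
exists (- (sig a (c * s * t) - b * (c * s * t))), (r + xi1 ^+ l * s * (1 - t * sig a xi1)).
split; last by apply: van_D => //; apply: van_Ml.
rewrite sigB (sigM _ (xi1 ^+ _)) sig_exp.
have -> : sig a (g0 + xi1 * q) = xi1 ^+ l * s + r + b * (g0 + xi1 * q).
  by rewrite -hg; ring.
have -> : l.+1%:R * xi1 ^+ l * sig a xi1 * (c * s * t) =
  xi1 ^+ l * s * (t * sig a xi1) * (c * l.+1%:R) by ring.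
by rewrite hc; ring.
Qed.

Lemma iter_d2D j f g : iter j d2 (f + g) = iter j d2 f + iter j d2 g.
Proof. by elim: j => //= j ->; rewrite raddfD. Qed.

Lemma iter_d2_exp k h z : ep z = 0 -> ep (d2 z) = 1 ->
  ep (iter k d2 (h * z ^+ k)) = k`!%:R * ep h.
Proof.
move=> hz hz2; elim: k h => [|k IH] h; first by rewrite /= mulr1 mul1r.
rewrite iterSr d2M iter_d2D rmorphD.
rewrite (van_iter_d2 (k := k.+1)) // ?add0r; last by rewrite mulrC; apply: van_exp.
have dX : d2 (z ^+ k.+1) = k.+1%:R * z ^+ k * d2 z.
  elim: (k) => [|l IHl]; first by rewrite expr1 expr0 !mul1r.
  by rewrite exprS d2M IHl -natr1 exprS; ring.
have -> : h * d2 (z ^+ k.+1) = (k.+1%:R * h * d2 z) * z ^+ k by rewrite dX; ring.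
by rewrite IH !rmorphM hz2 rmorph_nat factS natrM; ring.
Qed.

(* The solution is eps * sum_l c_l z^l, where eps solves the equation with eps = 1 at
   the point and z is a first integral of d1 - a d2. *)
Lemma prescribe_jet a b k (w : nat -> K) l :
  exists f, van k (sig a f - b * f) /\ forall j, (j < l)%N -> ep (iter j d2 f) = w j.
Proof.
have [eps [[t ht] heps]] := approx_solution a b k 1.
have [z [[t' ht'] hz]] := approx_solution a 0 k.+1 xi2.
have ez : ep z = 0 by rewrite ht' rmorphD rmorphM ep_xi1 ep_xi2 mul0r addr0.
have dz : ep (d2 z) = 1.
  by rewrite ht' raddfD /= d2M rmorphD d2_xi2 rmorphD !rmorphM d2_xi1 ep_xi1 !mul0r !addr0.
have e1 : ep eps = 1 by rewrite ht rmorphD rmorphM ep_xi1 rmorph1 mul0r addr0.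
elim: l => [|l [f [vf hf]]].
  by exists 0; split=> //; rewrite /sig !raddf0 !mulr0 !subr0; exact: van0.
(* At the point, [z ^+ l] has vanishing [d2]-derivatives below order l, and its l-th one is l!, so
   this correction leaves the values already prescribed unchanged. *)
pose c := (w l - ep (iter l d2 f)) / l`!%:R.
exists (f + cst c * eps * z ^+ l); split.
  have -> : sig a (f + cst c * eps * z ^+ l) - b * (f + cst c * eps * z ^+ l) =
     (sig a f - b * f) + cst c * z ^+ l * (sig a eps - b * eps)
     + cst c * eps * sig a (z ^+ l).
    by rewrite sigD !sigM sig_cst; ring.
  apply: van_D; last first.
    case: (l) => [|l0]; first by rewrite expr0 -[1](rmorph1 cst) sig_cst mulr0; exact: van0.
    rewrite sig_exp mulrA; apply: van_Ml; apply: van_le1.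
    by move: hz; rewrite mul0r subr0.
  by apply: van_D => //; apply: van_Ml.
move=> j; rewrite ltnS leq_eqVlt iter_d2D rmorphD => /orP[/eqP ->|jl].
  rewrite iter_d2_exp // rmorphM ep_cst e1 mulr1 /c mulrC divfK ?pnatr_eq0 -?lt0n ?fact_gt0 //.
  by rewrite addrC subrK.
rewrite hf // (van_iter_d2 (k := l)) ?addr0 // mulrC; exact: van_exp.
Qed.

End Contact.

Arguments van : simpl never.

(** * Formal operators evaluated on approximate solutions *)

Section Evaluation.
Variables (F : comNzRingType) (K : numFieldType).
Variables (d1 d2 : {additive F -> F}) (g1 g2 : F).
Hypothesis d1M : forall f g, d1 (f * g) = d1 f * g + f * d1 g.
Hypothesis d2M : forall f g, d2 (f * g) = d2 f * g + f * d2 g.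
Hypothesis d12 : forall f, d1 (d2 f) = d2 (d1 f) + g1 * d2 f - g2 * d1 f.
Variable ep : {rmorphism F -> K}.
Variables (n : nat) (a e : nat -> F).

Local Notation M := {ffun 'I_n -> {poly F}}.
Local Notation van := (van d1 d2 ep).
Local Notation sig := (sig d1 d2).
Local Notation fder1 := (fder1 d1 d2 g1 g2 a e).
Local Notation fder2 := (fder2 d2).
Local Notation inC := (inC d1 d2 g1 g2 a e).
Local Notation pcoef := (pcoef d2 g1 g2 a e).
Local Notation tder1 := (tder1 d1 d2 g1 g2 a e).
Local Notation tder2 := (tder2 d2).
Local Notation fgen := (fgen d2 g1 g2 n a e).
Local Notation vanD := (@van_D _ _ _ _ _).
Local Notation vanMl := (van_Ml d1M d2M).
Local Notation vanB := (van_B d1M d2M).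

Definition evp (P : {poly F}) f := \sum_(j < size P) P`_j * iter j d2 f.

Lemma evpE (P : {poly F}) f k : (size P <= k)%N -> evp P f = \sum_(j < k) P`_j * iter j d2 f.
Proof.
move=> sP; rewrite /evp (big_ord_widen k (fun j => P`_j * iter j d2 f) sP).
rewrite [RHS](bigID (fun j : 'I_k => (j < size P)%N)) /= [X in _ = _ + X]big1 ?addr0 //.
by move=> j; rewrite -leqNgt => /leq_sizeP -> //; rewrite mul0r.
Qed.

Lemma evpD P Q f : evp (P + Q) f = evp P f + evp Q f.
Proof.
pose k := maxn (size P) (size Q).
rewrite !(@evpE _ _ k) ?leq_maxl ?leq_maxr ?size_polyD // -big_split /=.
by apply: eq_bigr => j _; rewrite coefD mulrDl.
Qed.

Lemma evpZ h P f : evp (h *: P) f = h * evp P f.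
Proof.
rewrite !(@evpE _ _ (size P)) ?size_scale_leq // mulr_sumr.
by apply: eq_bigr => j _; rewrite coefZ mulrA.
Qed.

Lemma evpXn j f : evp 'X^j f = iter j d2 f.
Proof.
rewrite (@evpE _ _ j.+1) ?size_polyXn // big_ord_recr /= coefXn eqxx mul1r.
by rewrite big1 ?add0r // => k _; rewrite coefXn ltn_eqF ?mul0r.
Qed.

Lemma evp0 f : evp 0 f = 0.
Proof. by have := evpZ 0 0 f; rewrite scale0r mul0r. Qed.

Lemma evpB P Q f : evp (P - Q) f = evp P f - evp Q f.
Proof. by rewrite -scaleN1r evpD evpZ mulN1r. Qed.

Lemma evpC h f : evp h%:P f = h * f.
Proof. by have := evpZ h 'X^0 f; rewrite evpXn expr0 alg_polyC. Qed.

Lemma evp_tder2 P f : evp (tder2 P) f = d2 (evp P f).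
Proof.
elim/poly_mono_ind: P => [|P Q hP hQ|h j].
- by rewrite tder2_0 // evp0 raddf0.
- by rewrite (tder2D d2 P Q) (evpD (tder2 P)) (evpD P) hP hQ raddfD.
- by rewrite (tder2Z d2M h) (evpD (_ *: _)) !evpZ (tder2Xn d2M) !evpXn d2M.
Qed.

(** [f] satisfies its transport equation only to order k, and moving [d1] past each further [d2]
    differentiates the error once, at the price of one order. *)
Lemma evp_pcoef k i j f : van k (sig (a i) f - e i * f) ->
  van (k - j) (d1 (iter j d2 f) - evp (pcoef i j) f).
Proof.
move=> hf; elim: j => [|j IH].
  rewrite subn0 /= evpD evpZ -['X]expr1 evpXn evpC; congr van: hf.
  by rewrite /Web.sig /=; ring.
rewrite subnS [pcoef _ _]/= evpD evpB !evpZ evp_tder2 evpXn [iter j.+1 _ _]/= d12.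
rewrite (_ : _ - _ = d2 (d1 (iter j d2 f) - evp (pcoef i j) f)
  - g2 * (d1 (iter j d2 f) - evp (pcoef i j) f)); last by rewrite raddfB /=; ring.
apply: vanB; first exact: van_d2 IH.
by apply: vanMl; apply: van_leq IH; rewrite leq_pred.
Qed.

Lemma evp_tder1 k l i (P : {poly F}) f : van k (sig (a i) f - e i * f) -> (size P <= l.+1)%N ->
  van (k - l) (d1 (evp P f) - evp (tder1 i P) f).
Proof.
move=> hf sP.
have -> : d1 (evp P f) - evp (tder1 i P) f =
    \sum_(j < size P) P`_j * (d1 (iter j d2 f) - evp (pcoef i j) f).
  rewrite /tder1 evpD opprD addrA raddf_sum /=.
  have -> : evp (map_poly d1 P) f = \sum_(j < size P) d1 P`_j * iter j d2 f.
    rewrite (@evpE _ _ (size P)) ?map_poly_size //.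
    by apply: eq_bigr => j _; rewrite coef_map_id0 ?raddf0.
  have -> : evp (\sum_(j < size P) P`_j *: pcoef i j) f =
     \sum_(j < size P) P`_j * evp (pcoef i j) f.
    rewrite (big_morph (fun Q => evp Q f) (fun x y => evpD x y f) (evp0 f)).
    by apply: eq_bigr => j _; rewrite evpZ.
  rewrite -!sumrB; apply: eq_bigr => j _; rewrite d1M; ring.
apply: van_sum => j _; apply: vanMl; apply: van_leq (evp_pcoef j hf).
by apply: leq_sub2l; rewrite -ltnS; apply: leq_trans sP.
Qed.

Definition evM (P : M) (f : nat -> F) := \sum_(m < n) evp (P m) (f m).

Lemma evMD P Q f : evM (P + Q) f = evM P f + evM Q f.
Proof.
by rewrite /evM -big_split; apply: eq_bigr => m _; rewrite !ffunE evpD.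
Qed.
Lemma evMZ h P f : evM (h *: P) f = h * evM P f.
Proof.
by rewrite /evM mulr_sumr; apply: eq_bigr => m _; rewrite !ffunE evpZ.
Qed.
Lemma evMB P Q f : evM (P - Q) f = evM P f - evM Q f.
Proof. by rewrite -scaleN1r evMD evMZ mulN1r. Qed.
Lemma evM0 f : evM 0 f = 0.
Proof. by rewrite -[0 in LHS](scale0r 0) evMZ mul0r. Qed.

Lemma evM_fder2 P f : evM (fder2 P) f = d2 (evM P f).
Proof.
by rewrite /evM raddf_sum; apply: eq_bigr => m _; rewrite fder2E evp_tder2.
Qed.

Definition transported k (f : nat -> F) :=
  forall m, (m < n)%N -> van k (sig (a m) (f m) - e m * f m).

Lemma evM_fder1 k l P f : transported k f -> ford l P ->
  van (k - l) (d1 (evM P f) - evM (fder1 P) f).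
Proof.
move=> hf oP; rewrite /evM raddf_sum -sumrB; apply: van_sum => m _.
by rewrite fder1E; apply: evp_tder1 => //; apply: hf.
Qed.

Lemma evM_fgen f :
  evM fgen f = \sum_(m < n) (d1 (f m) - g1 * f m)
             - \sum_(m < n) (sig (a m) (f m) - e m * f m).
Proof.
rewrite -sumrB; apply: eq_bigr => m _; rewrite ffunE evpB evpC /= evpD evpZ evpC.
by rewrite -['X]expr1 evpXn /Web.sig /=; ring.
Qed.

(** Each derivative taken in building an element of [inC l] costs one order of vanishing; the
    generator itself, at l = 1, vanishes to order k. *)
Lemma evM_inC k f : transported k f -> van k (\sum_(m < n) (d1 (f m) - g1 * f m)) ->
  forall l P, inC l P -> van (k.+1 - l) (evM P f).
Proof.
move=> hf hg l P; elim=> {l P} [|l|l h P Q _ hP _ hQ|l P _ hP|l P cP hP|l P _ hP].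
- rewrite subSS subn0 evM_fgen; apply: vanB => //.
  by apply: van_sum => m _; apply: hf.
- by rewrite evM0; apply: van0.
- by rewrite evMD evMZ; apply: vanD => //; apply: vanMl.
- by apply: van_leq hP; rewrite leq_sub2l.
- have -> : evM (fder1 P) f = d1 (evM P f) - (d1 (evM P f) - evM (fder1 P) f) by ring.
  apply: vanB; last by rewrite subSS; apply: evM_fder1 => //; apply: inC_ford cP.
  by rewrite subnS; apply: van_d1.
- by rewrite evM_fder2 subnS; apply: van_d2.
Qed.

(** A converse: derivatives of the value of [P] are, up to the error of the transport equations,
    values of elements one filtration step higher, so vanishing of all of them at the point alone
    yields vanishing to higher order. *)
Lemma van_evM_inC k f : transported k f ->
  (forall l P, (l <= k)%N -> inC l P -> ep (evM P f) = 0) ->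
  forall r l P, (l + r = k.+1)%N -> inC l P -> van r (evM P f).
Proof.
move=> hf h0; elim=> [|r IH] l P lr cP //.
have lk : (l <= k)%N by rewrite -ltnS -lr addnS ltnS leq_addr.
split; first exact: h0 cP.
- have -> : d1 (evM P f) = evM (fder1 P) f + (d1 (evM P f) - evM (fder1 P) f) by ring.
  apply: vanD; first by apply: (IH l.+1); [rewrite addSnnS | exact: inC_der1].
  apply: van_leq (evM_fder1 hf (inC_ford cP)).
  by rewrite leq_subRL // -ltnS -lr addnS.
- by rewrite -evM_fder2; apply: (IH l.+1); [rewrite addSnnS | exact: inC_der2].
Qed.

Fixpoint sig_word j (f : F) := if j is j0.+1 then sig (a j0) (sig_word j0 f) else f.

Lemma evM_Wd k f j : transported k f ->
  van (k - j) (evM (Wd d1 d2 g1 g2 n a e j) f - sig_word j (evM fgen f)).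
Proof.
move=> hf; elim: j => [|j IH]; first by rewrite subrr; apply: van0.
rewrite subnS [Wd _ _ _ _ _ _ _ _]/= /sg evMB evMZ evM_fder2 [sig_word _ _]/=.
set W := Wd _ _ _ _ _ _ _ _ in IH *; set S := sig_word _ _ in IH *.
have -> : evM (fder1 W) f - a j * d2 (evM W f) - sig (a j) S =
   sig (a j) (evM W f - S) - (d1 (evM W f) - evM (fder1 W) f).
  by rewrite /Web.sig !raddfB /=; ring.
apply: vanB; last first.
  rewrite -subnS; apply: evM_fder1 => //; apply: inC_ford => //; exact: inC_Wd.
case: (k - j)%N IH => // r; exact: (van_sig d1M d2M).
Qed.

End Evaluation.

(** * Compositions of first-order operators *)

Section Words.
Variables (F : comNzRingType) (K : numFieldType).
Variables (d1 d2 : {additive F -> F}) (g1 g2 : F).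
Hypothesis d1M : forall f g, d1 (f * g) = d1 f * g + f * d1 g.
Hypothesis d2M : forall f g, d2 (f * g) = d2 f * g + f * d2 g.
Hypothesis d12 : forall f, d1 (d2 f) = d2 (d1 f) + g1 * d2 f - g2 * d1 f.
Variable ep : {rmorphism F -> K}.
Local Notation van := (van d1 d2 ep).
Local Notation vanD := (@van_D _ _ _ _ _).
Local Notation vanMl := (van_Ml d1M d2M).
Local Notation vanB := (van_B d1M d2M).

(* As [wop] in the statement: the first argument is the weight. *)
Definition fop := nat -> F -> F.
Definition has_symbol (A : fop) u v :=
  forall k, exists c, forall f, A k f = u * d1 f + v * d2 f + c * f.
Definition first_order A := exists u v, has_symbol A u v.

Fixpoint fcomp (l : list fop) k f :=
  if l is A :: l0 then A (k + size l0)%N (fcomp l0 k f) else f.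

Lemma has_symbolB A u v k f g : has_symbol A u v -> A k (f - g) = A k f - A k g.
Proof. by move=> /(_ k)[c hc]; rewrite !hc !raddfB /=; ring. Qed.

Lemma van_op A u v k m f : has_symbol A u v -> van m.+1 f -> van m (A k f).
Proof.
move=> /(_ k)[c hc] hf; rewrite hc; apply: vanD.
  by apply: vanD; apply: vanMl; [exact: van_d1 hf | exact: van_d2 hf].
by apply: vanMl; apply: van_le1.
Qed.

Lemma van_fcomp l k m f : List.Forall first_order l ->
  van (size l + m) f -> van m (fcomp l k f).
Proof.
move=> hl; elim: hl m => {l} [|A l [u [v hA]] _ IH] m; first by [].
rewrite [size _]/= addSnnS => /IH; exact: van_op hA.
Qed.

Lemma fcompB l k f g : List.Forall first_order l ->
  fcomp l k (f - g) = fcomp l k f - fcomp l k g.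
Proof.
elim=> {l} //= A l [u [v hA]] _ ->; exact: has_symbolB hA.
Qed.

Lemma fcomp0 l k : List.Forall first_order l -> fcomp l k 0 = 0.
Proof. by move=> hl; have := fcompB k 0 0 hl; rewrite !subrr. Qed.

Lemma fcompD l k f g : List.Forall first_order l ->
  fcomp l k (f + g) = fcomp l k f + fcomp l k g.
Proof.
move=> hl; have -> : f + g = f - (0 - g) by ring.
by rewrite !fcompB // fcomp0 // sub0r opprK.
Qed.

Lemma fcomp_sum l k (I : finType) (f : I -> F) : List.Forall first_order l ->
  fcomp l k (\sum_i f i) = \sum_i fcomp l k (f i).
Proof.
move=> hl; apply: (big_morph (fcomp l k)); last exact: fcomp0.
by move=> x y; apply: fcompD.
Qed.

Lemma fcomp_cat l1 l2 k f : fcomp (l1 ++ l2) k f = fcomp l1 (k + size l2) (fcomp l2 k f).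
Proof. by elim: l1 => //= A l ->; rewrite size_cat addnAC addnA. Qed.

Lemma Permutation_size (T : Type) (l l' : list T) : Permutation l l' -> size l = size l'.
Proof.
by elim=> {l l'} //= [x l l' _ ->|l l' l'' _ -> _ ->].
Qed.

Lemma van_op_comm A u v B u' v' k m f : has_symbol A u v -> has_symbol B u' v' ->
  van m.+2 f -> van m.+1 (A k.+1 (B k f) - B k.+1 (A k f)).
Proof.
move=> hA hB hf.
have [c1 E1] := hA k.+1; have [c2 E2] := hB k; have [c3 E3] := hB k.+1.
have [c4 E4] := hA k; rewrite E1 E2 E3 E4.
(* The second-order terms cancel except for the bracket of [d1] and [d2], which contributes the
   terms with [g1] and [g2]. *)
rewrite (_ : _ - _ =
   (u * d1 u' + v * d2 u' - u' * d1 u - v' * d2 u + u * c2 + c1 * u' - u' * c4 - c3 * u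
     - g2 * (u * v' - v * u')) * d1 f
   + (u * d1 v' + v * d2 v' - u' * d1 v - v' * d2 v + v * c2 + c1 * v' - v' * c4 - c3 * v
     + g1 * (u * v' - v * u')) * d2 f
   + (u * d1 c2 + v * d2 c2 - u' * d1 c4 - v' * d2 c4 + c1 * c2 - c3 * c4) * f); last first.
  by rewrite !raddfD /= !d1M !d2M d12; ring.
apply: vanD; last by apply: vanMl; apply: van_le1.
by apply: vanD; apply: vanMl; [exact: (van_d1 hf) | exact: (van_d2 hf)].
Qed.

(* Reordering a composition of L first-order operators changes it by an
   operator of order L - 1. *)
Lemma van_fcomp_perm l l' : Permutation l l' -> List.Forall first_order l ->
  forall k m f, van (size l + m) f -> van m.+1 (fcomp l k f - fcomp l' k f).
Proof.
elim=> {l l'} [|A l l' pl IH|A B l|l l' l'' pl IH pl' IH'] hl k m f hf.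
- by rewrite subrr; apply: van0.
- have [u [v hA]] := List.Forall_inv hl.
  have hl' := List.Forall_inv_tail hl.
  rewrite /= -(Permutation_size pl) -(has_symbolB _ _ _ hA).
  by apply: (van_op _ hA); apply: IH => //; rewrite -addSnnS.
- have [u [v hA]] := List.Forall_inv hl.
  have hl' := List.Forall_inv_tail hl.
  have [u' [v' hB]] := List.Forall_inv hl'.
  have hl'' := List.Forall_inv_tail hl'.
  rewrite /= addnS; apply: (van_op_comm _ hA hB).
  by apply: van_fcomp => //; move: hf; rewrite /= !addSn -!addnS.
- rewrite -(subrKA (fcomp l' k f)); apply: vanD; first exact: IH.
  apply: IH'; last by rewrite -(Permutation_size pl).
  exact: Permutation_Forall pl hl.
Qed.

Definition same_symbol A B := exists u v, has_symbol A u v /\ has_symbol B u v.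

(** Equal symbols factor by factor give equal principal parts of the compositions. The weights k and
    k' may differ, since a weight only enters the zeroth-order terms. *)
Lemma van_fcomp_symbol l l' : List.Forall2 same_symbol l l' ->
  forall k k' m f, van (size l + m) f -> van m.+1 (fcomp l k f - fcomp l' k' f).
Proof.
elim=> {l l'} [|A B l l' [u [v [hA hB]]] hl IH] k k' m f hf.
  by rewrite subrr; apply: van0.
rewrite /= -(subrKA (A (k + size l)%N (fcomp l' k' f))) -(has_symbolB _ _ _ hA).
apply: vanD.
  by apply: (van_op _ hA); apply: IH; rewrite -addSnnS.
have [c1 ->] := hA (k + size l)%N; have [c2 ->] := hB (k' + size l')%N.
rewrite (_ : _ - _ = (c1 - c2) * fcomp l' k' f); last by ring.
have sl : size l = size l' by elim: hl => //= *; congr S.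
apply: vanMl; apply: van_fcomp; last by move: hf; rewrite /= -sl addnS.
by elim: hl => //= A' B' l1 l1' [u' [v' [_ h']]] _ h; constructor=> //; exists u', v'.
Qed.

End Words.

(** * Normal forms in the free derivatives *)

Section Reduction.
Variables (F : comNzRingType).
Variables (d1 d2 : {additive F -> F}) (g1 g2 : F).
Hypothesis d1M : forall f g, d1 (f * g) = d1 f * g + f * d1 g.
Hypothesis d2M : forall f g, d2 (f * g) = d2 f * g + f * d2 g.
Hypothesis d12 : forall f, d1 (d2 f) = d2 (d1 f) + g1 * d2 f - g2 * d1 f.
Variables (n : nat) (a e : nat -> F).
Hypothesis n_gt0 : (0 < n)%N.
Hypothesis a_unit : forall i, (i < n)%N -> exists b, a i * b = 1.
Hypothesis ad_unit : forall i j, (i < n)%N -> (j < n)%N -> i != j ->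
  exists b, (a i - a j) * b = 1.

Local Notation M := {ffun 'I_n -> {poly F}}.
Local Notation fder1 := (fder1 d1 d2 g1 g2 a e).
Local Notation fder2 := (fder2 d2).
Local Notation inC := (inC d1 d2 g1 g2 a e).
Local Notation Wd := (Wd d1 d2 g1 g2 n a e).
Local Notation fgen := (fgen d2 g1 g2 n a e).

(* (i, l) stands for the free derivative d2^l u_i. *)
Definition fidx := {p : 'I_n * 'I_n | (p.2 <= p.1)%N}.

Definition mono (i : 'I_n) (j : nat) : M := [ffun m => if m == i then 'X^j else 0].
Definition fbasis (b : fidx) : M := mono (val b).1 (val b).2.
Definition cf (Q : M) (b : fidx) : F := (Q (val b).1)`_(val b).2.

Lemma cfD P Q b : cf (P + Q) b = cf P b + cf Q b.
Proof. by rewrite /cf ffunE coefD. Qed.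
Lemma cfZ h Q b : cf (h *: Q) b = h * cf Q b.
Proof. by rewrite /cf ffunE coefZ. Qed.
Lemma cfB P Q b : cf (P - Q) b = cf P b - cf Q b.
Proof. by rewrite /cf !ffunE coefB. Qed.
Lemma cf_sum (I : finType) (f : I -> M) b : cf (\sum_i f i) b = \sum_i cf (f i) b.
Proof. by rewrite /cf sum_ffunE coef_sum. Qed.

Lemma cf_mono i j b : cf (mono i j) b = (((val b).1 == i) && ((val b).2 == j :> nat))%:R.
Proof.
by rewrite /cf ffunE; case: eqP => _; rewrite ?coef0 // coefXn.
Qed.

Lemma cf_fbasis b c : cf (fbasis b) c = (c == b)%:R.
Proof.
by rewrite cf_mono -val_eqE.
Qed.

Lemma ffree_cf0 (Q : M) : ffree Q -> (forall b, cf Q b = 0) -> Q = 0.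
Proof.
move=> fQ h; apply/ffunP=> i; rewrite ffunE; apply/polyP=> j; rewrite coef0.
case: (leqP j i) => [ji|ij]; last exact: fQ.
have jn : (j < n)%N by apply: leq_ltn_trans ji _.
exact: (h (Sub (i, Ordinal jn) ji)).
Qed.

Lemma ffree_lin h (P Q : M) : ffree P -> ffree Q -> ffree (h *: P + Q).
Proof.
by move=> fP fQ m l ml; rewrite !ffunE coefD coefZ fP // fQ // mulr0 addr0.
Qed.
Lemma ffree0 : ffree (0 : M). Proof. by move=> m l _; rewrite ffunE coef0. Qed.
Lemma ffreeD (P Q : M) : ffree P -> ffree Q -> ffree (P + Q).
Proof. by move=> fP fQ; rewrite -[P]scale1r; apply: ffree_lin. Qed.
Lemma ffreeZ h (P : M) : ffree P -> ffree (h *: P).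
Proof. by move=> fP; rewrite -[_ *: _]addr0; apply: ffree_lin => //; apply: ffree0. Qed.
Lemma ffreeB (P Q : M) : ffree P -> ffree Q -> ffree (P - Q).
Proof. by move=> fP fQ; rewrite addrC -scaleN1r; apply: ffree_lin. Qed.
Lemma ffree_sum (I : finType) (f : I -> M) :
  (forall i, ffree (f i)) -> ffree (\sum_i f i).
Proof.
by move=> hf; elim/big_ind: _ => // [|x y hx hy]; [exact: ffree0 | exact: ffreeD].
Qed.
Lemma ffree_mono (i : 'I_n) j : (j <= i)%N -> ffree (mono i j).
Proof.
move=> ji m l ml; rewrite ffunE; case: eqP => [mi|_]; last by rewrite coef0.
by rewrite coefXn gtn_eqF // (leq_ltn_trans ji) // -mi.
Qed.
Lemma ffree_fbasis b : ffree (fbasis b).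
Proof. by apply: ffree_mono; apply: (valP b). Qed.

Lemma ffree_decomp (Q : M) : ffree Q -> Q = \sum_b cf Q b *: fbasis b.
Proof.
move=> fQ; apply/eqP; rewrite -subr_eq0; apply/eqP; apply: ffree_cf0.
  apply: ffreeB => //; apply: ffree_sum => b; apply: ffreeZ; exact: ffree_fbasis.
move=> b; rewrite cfB cf_sum (bigD1 b) //= cfZ cf_fbasis eqxx mulr1 big1.
  by rewrite addr0 subrr.
by move=> c cb; rewrite cfZ cf_fbasis eq_sym (negPf cb) mulr0.
Qed.

Lemma ford_mono i j : ford j (mono i j).
Proof. by move=> m; rewrite ffunE; case: eqP => _; rewrite ?size_polyXn ?size_poly0. Qed.

Lemma reduction_exists : exists r : 'I_n -> nat -> M,
  forall i j, (j <= n)%N -> ffree (r i j) /\ inC n (mono i j - r i j).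
Proof.
have H (i : 'I_n) (j : 'I_n.+1) : exists Q, ffree Q /\ inC n (mono i j - Q).
  have jn : (j <= n)%N by rewrite -ltnS.
  have [Q [fQ cQ]] := ffree_reduce d1 d2 g1 g2 e a_unit ad_unit jn (@ford_mono i j).
  by exists Q; split=> //; apply: inC_leq cQ.
have [r hr] := @boolp.choice _ _ _ (fun p : 'I_n * 'I_n.+1 => H p.1 p.2).
by exists (fun i j => r (i, inord j)) => i j jn; have := hr (i, inord j); rewrite /= inordK.
Qed.

(** Extension of the normal forms of monomials that is linear over functions, not just over
    constants, so that reduction can be exchanged with evaluation of coefficients at a point. *)
Definition reduce (r : 'I_n -> nat -> M) (P : M) : M :=
  \sum_(i < n) \sum_(j < n.+1) (P i)`_j *: r i j.

Lemma ford_decomp (P : M) : ford n P -> P = \sum_(i < n) \sum_(j < n.+1) (P i)`_j *: mono i j.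
Proof.
move=> oP; apply/ffunP=> m; rewrite sum_ffunE (bigD1 m) //= [X in _ + X]big1 ?addr0.
  rewrite sum_ffunE -[LHS]coefK poly_def.
  rewrite (big_ord_widen n.+1 (fun j => (P m)`_j *: 'X^j) (oP m)) big_mkcond.
  apply: eq_bigr => j _; rewrite !ffunE eqxx; case: ltnP => // /leq_sizeP -> //.
  by rewrite scale0r.
move=> i im; rewrite sum_ffunE big1 // => j _.
by rewrite !ffunE eq_sym (negPf im) scaler0.
Qed.

Section ReductionMap.
Variable r : 'I_n -> nat -> M.
Hypothesis hr : forall i j, (j <= n)%N -> ffree (r i j) /\ inC n (mono i j - r i j).

Lemma ffree_reduceP P : ffree (reduce r P).
Proof.
apply: ffree_sum => i; apply: ffree_sum => j; apply: ffreeZ.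
by have [|] := hr i (j := j); rewrite // -ltnS.
Qed.

Lemma inC_reduce (P : M) : ford n P -> inC n (P - reduce r P).
Proof.
move=> oP; rewrite [X in X - _](ford_decomp oP) /reduce -sumrB.
apply: inC_sum => i; rewrite -sumrB; apply: inC_sum => j; rewrite -scalerBr.
by apply: inC_Z; have [|] := hr i (j := j); rewrite // -ltnS.
Qed.

Lemma inC_ford_le k (P : M) : (k <= n)%N -> inC k P -> ford n P.
Proof. by move=> kn cP; apply: ford_leq kn _; apply: inC_ford cP. Qed.

(** The normal form of an element of the submodule is free and again in the submodule, hence zero by
    uniqueness. *)
Lemma reduce_inC k (P : M) : (k <= n)%N -> inC k P -> reduce r P = 0.
Proof.
move=> kn cP; apply: (ffree_inC d1M d2M d12 a_unit ad_unit (leqnn n)); last exact: ffree_reduceP.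
rewrite -[reduce r P](subKr P); apply: inC_B; first exact: inC_leq cP.
by apply: inC_reduce; apply: inC_ford_le cP.
Qed.

End ReductionMap.
End Reduction.

(** * The operator kappa *)

Section Kappa.
Variables (F : comNzRingType) (K : numFieldType).
Variables (d1 d2 : {additive F -> F}) (g1 g2 : F).
Hypothesis d1M : forall f g, d1 (f * g) = d1 f * g + f * d1 g.
Hypothesis d2M : forall f g, d2 (f * g) = d2 f * g + f * d2 g.
Hypothesis d12 : forall f, d1 (d2 f) = d2 (d1 f) + g1 * d2 f - g2 * d1 f.
Variables (n : nat) (a : nat -> F).
Hypothesis n_gt0 : (0 < n)%N.
Hypothesis a_unit : forall i, (i < n)%N -> exists b, a i * b = 1.
Hypothesis ad_unit : forall i j, (i < n)%N -> (j < n)%N -> i != j ->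
  exists b, (a i - a j) * b = 1.
Variable ep : {rmorphism F -> K}.

Definition zcoef i := d2 (a i) + g1 - g2 * a i.
Definition fde1 : fop F := fun k f => d1 f - k%:R * g1 * f.
Definition fDe (i : nat) : fop F :=
  fun k f => fde1 k f - (d2 (a i * f) - k%:R * g2 * (a i * f)).

Local Notation M := {ffun 'I_n -> {poly F}}.
Local Notation van := (van d1 d2 ep).
Local Notation sig := (sig d1 d2).
Local Notation inC := (inC d1 d2 g1 g2 a zcoef).
Local Notation Wd := (Wd d1 d2 g1 g2 n a zcoef).
Local Notation fgen := (fgen d2 g1 g2 n a zcoef).
Local Notation has_symbol := (has_symbol d1 d2).
Local Notation first_order := (first_order d1 d2).
Local Notation evM := (evM d2).

Lemma fDe1E i f : fDe i 1 f = sig (a i) f - zcoef i * f.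
Proof. by rewrite /fDe /fde1 /Web.sig /zcoef d2M; ring. Qed.

Lemma fde1_symbol : has_symbol fde1 1 0.
Proof. by move=> k; exists (- (k%:R * g1)) => f; rewrite /fde1; ring. Qed.

Lemma fDe_symbol i : has_symbol (fDe i) 1 (- a i).
Proof.
move=> k; exists (- (k%:R * g1) - d2 (a i) + k%:R * g2 * a i) => f.
by rewrite /fDe /fde1 d2M; ring.
Qed.

Definition word1 : list (fop F) := map fDe (iota 0 n) ++ [:: fde1].
Definition word2 i : list (fop F) :=
  map fDe (iota 0 i) ++ [:: fde1] ++ map fDe (iota i.+1 (n - i.+1)) ++ [:: fDe i].
Definition fbox i f := fcomp word1 1 f - fcomp (word2 i) 1 f.
Definition fkappa (f : nat -> F) := \sum_(i < n) fbox i (f i).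

Lemma Forall_fDe s : List.Forall first_order (map fDe s).
Proof.
elim: s => [|i s IH]; first exact: List.Forall_nil.
by apply: List.Forall_cons => //; exists 1, (- a i); apply: fDe_symbol.
Qed.

Lemma Forall_word1 : List.Forall first_order word1.
Proof.
apply/List.Forall_app; split; first exact: Forall_fDe.
by apply: List.Forall_cons => //; exists 1, 0; apply: fde1_symbol.
Qed.

Lemma perm_word i : (i < n)%N -> Permutation word1 (word2 i).
Proof.
move=> ni; rewrite /word1 /word2 -{1}(subnKC (ltnW ni)) iotaD map_cat add0n -catA.
apply: Permutation_app_head; rewrite -subnSK //= .
apply: (@Permutation_trans _ _ (fde1 :: fDe i :: map fDe (iota i.+1 (n - i.+1)))).
  rewrite -cat_cons; apply: Permutation_sym; exact: Permutation_cons_append.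
apply: perm_skip; exact: Permutation_cons_append.
Qed.

Lemma Forall_word2 i : (i < n)%N -> List.Forall first_order (word2 i).
Proof. by move=> ni; apply: Permutation_Forall (perm_word ni) Forall_word1. Qed.

Lemma size_word1 : size word1 = n.+1.
Proof. by rewrite size_cat size_map size_iota addn1. Qed.

(* Each box is an operator of order at most n although its two words have n + 1 letters. *)
Lemma fkappa_order f : (forall i, (i < n)%N -> van n.+1 (f i)) -> ep (fkappa f) = 0.
Proof.
move=> hf; apply: (@van_ep _ _ d1 d2 _ 0); apply: van_sum => i _.
apply: (van_fcomp_perm d1M d2M d12 (perm_word (ltn_ord i)) Forall_word1).
by rewrite size_word1 addn0; apply: hf.
Qed.

Lemma fkappaB f g : fkappa (fun i => f i - g i) = fkappa f - fkappa g.
Proof.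
rewrite /fkappa -sumrB; apply: eq_bigr => i _; rewrite /fbox.
rewrite (fcompB _ _ _ Forall_word1) (fcompB _ _ _ (Forall_word2 (ltn_ord i))).
ring.
Qed.

Definition sgop (j : nat) : fop F := fun _ f => sig (a j) f.

Lemma sgop_symbol j : has_symbol (sgop j) 1 (- a j).
Proof. by move=> k; exists 0 => f; rewrite /sgop /Web.sig; ring. Qed.

Lemma Forall_sgop s : List.Forall first_order (map sgop s).
Proof.
elim: s => [|i s IH]; first exact: List.Forall_nil.
by apply: List.Forall_cons => //; exists 1, (- a i); apply: sgop_symbol.
Qed.

Lemma sig_wordE j f : sig_word d1 d2 a j f = fcomp (map sgop (rev (iota 0 j))) 0 f.
Proof. by elim: j => [|j IH] //; rewrite -[in RHS]addn1 iotaD rev_cat map_cat /= -IH. Qed.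

Lemma Permutation_rev_seq (T : Type) (s : seq T) : Permutation s (rev s).
Proof.
elim: s => [|x s IH]; first exact: perm_nil.
rewrite rev_cons -cats1; apply: (Permutation_trans (perm_skip x IH)).
exact: Permutation_cons_append.
Qed.

(** The first words of the boxes add up to Delta_1 ... Delta_n applied to the last equation, and the
    second words act on the [fDe i 1 (f i)], which vanish to sufficient order. What remains has the
    same symbols as the product in [Wd n] but in reverse order, and with n factors acting on a
    function that vanishes to order n this makes no difference at the point. *)
Lemma fkappa_Wd f : (forall i, (i < n)%N -> van n.+1 (fDe i 1 (f i))) ->
  van n (\sum_(i < n) fde1 1 (f i)) -> ep (fkappa f) = ep (evM (Wd n) f).
Proof.
move=> hD hg; set g := \sum_(i < n) _ in hg.
have htr : transported d1 d2 ep n a zcoef n.+1 f by move=> i ni; rewrite -fDe1E; apply: hD.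
apply/eqP; rewrite -subr_eq0 -rmorphB; apply/eqP; apply: (@van_ep _ _ d1 d2 _ 0).
pose S := sig_word d1 d2 a n.
have -> : fkappa f - evM (Wd n) f = (fcomp (map fDe (iota 0 n)) 2 g - S g)
   - \sum_(i < n) fcomp (word2 i) 1 (f i)
   - (evM (Wd n) f - S (evM fgen f)) + (S g - S (evM fgen f)).
  rewrite /fkappa sumrB; suff -> : \sum_(i < n) fcomp word1 1 (f i) =
     fcomp (map fDe (iota 0 n)) 2 g by ring.
  rewrite /g (fcomp_sum _ _ (Forall_fDe _)); apply: eq_bigr => i _.
  by rewrite fcomp_cat.
apply: van_D; last first.
  have -> : S g - S (evM fgen f) = S (g - evM fgen f).
    by rewrite /S !sig_wordE (fcompB _ _ _ (Forall_sgop _)).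
  rewrite /S sig_wordE; apply: (van_fcomp d1M d2M _ (Forall_sgop _)).
  rewrite size_map size_rev size_iota addn1 (evM_fgen d1).
  have -> : \sum_(m < n) (d1 (f m) - g1 * f m) = g.
    by apply: eq_bigr => m _; rewrite /fde1; ring.
  by rewrite subKr; apply: van_sum => m _; apply: htr.
apply: (van_B d1M d2M); last first.
  have := @evM_Wd _ _ d1 d2 g1 g2 d1M d2M d12 ep n a zcoef n.+1 f n htr.
  by rewrite subSnn.
apply: (van_B d1M d2M); last first.
  apply: van_sum => i _; rewrite /word2 !catA fcomp_cat.
  have h2 := Forall_word2 (ltn_ord i); rewrite /word2 !catA in h2.
  move: h2 => /List.Forall_app[h2 _].
  apply: (van_fcomp d1M d2M _ h2) => /=.
  rewrite !size_cat !size_map !size_iota /=.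
  have -> : (i + 1 + (n - i.+1) + 1 = n.+1)%N by rewrite !addn1 subnKC.
  exact: hD.
have hgn : van (n + 0) g by rewrite addn0.
rewrite -(subrKA (fcomp (map sgop (iota 0 n)) 0 g)); apply: van_D.
  apply: (van_fcomp_symbol d1M d2M); last by rewrite size_map size_iota.
  elim: (iota 0 n) => [|i s IH]; first exact: List.Forall2_nil.
  apply: List.Forall2_cons => //; exists 1, (- a i); split; [exact: fDe_symbol | exact: sgop_symbol].
rewrite /S sig_wordE.
apply: (van_fcomp_perm d1M d2M d12 _ (Forall_sgop _)); last by rewrite size_map size_iota.
by rewrite map_rev; apply: Permutation_rev_seq.
Qed.

Lemma evM_mono (i : 'I_n) j (f : nat -> F) : evM (mono F i j) f = iter j d2 (f i).
Proof.
rewrite /Web.evM (bigD1 i) //= ffunE eqxx evpXn big1 ?addr0 // => m mi.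
by rewrite ffunE (negPf mi) evp0.
Qed.

Lemma evM_ffree (Q : M) (f : nat -> F) : ffree Q ->
  evM Q f = \sum_b cf Q b * iter (val b).2 d2 (f (val b).1).
Proof.
move=> fQ; rewrite {1}(ffree_decomp fQ).
rewrite (big_morph (fun P => evM P f) (fun x y => evMD d2 x y f) (@evM0 F d2 n f)).
by apply: eq_bigr => b _; rewrite evMZ evM_mono.
Qed.

(** Each [d2]-derivative of order at most n is congruent to a combination of free ones, so it
    vanishes at the point; [van_transport] then takes care of the derivatives involving [d1]. *)
Lemma van_of_free_jet f :
  (forall i, (i < n)%N -> van n (fDe i 1 (f i))) -> van n (\sum_(i < n) fde1 1 (f i)) ->
  (forall b : fidx n, ep (iter (val b).2 d2 (f (val b).1)) = 0) ->
  forall i, (i < n)%N -> van n.+1 (f i).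
Proof.
move=> hD hg hz i ni.
have htr : transported d1 d2 ep n a zcoef n f by move=> m nm; rewrite -fDe1E; apply: hD.
have hg' : van n (\sum_(m < n) (d1 (f m) - g1 * f m)).
  congr van: hg; apply: eq_bigr => m _; rewrite /fde1; ring.
have [r hr] := reduction_exists d1 d2 g1 g2 zcoef a_unit ad_unit.
have hw j : (j <= n)%N -> ep (iter j d2 (f i)) = 0.
  move=> jn; have [fr cr] := hr (Ordinal ni) j jn.
  have := evM_inC d1M d2M d12 htr hg' cr; rewrite subSnn => /van_ep.
  rewrite evMB evM_mono rmorphB (evM_ffree _ fr) rmorph_sum big1 ?subr0 // => b _.
  by rewrite rmorphM hz mulr0.
suff H k : (k <= n.+1)%N -> van k (f i) by apply: H.
elim: k => // k IH kn; apply: (@van_transport _ _ d1 d2 g1 g2 d1M d2M d12 ep (a i)).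
- by apply: IH; apply: ltnW.
- rewrite -(subrK (zcoef i * f i) (sig (a i) (f i))) -fDe1E; apply: van_D.
    by apply: van_leq (hD i ni); rewrite -ltnS.
  by apply: (van_Ml d1M d2M); apply: IH; apply: ltnW.
- exact: hw.
Qed.

Variable cst : {rmorphism K -> F}.
Hypothesis ep_cst : forall c, ep (cst c) = c.
Hypothesis d1_cst : forall c, d1 (cst c) = 0.
Hypothesis d2_cst : forall c, d2 (cst c) = 0.
Variables xi1 xi2 : F.
Hypothesis ep_xi1 : ep xi1 = 0.
Hypothesis ep_xi2 : ep xi2 = 0.
Hypothesis d1_xi1 : ep (d1 xi1) = 1.
Hypothesis d2_xi1 : ep (d2 xi1) = 0.
Hypothesis d2_xi2 : ep (d2 xi2) = 1.

(* A jet of a solution exists with any prescribed free derivatives, so the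
   free row equivalent to the top word is read off from kappa. *)
Lemma kappa_reduce0 r :
  (forall i j, (j <= n)%N -> ffree (r i j) /\ inC n (mono F i j - r i j)) ->
  (forall f, (forall i, (i < n)%N -> van n (fDe i 1 (f i))) ->
     van n (\sum_(i < n) fde1 1 (f i)) -> ep (fkappa f) = 0) ->
  forall b, ep (cf (reduce r (Wd n)) b) = 0.
Proof.
move=> hr hk b.
(* Each unknown receives the [d2]-jet dictated by the normal forms [r] when the free derivative [b]
   is 1 at the point and all others are 0. Evaluation on this family then reads off coefficient [b]
   of a normal form. *)
have H (m : nat) : exists f, van n.+1 (sig (a m) f - zcoef m * f) /\
    forall m' : 'I_n, m' = m :> nat ->
    forall j, (j < n.+1)%N -> ep (iter j d2 f) = ep (cf (r m' j) b).
  pose w j := if insub m is Some m' then ep (cf (r m' j) b) else 0.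
  have [f [hf hw]] := prescribe_jet d1M d2M ep_cst d1_cst d2_cst ep_xi1 ep_xi2 d1_xi1 d2_xi1
     d2_xi2 (a m) (zcoef m) n.+1 w n.+1.
  exists f; split=> // m' mm j jn; rewrite hw // /w -mm valK //.
have {H} [f hf] := boolp.choice H.
have hev P : ford n P -> ep (evM P f) = ep (cf (reduce r P) b).
  move=> oP; rewrite /Web.evM cf_sum !rmorph_sum; apply: eq_bigr => m _.
  rewrite (evpE _ _ (oP m)) cf_sum !rmorph_sum; apply: eq_bigr => j _.
  by rewrite cfZ !rmorphM (proj2 (hf m) m erefl).
have htr : transported d1 d2 ep n a zcoef n.+1 f by move=> m _; case: (hf m).
have htr' : transported d1 d2 ep n a zcoef n f.
  by move=> m nm; apply: van_le1; apply: htr.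
(* The last equation was not imposed on the family: it holds to order n because reduction
   annihilates [inC l] for l <= n. *)
have hgen : van n (evM fgen f).
  apply: (van_evM_inC d1M d2M d12 htr' _ (add1n n)); last exact: inC_gen.
  move=> l P ln cP; rewrite hev; last exact: inC_ford_le cP.
  rewrite (reduce_inC d1M d2M d12 a_unit ad_unit hr ln cP).
  by rewrite /cf ffunE coef0 rmorph0.
have hD i : (i < n)%N -> van n.+1 (fDe i 1 (f i)) by move=> ni; rewrite fDe1E; apply: htr.
have hg : van n (\sum_(i < n) fde1 1 (f i)).
  have -> : \sum_(i < n) fde1 1 (f i) = evM fgen f + \sum_(i < n) fDe i 1 (f i).
    rewrite (evM_fgen d1) [X in _ - X + _](eq_bigr (fun i : 'I_n => fDe i 1 (f i))).
      by rewrite subrK; apply: eq_bigr => m _; rewrite /fde1; ring.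
    by move=> i _; rewrite fDe1E.
  by apply: van_D => //; apply: van_sum => i _; apply: van_le1; apply: hD.
rewrite -hev; last exact: Wd_ford.
rewrite -(fkappa_Wd hD hg); apply: hk => // i ni; apply: van_le1; exact: hD.
Qed.

End Kappa.

(** * The connection on free derivatives *)

Section Connection.
Variables (F : comNzRingType) (K : numFieldType).
Variables (d1 d2 dx dy : {additive F -> F}) (g1 g2 : F).
Hypothesis d1M : forall f g, d1 (f * g) = d1 f * g + f * d1 g.
Hypothesis d2M : forall f g, d2 (f * g) = d2 f * g + f * d2 g.
Hypothesis d12 : forall f, d1 (d2 f) = d2 (d1 f) + g1 * d2 f - g2 * d1 f.
Variables al1 al2 be1 be2 winv : F.
Hypothesis w_unit : winv * (al1 * be2 - be1 * al2) = 1.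
Hypothesis dxE : forall f, dx f = al1 * d1 f + al2 * d2 f.
Hypothesis dyE : forall f, dy f = be1 * d1 f + be2 * d2 f.
Hypothesis struct1 : dx be1 - dy al1 = (al1 * be2 - be1 * al2) * g2.
Hypothesis struct2 : dx be2 - dy al2 = - ((al1 * be2 - be1 * al2) * g1).
Variables (n : nat) (a e : nat -> F).
Hypothesis n_gt0 : (0 < n)%N.
Hypothesis a_unit : forall i, (i < n)%N -> exists b, a i * b = 1.
Hypothesis ad_unit : forall i j, (i < n)%N -> (j < n)%N -> i != j ->
  exists b, (a i - a j) * b = 1.

Local Notation M := {ffun 'I_n -> {poly F}}.
Local Notation fder1 := (fder1 d1 d2 g1 g2 a e).
Local Notation fder2 := (fder2 d2).
Local Notation inC := (inC d1 d2 g1 g2 a e).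
Local Notation fgen := (fgen d2 g1 g2 n a e).
Local Notation fbasis := (@fbasis F n).
Local Notation mono := (@mono F n).

Definition fdx (Q : M) : M := al1 *: fder1 Q + al2 *: fder2 Q.
Definition fdy (Q : M) : M := be1 *: fder1 Q + be2 *: fder2 Q.

(** The structure equations of the coframe compensate exactly the bracket of [fder1] and [fder2], so
    that coordinate derivatives commute on the module as they do on functions. *)
Lemma fdx_fdy Q : fdx (fdy Q) = fdy (fdx Q).
Proof.
rewrite /fdx /fdy !(fder1D, fder2D) !(fder1Z d2 g1 g2 d1M, fder2Z d2M) (fder12 d1M d2M d12).
have E1 : al1 * d1 be1 = (al1 * be2 - be1 * al2) * g2 - al2 * d2 be1 + be1 * d1 al1 + be2 * d2 al1.
  by rewrite -struct1 dxE dyE; ring.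
have E2 : al1 * d1 be2 = - ((al1 * be2 - be1 * al2) * g1) - al2 * d2 be2
     + be1 * d1 al2 + be2 * d2 al2.
  by rewrite -struct2 dxE dyE; ring.
apply/ffunP=> m; rewrite !ffunE !(scalerDr, scalerA) E1 E2 -!mul_polyC; ring.
Qed.

Lemma inC_fdx k Q : inC k Q -> inC k.+1 (fdx Q).
Proof. by move=> hQ; apply: inC_D; apply: inC_Z; [exact: inC_der1 | exact: inC_der2]. Qed.
Lemma inC_fdy k Q : inC k Q -> inC k.+1 (fdy Q).
Proof. by move=> hQ; apply: inC_D; apply: inC_Z; [exact: inC_der1 | exact: inC_der2]. Qed.

Lemma fdxZ h Q : fdx (h *: Q) = dx h *: Q + h *: fdx Q.
Proof.
rewrite /fdx (fder1Z d2 g1 g2 d1M) (fder2Z d2M) dxE; apply/ffunP=> m; rewrite !ffunE -!mul_polyC; ring.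
Qed.
Lemma fdyZ h Q : fdy (h *: Q) = dy h *: Q + h *: fdy Q.
Proof.
rewrite /fdy (fder1Z d2 g1 g2 d1M) (fder2Z d2M) dyE; apply/ffunP=> m; rewrite !ffunE -!mul_polyC; ring.
Qed.
Lemma fdxD P Q : fdx (P + Q) = fdx P + fdx Q.
Proof. by rewrite /fdx !fder1D !fder2D !scalerDr addrACA. Qed.
Lemma fdyD P Q : fdy (P + Q) = fdy P + fdy Q.
Proof. by rewrite /fdy !fder1D !fder2D !scalerDr addrACA. Qed.
Lemma fdxB P Q : fdx (P - Q) = fdx P - fdx Q.
Proof.
rewrite fdxD; congr (_ + _); rewrite /fdx (fder1_opp d2 g1 g2 d1M) (fder2_opp d2M).
by rewrite !scalerN opprD.
Qed.
Lemma fdyB P Q : fdy (P - Q) = fdy P - fdy Q.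
Proof.
rewrite fdyD; congr (_ + _); rewrite /fdy (fder1_opp d2 g1 g2 d1M) (fder2_opp d2M).
by rewrite !scalerN opprD.
Qed.
Lemma fdx0 : fdx 0 = 0.
Proof. by rewrite -[0 in LHS](scale0r 0) fdxZ raddf0 !scale0r addr0. Qed.
Lemma fdy0 : fdy 0 = 0.
Proof. by rewrite -[0 in LHS](scale0r 0) fdyZ raddf0 !scale0r addr0. Qed.

Lemma fder1_xy Q : fder1 Q = winv *: (be2 *: fdx Q - al2 *: fdy Q).
Proof.
rewrite -[LHS]scale1r -w_unit /fdx /fdy; apply/ffunP=> m.
by rewrite !ffunE -!mul_polyC; ring.
Qed.

Lemma fder2_xy Q : fder2 Q = winv *: (al1 *: fdy Q - be1 *: fdx Q).
Proof.
rewrite -[LHS]scale1r -w_unit /fdx /fdy; apply/ffunP=> m.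
by rewrite !ffunE -!mul_polyC; ring.
Qed.

(* [rx b] and [ry b] are the reductions of the derivatives of the b-th free
   derivative along the coordinate fields. *)
Definition connection (rx ry : fidx n -> M) := forall b,
  [/\ ffree (rx b), ffree (ry b), inC n (fdx (fbasis b) - rx b)
    & inC n (fdy (fbasis b) - ry b)].

Lemma connection_exists : exists rx ry, connection rx ry.
Proof.
have red h1 h2 (b : fidx n) :
    exists Q : M, ffree Q /\ inC n (h1 *: fder1 (fbasis b) + h2 *: fder2 (fbasis b) - Q).
  have ob : ford (val b).2 (fbasis b) by apply: ford_mono.
  have bn : ((val b).2 < n)%N by apply: ltn_ord.
  have oP : ford (val b).2.+1 (h1 *: fder1 (fbasis b) + h2 *: fder2 (fbasis b)).
    apply: ford_lin; first exact: ford_fder1.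
    rewrite -[h2 *: _]addr0; apply: ford_lin; first exact: ford_fder2.
    by move=> m; rewrite ffunE size_poly0.
  have [Q [fQ cQ]] := ffree_reduce d1 d2 g1 g2 e a_unit ad_unit bn oP.
  by exists Q; split=> //; apply: inC_leq bn _.
have [rx hx] := boolp.choice (red al1 al2); have [ry hy] := boolp.choice (red be1 be2).
by exists rx, ry => b; have [? ?] := hx b; have [? ?] := hy b; split.
Qed.

Section ConnectionTheory.
Variables rx ry : fidx n -> M.
Hypothesis hc : connection rx ry.

(** The Leibniz rule on the expansion over free basis elements: modulo [inC n], a derivation acts on
    coefficients through the connection. The derivation is abstract in order to serve both
    coordinates. *)
Lemma inC_fd_free (fd : M -> M) (d : F -> F) (r : fidx n -> M) Q :
  (forall h P, fd (h *: P) = d h *: P + h *: fd P) ->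
  (forall P P', fd (P + P') = fd P + fd P') -> fd 0 = 0 ->
  (forall b, inC n (fd (fbasis b) - r b)) -> ffree Q ->
  inC n (fd Q - \sum_b (d (cf Q b) *: fbasis b + cf Q b *: r b)).
Proof.
move=> fdZ fdD fd0 hr fQ; rewrite {1}(ffree_decomp fQ) (big_morph fd fdD fd0) -sumrB.
apply: inC_sum => b; rewrite fdZ opprD addrACA subrr add0r -scalerBr.
by apply: inC_Z.
Qed.

(** [Z1] and [Z2] reduce the same mixed second derivative of a basis element in the two possible
    orders. As [fdx] and [fdy] commute, they differ by an element of [inC n.+1]; it is free, hence
    zero by [top]. *)
Lemma connection_flat :
  (forall Q : M, inC n.+1 Q -> ffree Q -> Q = 0) -> forall b c,
  dy (cf (rx b) c) + \sum_k cf (rx b) k * cf (ry k) c =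
  dx (cf (ry b) c) + \sum_k cf (ry b) k * cf (rx k) c.
Proof.
move=> top b c; have [fx fy cx cy] := hc b.
have hx k : inC n (fdx (fbasis k) - rx k) by case: (hc k).
have hy k : inC n (fdy (fbasis k) - ry k) by case: (hc k).
pose Z1 : M := \sum_k (dy (cf (rx b) k) *: fbasis k + cf (rx b) k *: ry k).
pose Z2 : M := \sum_k (dx (cf (ry b) k) *: fbasis k + cf (ry b) k *: rx k).
have fZ1 : ffree Z1.
  apply: ffree_sum => k; apply: ffreeD; apply: ffreeZ; [exact: ffree_fbasis | by case: (hc k)].
have fZ2 : ffree Z2.
  apply: ffree_sum => k; apply: ffreeD; apply: ffreeZ; [exact: ffree_fbasis | by case: (hc k)].
have H1 : inC n.+1 (fdy (fdx (fbasis b)) - Z1).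
  rewrite -(subrKA (fdy (rx b))); apply: inC_D; first by rewrite -fdyB; apply: inC_fdy.
  by apply: inC_up; apply: (inC_fd_free fdyZ fdyD fdy0 hy fx).
have H2 : inC n.+1 (fdx (fdy (fbasis b)) - Z2).
  rewrite -(subrKA (fdx (ry b))); apply: inC_D; first by rewrite -fdxB; apply: inC_fdx.
  by apply: inC_up; apply: (inC_fd_free fdxZ fdxD fdx0 hx fy).
have Z12 : Z1 - Z2 = 0.
  apply: top; last exact: ffreeB.
  have -> : Z1 - Z2 = (fdx (fdy (fbasis b)) - Z2) - (fdy (fdx (fbasis b)) - Z1).
    by rewrite fdx_fdy opprB [RHS]addrC subrKA.
  exact: inC_B.
have cZ (d : F -> F) (Q : M) (r : fidx n -> M) :
    cf (\sum_k (d (cf Q k) *: fbasis k + cf Q k *: r k)) c =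
    d (cf Q c) + \sum_k cf Q k * cf (r k) c.
  rewrite cf_sum (eq_bigr (fun k => d (cf Q k) * (c == k)%:R + cf Q k * cf (r k) c)).
    rewrite big_split (bigD1 c) //= eqxx mulr1 big1 ?addr0 // => k kc.
    by rewrite eq_sym (negPf kc) mulr0.
  by move=> k _; rewrite cfD !cfZ cf_fbasis.
by rewrite -!cZ; apply/eqP; rewrite -subr_eq0 -cfB -/Z1 -/Z2 Z12 /cf ffunE coef0.
Qed.

Lemma fder2_mono i j : fder2 (mono i j) = mono i j.+1.
Proof.
apply/ffunP=> m; rewrite fder2E !ffunE; case: eqP => _; first exact: (tder2Xn d2M).
exact: (tder2_0 d2M).
Qed.

Lemma fder1_mono0 i : fder1 (mono i 0) = a i *: fder2 (mono i 0) + e i *: mono i 0.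
Proof.
rewrite fder2_mono; apply/ffunP=> m; rewrite fder1E !ffunE.
case: eqP => [->|_]; last by rewrite (tder1_0 d2 g1 g2 d1M) !scaler0 addr0.
by rewrite (tder1Xn d2 g1 g2 d1M) /= expr1 expr0 alg_polyC.
Qed.

Lemma sum_mono_gen : \sum_i (fder1 (mono i 0) - g1 *: mono i 0) = fgen.
Proof.
apply/ffunP=> m; rewrite sum_ffunE (bigD1 m) //= big1 ?addr0.
  rewrite fder1_mono0 fder2_mono !ffunE eqxx expr1 expr0 /=.
  by rewrite !alg_polyC.
move=> i im; rewrite fder1_mono0 fder2_mono !ffunE eq_sym (negPf im).
by rewrite !scaler0 addr0 subr0.
Qed.

Definition row1 b : M := winv *: (be2 *: rx b - al2 *: ry b).
Definition row2 b : M := winv *: (al1 *: ry b - be1 *: rx b).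

Lemma ffree_row1 b : ffree (row1 b).
Proof. by apply: ffreeZ; apply: ffreeB; apply: ffreeZ; case: (hc b). Qed.
Lemma ffree_row2 b : ffree (row2 b).
Proof. by apply: ffreeZ; apply: ffreeB; apply: ffreeZ; case: (hc b). Qed.

Lemma inC_row1 b : inC n (fder1 (fbasis b) - row1 b).
Proof.
have [_ _ cx cy] := hc b.
have -> : fder1 (fbasis b) - row1 b =
    winv *: (be2 *: (fdx (fbasis b) - rx b) - al2 *: (fdy (fbasis b) - ry b)).
  by rewrite fder1_xy /row1 -scalerBr !scalerBr; apply/ffunP=> m; rewrite !ffunE; ring.
by apply: inC_Z; apply: inC_B; apply: inC_Z.
Qed.

Lemma inC_row2 b : inC n (fder2 (fbasis b) - row2 b).
Proof.
have [_ _ cx cy] := hc b.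
have -> : fder2 (fbasis b) - row2 b =
    winv *: (al1 *: (fdy (fbasis b) - ry b) - be1 *: (fdx (fbasis b) - rx b)).
  by rewrite fder2_xy /row2 -scalerBr !scalerBr; apply/ffunP=> m; rewrite !ffunE; ring.
by apply: inC_Z; apply: inC_B; apply: inC_Z.
Qed.

(** Ensures that the entries of a parallel section belonging to one unknown are its successive
    [d2]-derivatives. The relation holds modulo [inC n], and congruent free elements are equal;
    [row_transport] and [row_gen] recover the two kinds of equations in the same way. *)
Lemma row2_succ (b c : fidx n) : (val c).1 = (val b).1 -> (val c).2 = (val b).2.+1 :> nat ->
  row2 b = fbasis c.
Proof.
move=> c1 c2; apply/eqP; rewrite eq_sym -subr_eq0; apply/eqP.
apply: (ffree_inC d1M d2M d12 a_unit ad_unit (leqnn n)).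
  by rewrite /Web.fbasis c1 c2 -fder2_mono; apply: inC_row2.
by apply: ffreeB; [exact: ffree_fbasis | exact: ffree_row2].
Qed.

Lemma row_transport (b : fidx n) : (val b).2 = 0%N :> nat ->
  row1 b = a (val b).1 *: row2 b + e (val b).1 *: fbasis b.
Proof.
move=> b2; apply/eqP; rewrite eq_sym -subr_eq0; apply/eqP.
apply: (ffree_inC d1M d2M d12 a_unit ad_unit (leqnn n)); last first.
  apply: ffreeB; last exact: ffree_row1.
  apply: ffreeD; apply: ffreeZ; [exact: ffree_row2 | exact: ffree_fbasis].
have -> : a (val b).1 *: row2 b + e (val b).1 *: fbasis b - row1 b =
   (fder1 (fbasis b) - row1 b) - a (val b).1 *: (fder2 (fbasis b) - row2 b).
  rewrite {2}/Web.fbasis b2 fder1_mono0 -{1 2}b2 -/(fbasis b).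
  by rewrite !scalerBr; apply/ffunP=> m; rewrite !ffunE; ring.
by apply: inC_B; [exact: inC_row1 | apply: inC_Z; exact: inC_row2].
Qed.

Lemma row_gen (b : 'I_n -> fidx n) :
  (forall i, (val (b i)).1 = i /\ (val (b i)).2 = 0%N :> nat) ->
  \sum_i (row1 (b i) - g1 *: fbasis (b i)) = 0.
Proof.
move=> hb; apply: (ffree_inC d1M d2M d12 a_unit ad_unit (leqnn n)); last first.
  apply: ffree_sum => i; apply: ffreeB; first exact: ffree_row1.
  by apply: ffreeZ; apply: ffree_fbasis.
have fb i : fbasis (b i) = mono i 0 by rewrite /Web.fbasis; have [-> ->] := hb i.
have -> : \sum_i (row1 (b i) - g1 *: fbasis (b i)) =
   fgen - \sum_i (fder1 (fbasis (b i)) - row1 (b i)).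
  rewrite -sum_mono_gen -sumrB; apply: eq_bigr => i _; rewrite fb.
  by apply/ffunP=> m; rewrite !ffunE; ring.
apply: inC_B; first by apply: (inC_leq n_gt0); exact: inC_gen.
by apply: inC_sum => i; apply: inC_row1.
Qed.

Variables (Pt : Type) (eps : Pt -> {rmorphism F -> K}).
Hypothesis separated : forall f, (forall p, eps p f = 0) -> f = 0.

(** An exact solution satisfies the equations to every order at every point, so [inC n] annihilates
    it identically and the congruences defining the connection become identities of functions. *)
Lemma solution_parallel (f : nat -> F) :
  (forall i, (i < n)%N -> sig d1 d2 (a i) (f i) - e i * f i = 0) ->
  \sum_(i < n) (d1 (f i) - g1 * f i) = 0 ->
  forall b, let z (c : fidx n) := iter (val c).2 d2 (f (val c).1) in
  dx (z b) = \sum_c cf (rx b) c * z c /\ dy (z b) = \sum_c cf (ry b) c * z c.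
Proof.
move=> hf hg b z.
have htr k p : transported d1 d2 (eps p) n a e k f.
  by move=> m nm; rewrite hf //; apply: van0.
have ev0 (P : M) : inC n P -> evM d2 P f = 0.
  move=> cP; apply: separated => p.
  apply: (@van_ep _ _ d1 d2 _ 0).
  have := evM_inC d1M d2M d12 (htr n p) _ cP; rewrite subSnn; apply.
  by rewrite hg; apply: van0.
have ev1 (P : M) : evM d2 (fder1 P) f = d1 (evM d2 P f).
  apply/eqP; rewrite eq_sym -subr_eq0; apply/eqP; apply: separated => p.
  have [l ol] : exists l, ford l P.
    exists (\max_(m < n) size (P m)) => m; apply: leqW.
    exact: (leq_bigmax (F := fun m => size (P m))).
  have := evM_fder1 d1M d2M d12 (htr l.+1 p) ol; rewrite subSnn => /van_ep; exact.
have [fx fy cx cy] := hc b.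
have zE c : evM d2 (fbasis c) f = z c by rewrite evM_mono.
have evB (P Q : M) : inC n (P - Q) -> evM d2 P f = evM d2 Q f.
  by move/ev0; rewrite evMB => /eqP; rewrite subr_eq0 => /eqP.
rewrite -(evM_ffree d2 f fx) -(evM_ffree d2 f fy) -(evB _ _ cx) -(evB _ _ cy).
by rewrite !evMD !evMZ !ev1 !(evM_fder2 d2M) zE dxE dyE.
Qed.

End ConnectionTheory.
End Connection.

(** * Smooth functions on a square as a differential ring *)

Section SFunRing.
Variable s : square.
HB.instance Definition _ := boolp.gen_eqMixin (sfun s).
HB.instance Definition _ := boolp.gen_choiceMixin (sfun s).
HB.instance Definition _ := GRing.isZmodule.Build (sfun s)
  (@splusA s) (@splusC s) (@splus0 s) (@splusN s).
Fact sfun_1_neq0 : sconst s 1 != szero s.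
Proof. by apply/eqP; exact: sconst1_neq0. Qed.
HB.instance Definition _ := GRing.Zmodule_isComNzRing.Build (sfun s)
  (@smultA s) (@smultC s) (@smult1 s) (@smultD s) sfun_1_neq0.
End SFunRing.

Lemma spdx_leibniz s (f g : sfun s) : spdx (f * g) = spdx f * g + f * spdx g.
Proof. exact: spdxM. Qed.
Lemma spdy_leibniz s (f g : sfun s) : spdy (f * g) = spdy f * g + f * spdy g.
Proof. exact: spdyM. Qed.

Section Vector.
Variable s : square.
Definition vfield (p q : sfun s) (f : sfun s) : sfun s := p * spdx f + q * spdy f.

Lemma vfieldD p q f g : vfield p q (f + g) = vfield p q f + vfield p q g.
Proof. by rewrite /vfield [spdx _]spdxD [spdy _]spdyD !mulrDr addrACA. Qed.

Lemma vfieldB p q : zmod_morphism (vfield p q).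
Proof.
move=> f g; have := vfieldD p q (f - g) g; rewrite subrK => ->; by rewrite addrK.
Qed.
HB.instance Definition _ p q :=
  GRing.isZmodMorphism.Build (sfun s) (sfun s) (vfield p q) (vfieldB p q).

Lemma vfieldM p q f g : vfield p q (f * g) = vfield p q f * g + f * vfield p q g.
Proof. by rewrite /vfield spdx_leibniz spdy_leibniz; ring. Qed.

Record point := Point { pt_x : R; pt_y : R; pt_dom : dom s (pt_x, pt_y) }.
Variable p : point.
Definition evalp (f : sfun s) : R := sfv f (pt_x p) (pt_y p).

Lemma evalpN f : evalp (- f) = - evalp f.
Proof.
have -> : evalp (- f) = sfv (sconst s (-1)%R) (pt_x p) (pt_y p) * evalp f by [].
by rewrite sconstE ?mulN1r //; exact: pt_dom.
Qed.
Lemma evalpB : zmod_morphism evalp.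
Proof. by move=> f g; rewrite -evalpN. Qed.
HB.instance Definition _ := GRing.isZmodMorphism.Build (sfun s) R evalp evalpB.
Lemma evalpM : monoid_morphism evalp.
Proof. split=> //; exact: (sconstE _ _ _ _ (pt_dom p)). Qed.
HB.instance Definition _ := GRing.isMonoidMorphism.Build (sfun s) R evalp evalpM.

Lemma sconstB : zmod_morphism (sconst s).
Proof.
move=> a b; apply: sfun_eq => x y h.
have -> : sfv (sconst s a - sconst s b) x y =
   sfv (sconst s a) x y + sfv (sconst s (-1)%R) x y * sfv (sconst s b) x y by [].
by rewrite !sconstE // mulN1r.
Qed.
HB.instance Definition _ := GRing.isZmodMorphism.Build R (sfun s) (sconst s) sconstB.
Lemma sconstM : monoid_morphism (sconst s).
Proof.
split=> // a b; apply: sfun_eq => x y h.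
have -> : sfv (sconst s a * sconst s b) x y = sfv (sconst s a) x y * sfv (sconst s b) x y by [].
by rewrite !sconstE.
Qed.
HB.instance Definition _ := GRing.isMonoidMorphism.Build R (sfun s) (sconst s) sconstM.

Lemma vfield_const a b c : vfield a b (sconst s c) = 0.
Proof.
rewrite /vfield spdx_const spdy_const; change (szero s) with (0 : sfun s).
by rewrite !mulr0 addr0.
Qed.

Lemma evalp_const c : evalp (sconst s c) = c.
Proof. exact: (sconstE _ _ _ _ (pt_dom p)). Qed.
End Vector.

Lemma sfun_separated s (f : sfun s) : (forall p, evalp p f = 0) -> f = 0.
Proof. move=> h; apply: sfun_eq => x y hxy; exact: (h (Point hxy)). Qed.
Arguments evalp : simpl never.
Arguments vfield : simpl never.
Arguments sconst : simpl never.
Arguments sfst : simpl never.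
Arguments ssnd : simpl never.
Arguments spdx : simpl never.
Arguments spdy : simpl never.

(** * Webs *)

Section VanishingCoordinates.
Variables (F : comNzRingType) (K : numFieldType) (ep : {rmorphism F -> K}).
Variables (dx dy : {additive F -> F}).
Hypothesis dxM : forall f g, dx (f * g) = dx f * g + f * dx g.
Hypothesis dyM : forall f g, dy (f * g) = dy f * g + f * dy g.
Hypothesis dxy : forall f, dx (dy f) = dy (dx f).

Lemma iter_dy_dx m f : iter m dy (dx f) = dx (iter m dy f).
Proof. by elim: m => //= m ->; rewrite dxy. Qed.

(** The recursion in [van] tests all words in [dx] and [dy]; commutation sorts them into mixed
    partial derivatives. *)
Lemma van_iter k f : van dx dy ep k f <->
  forall m j, (m + j < k)%N -> ep (iter m dx (iter j dy f)) = 0.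
Proof.
elim: k f => [|k IH] f; first by split.
split=> [[h0 /IH hx /IH hy] m j | H].
  case: m => [|m]; last by rewrite addSn ltnS iterSr -iter_dy_dx; apply: hx.
  case: j => [|j] //; rewrite add0n ltnS => jk.
  by rewrite iterSr; apply: (hy 0%N).
split; [exact: (H 0%N 0%N) | apply/IH => m j mj | apply/IH => m j mj].
  by rewrite iter_dy_dx -iterSr; apply: H.
by rewrite -iterSr; apply: H; rewrite addnS.
Qed.

Lemma van_frame (d1 d2 : {additive F -> F}) p1 q1 p2 q2 k f :
  (forall f, d1 f = p1 * dx f + q1 * dy f) -> (forall f, d2 f = p2 * dx f + q2 * dy f) ->
  van dx dy ep k f -> van d1 d2 ep k f.
Proof.
move=> E1 E2; elim: k f => //= k IH f [h0 hx hy].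
by split=> //; apply: IH; rewrite ?E1 ?E2; apply: van_D; apply: (van_Ml dxM dyM).
Qed.

Lemma der_exp1 (d : {additive F -> F}) xi m : (forall f g, d (f * g) = d f * g + f * d g) ->
  d xi = 1 -> d (xi ^+ m) = m%:R * xi ^+ m.-1.
Proof.
move=> dM d1; elim: m => [|m IH]; first by rewrite mul0r (der1_0 dM).
rewrite exprS dM IH d1; case: m IH => [|m] _; first by rewrite !expr0 mul0r mulr0 addr0 !mul1r.
by rewrite [m.+1.-1]/= -[m.+2%:R]natr1 exprS; ring.
Qed.

Lemma iter_der_exp (d : {additive F -> F}) xi h m k :
  (forall f g, d (f * g) = d f * g + f * d g) -> d xi = 1 -> d h = 0 ->
  iter k d (h * xi ^+ m) = h * ((m ^_ k)%:R * xi ^+ (m - k)).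
Proof.
move=> dM d1 dh; elim: k => [|k IH]; first by rewrite ffactn0 mul1r subn0.
rewrite iterS IH dM dh mul0r add0r dM der_exp1 //.
have -> : d (m ^_ k)%:R = 0 by rewrite raddfMn (der1_0 dM) mul0rn.
by rewrite mul0r add0r [_%:R * (_%:R * _)]mulrA -natrM -ffactnSr subnS.
Qed.
End VanishingCoordinates.

Lemma spdxB s : zmod_morphism (@spdx s).
Proof.
move=> f g; have e : splus s (f - g) g = f := subrK g f.
by have := spdxD s (f - g) g; rewrite e => ->; rewrite [RHS]addrK.
Qed.
HB.instance Definition _ s := GRing.isZmodMorphism.Build (sfun s) (sfun s) (@spdx s) (@spdxB s).
Lemma spdyB s : zmod_morphism (@spdy s).
Proof.
move=> f g; have e : splus s (f - g) g = f := subrK g f.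
by have := spdyD s (f - g) g; rewrite e => ->; rewrite [RHS]addrK.
Qed.
HB.instance Definition _ s := GRing.isZmodMorphism.Build (sfun s) (sfun s) (@spdy s) (@spdyB s).

Lemma sum_n_big (f : nat -> R) k : sum_n f k = \sum_(i < k.+1) f i.
Proof.
elim: k => [|k IH]; first by rewrite sum_O big_ord1.
by rewrite sum_Sn IH [RHS]big_ord_recr.
Qed.

Lemma rsum_big (f : nat -> R) k : rsum k f = \sum_(i < k) f i.
Proof. by elim: k => [|k IH]; [rewrite big_ord0 | rewrite /= IH big_ord_recr]. Qed.

Lemma rep_evalp s u (f : sfun s) (p : point s) : rep u f -> evalp p f = u (pt_x p) (pt_y p).
Proof. by move=> h; rewrite /evalp h //; exact: pt_dom. Qed.

Lemma repP s u (f : sfun s) : (forall p : point s, evalp p f = u (pt_x p) (pt_y p)) -> rep u f.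
Proof. by move=> h x y hxy; rewrite -(h (Point hxy)). Qed.

Lemma spdx_const0 s c : spdx (sconst s c) = 0. Proof. exact: spdx_const. Qed.
Lemma spdy_const0 s c : spdy (sconst s c) = 0. Proof. exact: spdy_const. Qed.
Lemma spdy_fst0 s c : spdy (sfst s c) = 0. Proof. exact: spdy_fst. Qed.
Lemma spdx_snd0 s c : spdx (ssnd s c) = 0. Proof. exact: spdx_snd. Qed.
Lemma spdx_fst1 s c : spdx (sfst s c) = 1. Proof. exact: spdx_fst. Qed.
Lemma spdy_snd1 s c : spdy (ssnd s c) = 1. Proof. exact: spdy_snd. Qed.

(** * Taylor polynomials as representatives of jets *)

Section Taylor.
Variables (s : square) (p : point s).

Definition taylor k (c : nat -> nat -> R) : sfun s :=
  \sum_(m < k.+1) \sum_(l < (k - m).+1)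
    sconst s (c m l / ((m`!)%:R * (l`!)%:R)) * sfst s (pt_x p) ^+ m * ssnd s (pt_y p) ^+ l.

Lemma evalp_fst q c : evalp q (sfst s c) = pt_x q - c.
Proof. by rewrite /evalp smkE //; exact: pt_dom. Qed.
Lemma evalp_snd q c : evalp q (ssnd s c) = pt_y q - c.
Proof. by rewrite /evalp smkE //; exact: pt_dom. Qed.

Lemma natr_fact m : INR (fact m) = (m`!)%:R.
Proof.
rewrite INRE; congr (_%:R); elim: m => //= m IH; rewrite factS -IH.
by rewrite mulSn; congr addn.
Qed.

Lemma rep_jet_section k th i : jet_x th = pt_x p -> jet_y th = pt_y p ->
  rep (jet_section k th i) (taylor k (jet_u th i)).
Proof.
move=> hx hy; apply: repP => q; rewrite /jet_section hx hy sum_n_big rmorph_sum.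
apply: eq_bigr => m _; rewrite sum_n_big rmorph_sum; apply: eq_bigr => l _.
by rewrite !rmorphM !rmorphXn /= evalp_fst evalp_snd !evalp_const !natr_fact !RpowE RdivE.
Qed.

Lemma iter_sum (V : zmodType) (d : {additive V -> V}) k (I : Type) (r : seq I) (f : I -> V) :
  iter k d (\sum_(i <- r) f i) = \sum_(i <- r) iter k d (f i).
Proof. by elim: k => //= k ->; rewrite raddf_sum. Qed.

Lemma ffact_exp0 (A : pzRingType) m k : (m ^_ k)%:R * 0 ^+ (m - k) = (if m == k then k`!%:R else 0) :> A.
Proof.
case: ltngtP => [mk|km|->]; first by rewrite ffact_small // mul0r.
  by rewrite expr0n subn_eq0 leqNgt km mulr0.
by rewrite subnn expr0 mulr1 ffactnn.
Qed.

Lemma evalp_monomial k l m j c :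
  evalp p (iter k (@spdx s) (iter l (@spdy s)
    (sconst s c * sfst s (pt_x p) ^+ m * ssnd s (pt_y p) ^+ j)))
  = c * (if m == k then k`!%:R else 0) * (if j == l then l`!%:R else 0).
Proof.
have dxM := @spdx_leibniz s; have dyM := @spdy_leibniz s.
have exp0 (d : {additive sfun s -> sfun s}) x r :
    (forall f g, d (f * g) = d f * g + f * d g) -> d x = 0 -> d (x ^+ r) = 0.
  move=> dM dx; elim: r => [|r IH]; first by rewrite (der1_0 dM).
  by rewrite exprS dM dx IH mul0r mulr0 addr0.
rewrite (iter_der_exp _ _ dyM); [|exact: spdy_snd1|]; last first.
  rewrite /= dyM spdy_const0 (exp0 (@spdy s) _ _ dyM); last exact: spdy_fst0.
  by rewrite mul0r mulr0 addr0.
set h := (j ^_ l)%:R * _.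
have -> : sconst s c * sfst s (pt_x p) ^+ m * h = (sconst s c * h) * sfst s (pt_x p) ^+ m by ring.
rewrite (iter_der_exp _ _ dxM); [|exact: spdx_fst1|]; last first.
  rewrite /= dxM spdx_const0 mul0r add0r /h dxM (exp0 (@spdx s) _ _ dxM); last exact: spdx_snd0.
  by rewrite raddfMn /= (der1_0 dxM) mul0rn mul0r mulr0 addr0 mulr0.
rewrite /h !rmorphM !rmorphXn !rmorph_nat /= evalp_fst evalp_snd !subrr evalp_const.
by rewrite !ffact_exp0 mulrAC.
Qed.

Lemma taylor_van k c : forall m l, (m + l < k.+1)%N ->
  evalp p (iter m (@spdx s) (iter l (@spdy s) (taylor k c))) = c m l.
Proof.
move=> m l mlk; have mk : (m < k.+1)%N by apply: leq_ltn_trans (leq_addr l m) mlk.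
rewrite /taylor !iter_sum rmorph_sum (bigD1 (Ordinal mk)) //= [X in _ + X]big1 ?addr0.
  have lk : (l < (k - m).+1)%N by rewrite ltnS leq_subRL // -ltnS.
  rewrite !iter_sum rmorph_sum (bigD1 (Ordinal lk)) //= [X in _ + X]big1 ?addr0.
    rewrite evalp_monomial !eqxx -mulrA divfK //.
    by rewrite mulf_neq0 // pnatr_eq0 -lt0n fact_gt0.
  by move=> j; rewrite -val_eqE /= => /negPf jl; rewrite /= evalp_monomial jl mulr0.
move=> i; rewrite -val_eqE /= => /negPf im; rewrite !iter_sum rmorph_sum big1 //= => j _.
by rewrite evalp_monomial im mulr0 mul0r.
Qed.
End Taylor.

Lemma splusE s (f g : sfun s) : splus s f g = f + g. Proof. by []. Qed.
Lemma smultE s (f g : sfun s) : smult s f g = f * g. Proof. by []. Qed.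
Lemma soppE s (f : sfun s) : sopp s f = - f. Proof. by []. Qed.

Lemma eval_det (S T : comPzRingType) (f : {rmorphism S -> T}) (w p q r t : S) :
  f (w * p * q + - (w * r) * t) = f w * (f q * f p - f t * f r).
Proof. by rewrite rmorphD !rmorphM rmorphN !rmorphM; ring. Qed.

Lemma card_fidx d : #|{: fidx (d - 2)}| = Nat.div ((d - 1) * (d - 2))%coq_nat 2.
Proof.
have tri k : (\sum_(i < k) i.+1 * 2 = k.+1 * k)%N.
  by elim: k => [|k IH]; rewrite ?big_ord0 // big_ord_recr /= IH; lia.
have -> : #|{: fidx (d - 2)}| = (\sum_(i < d - 2) i.+1)%N.
  rewrite card_sig -sum1_card -(pair_big_dep xpredT (fun i j : 'I_(d - 2) => (j <= i)%N) (fun _ _ => 1%N)) /=.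
  apply: eq_bigr => i _; rewrite -[RHS]muln1 -[X in _ = X]card_ord.
  by rewrite muln1 -sum1_card (big_ord_widen (d - 2) (fun=> 1%N)).
set S := (\sum_(i < _) _)%N.
have : (S * 2 = (d - 2).+1 * (d - 2))%N by rewrite -tri big_distrl.
move=> E; have -> : ((d - 1) * (d - 2))%coq_nat = (S * 2)%coq_nat.
  by rewrite ?multE ?minusE E; case: (d) => [|[|k]] //; rewrite !subSS !subn0.
by rewrite Nat.div_mul.
Qed.

Lemma injective_row_surj (K : fieldType) N (A : 'M[K]_N) :
  (forall c : 'rV_N, c *m A = 0 -> c = 0) -> forall v : 'rV_N, exists c, c *m A = v.
Proof.
move=> inj v; have uA : A \in unitmx by rewrite -row_free_unit; apply: inj_row_free.
by exists (v *m invmx A); rewrite mulmxKV.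
Qed.

(** * The formal theory applied to a web on a square *)

Section WebTheory.
Variables (d : nat) (D : R * R -> Prop) (om : nat -> one_form)
  (a : nat -> R -> R -> R) (gam : one_form).
Hypothesis hd : (3 <= d)%coq_nat.
Hypothesis hweb : is_web d D om.
Hypothesis hnorm : is_normalized d D om a.
Hypothesis hgam : is_chern_connection D om gam.
Variable s : square.
Hypothesis Hs : forall p, dom s p -> D p.

Local Notation n := (d - 2)%N.
Local Notation F := (sfun s).
Local Notation al1 := (al1 om s).
Local Notation al2 := (al2 om s).
Local Notation be1 := (be1 om s).
Local Notation be2 := (be2 om s).
Local Notation winv := (winv om s).
Local Notation g1 := (sg1 om gam s).
Local Notation g2 := (sg2 om gam s).
Local Notation A := (inva a s).
Let dx : {additive F -> F} := @spdx s.
Let dy : {additive F -> F} := @spdy s.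
Let d1 : {additive F -> F} := vfield (winv * be2) (- (winv * al2)).
Let d2 : {additive F -> F} := vfield (- (winv * be1)) (winv * al1).

Lemma n_gt0 : (0 < n)%N.
Proof. by move/leP: hd; rewrite subn_gt0. Qed.

Lemma w_unit : winv * (al1 * be2 - be1 * al2) = 1.
Proof. exact: (winv_wdg d D om hd hweb s Hs). Qed.

Lemma dxE f : dx f = al1 * d1 f + al2 * d2 f.
Proof.
rewrite -[LHS]mul1r -w_unit /d1 /d2 /= /vfield /dx /=; ring.
Qed.
Lemma dyE f : dy f = be1 * d1 f + be2 * d2 f.
Proof.
rewrite -[LHS]mul1r -w_unit /d1 /d2 /= /vfield /dy /=; ring.
Qed.
Lemma d1M f g : d1 (f * g) = d1 f * g + f * d1 g. Proof. exact: vfieldM. Qed.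
Lemma d2M f g : d2 (f * g) = d2 f * g + f * d2 g. Proof. exact: vfieldM. Qed.

Lemma struct1 : dx be1 - dy al1 = (al1 * be2 - be1 * al2) * g2.
Proof. exact: (struct_eq1 d D om gam hd hweb hgam s Hs). Qed.
Lemma struct2 : dx be2 - dy al2 = - ((al1 * be2 - be1 * al2) * g1).
Proof. exact: (struct_eq2 d D om gam hd hweb hgam s Hs). Qed.

(** Expanding [dx (dy f) = dy (dx f)] in the frame, that is d(df) = 0, and inserting the structure
    equations of omega_1 and omega_2. *)
Lemma d12 f : d1 (d2 f) = d2 (d1 f) + g1 * d2 f - g2 * d1 f.
Proof.
have dxM := @spdx_leibniz s; have dyM := @spdy_leibniz s.
have H : dx (be1 * d1 f + be2 * d2 f) = dy (al1 * d1 f + al2 * d2 f).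
  by rewrite -dxE -dyE; exact: spdx_spdy.
rewrite !raddfD /dx /dy /= !dxM !dyM in H.
have {}H : (spdx be1 - spdy al1) * d1 f + (spdx be2 - spdy al2) * d2 f
   + (al1 * be2 - be1 * al2) * (d1 (d2 f) - d2 (d1 f)) = 0.
  have E1 := dxE (d1 f); have E2 := dxE (d2 f); have E3 := dyE (d1 f); have E4 := dyE (d2 f).
  rewrite /dx /dy /= in E1 E2 E3 E4; rewrite E1 E2 E3 E4 in H.
  move/eqP: H; rewrite -subr_eq0 => /eqP H; rewrite -[RHS]H; ring.
have S1 := struct1; have S2 := struct2; rewrite /dx /dy /= in S1 S2.
rewrite S1 S2 in H.
have {}H : winv * (al1 * be2 - be1 * al2) * (d1 (d2 f) - d2 (d1 f) + g2 * d1 f - g1 * d2 f) = 0.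
  by rewrite -[RHS](mulr0 winv) -[X in _ = winv * X]H; ring.
move: H; rewrite w_unit mul1r => H.
rewrite -[LHS]subr0 -H; ring.
Qed.

Lemma a_unit i : (i < n)%N -> exists b, A i * b = 1.
Proof. by move=> /ltP ni; exact: (inva_unit d D om a hd hweb hnorm s Hs). Qed.
Lemma ad_unit i j : (i < n)%N -> (j < n)%N -> i != j -> exists b, (A i - A j) * b = 1.
Proof.
by move=> /ltP ni /ltP nj /eqP ij; exact: (inva_diff_unit d D om a hd hweb hnorm s Hs).
Qed.

Local Notation e := (zcoef d2 g1 g2 A).
Local Notation fDe := (fDe d1 d2 g1 g2 A).
Local Notation fde1 := (fde1 d1 g1).
Local Notation fkappa := (fkappa d1 d2 g1 g2 n A).
Local Notation inC := (inC d1 d2 g1 g2 A e).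
Local Notation Wd := (Wd d1 d2 g1 g2 n A e).

Lemma sconst_INR k : sconst s (INR k) = k%:R.
Proof. by rewrite INRE rmorph_nat. Qed.

Lemma sd1E f : sd1 om s f = d1 f.
Proof. by rewrite /sd1 !(splusE, smultE, soppE). Qed.
Lemma sd2E f : sd2 om s f = d2 f.
Proof. by rewrite /sd2 !(splusE, smultE, soppE). Qed.

Lemma rep_fde1 k u f : rep u f -> rep (delta_1 om gam k u) (fde1 k f).
Proof.
move=> h; have := rep_delta1 d D om gam hd hweb hgam s Hs k u f h.
by rewrite /sdelta1 sd1E sconst_INR !(splusE, smultE, soppE).
Qed.

Lemma rep_fDe i k u f : (i < n)%N -> rep u f -> rep (Delta_op om a gam i.+1 k u) (fDe i k f).
Proof.
move=> /ltP ni h; have := rep_Delta d D om a gam hd hweb hnorm hgam s Hs i k u f ni h.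
by rewrite /sDelta /sdelta1 /sdelta2 sd1E sd2E sconst_INR !(splusE, smultE, soppE).
Qed.

Lemma rep_sum N (u : nat -> R -> R -> R) (f : nat -> F) :
  (forall i, (i < N)%N -> rep (u i) (f i)) ->
  rep (fun x y => rsum N (fun i => u i x y)) (\sum_(i < N) f i).
Proof.
move=> h; apply: repP => p; rewrite rsum_big rmorph_sum; apply: eq_bigr => i _.
by rewrite /= (rep_evalp p (h i (ltn_ord i))).
Qed.

Definition rep_op (B : wop) (C : fop F) :=
  forall k u (f : F), rep u f -> rep (B k u) (C k f).

Lemma rep_wcompose l l' : List.Forall2 rep_op l l' ->
  forall k u (f : F), rep u f -> rep (wcompose l k u) (fcomp l' k f).
Proof.
elim=> {l l'} [|B C l l' hBC hl IH] k u f hf //=.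
have -> : List.length l = size l' by elim: hl => //= *; congr S.
by apply: hBC; apply: IH.
Qed.

Lemma rep_map_Delta m k : (m + k <= n)%N ->
  List.Forall2 rep_op (List.map (Delta_op om a gam) (List.seq m.+1 k)) (map fDe (iota m k)).
Proof.
elim: k m => [|k IH] m mk; first exact: List.Forall2_nil.
apply: List.Forall2_cons; last by apply: IH; rewrite addSnnS.
move=> r u f h; apply: rep_fDe => //.
by apply: leq_trans mk; rewrite addnS ltnS leq_addr.
Qed.

Lemma rep_box i u f : (i < n)%N -> rep u f ->
  rep (box d om a gam i.+1 u) (fbox d1 d2 g1 g2 n A i f).
Proof.
move=> ni h; rewrite /box /fbox.
have hde : rep_op (delta_1 om gam) fde1 by move=> k v g; exact: rep_fde1.
have h1 : rep (wcompose (List.map (Delta_op om a gam) (List.seq 1 n) ++ [:: delta_1 om gam]) 1 u)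
   (fcomp (word1 d1 d2 g1 g2 n A) 1 f).
  apply: rep_wcompose => //; apply: List.Forall2_app; first exact: rep_map_Delta.
  by apply: List.Forall2_cons => //; exact: List.Forall2_nil.
have h2 : rep (wcompose (List.map (Delta_op om a gam) (List.seq 1 (i.+1 - 1)) ++
     delta_1 om gam :: nil ++ List.map (Delta_op om a gam) (List.seq (i.+1 + 1) (n - i.+1)) ++
     Delta_op om a gam i.+1 :: nil) 1 u)
   (fcomp (word2 d1 d2 g1 g2 n A i) 1 f).
  apply: rep_wcompose => //; apply: List.Forall2_app.
    by rewrite subn1; apply: rep_map_Delta; apply: ltnW.
  apply: List.Forall2_cons => //; apply: List.Forall2_app.
    by rewrite addn1; apply: rep_map_Delta; rewrite subnKC.
  apply: List.Forall2_cons; last exact: List.Forall2_nil.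
  by move=> k v g; exact: rep_fDe.
move=> x y hxy.
have -> : sfv (fcomp (word1 d1 d2 g1 g2 n A) 1 f - fcomp (word2 d1 d2 g1 g2 n A i) 1 f) x y
   = sfv (fcomp (word1 d1 d2 g1 g2 n A) 1 f) x y - sfv (fcomp (word2 d1 d2 g1 g2 n A i) 1 f) x y.
  by have := @raddfB _ _ (evalp (Point hxy)) (fcomp (word1 d1 d2 g1 g2 n A) 1 f)
     (fcomp (word2 d1 d2 g1 g2 n A i) 1 f).
by rewrite -(h1 x y hxy) -(h2 x y hxy).
Qed.

Lemma rep_kappa u (f : nat -> F) : (forall i, (i < n)%N -> rep (u i.+1) (f i)) ->
  rep (kappa d om a gam u) (fkappa f).
Proof.
move=> h; have := @rep_sum n (fun i => box d om a gam i.+1 (u i.+1)) (fun i => fbox d1 d2 g1 g2 n A i (f i)).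
move=> H x y hxy; rewrite /kappa sum_n_m_rsum.
by rewrite -(H _ x y hxy) // => i ni; apply: rep_box => //; apply: h.
Qed.

Local Notation van12 p := (van d1 d2 (evalp p)).

Lemma d1E f : d1 f = (winv * be2) * dx f + (- (winv * al2)) * dy f. Proof. by []. Qed.
Lemma d2E f : d2 f = (- (winv * be1)) * dx f + (winv * al1) * dy f. Proof. by []. Qed.

Lemma van12_xy p k f : van12 p k f <-> van dx dy (evalp p) k f.
Proof.
split; first exact: (van_frame d1M d2M dxE dyE).
exact: (van_frame (@spdx_leibniz s) (@spdy_leibniz s) d1E d2E).
Qed.

Lemma Nat_iterE (T : Type) (f : T -> T) x m : Nat.iter m f x = iter m f x.
Proof. by elim: m => //= m ->. Qed.

Lemma partial_derive_evalp p u f m l : rep u f ->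
  partial_derive m l u (pt_x p) (pt_y p) = evalp p (iter m dx (iter l dy f)).
Proof. by move=> h; rewrite -(rep_evalp p (rep_iter s m l u f h)) !Nat_iterE. Qed.

Lemma van12_partial p k u f : rep u f ->
  (van12 p k f <-> forall m l, (m + l < k)%N -> partial_derive m l u (pt_x p) (pt_y p) = 0).
Proof.
move=> h; split=> [/van12_xy/(van_iter _ (@spdx_spdy s)) H m l ml | H].
  by rewrite (partial_derive_evalp _ _ _ h); apply: H.
apply/van12_xy/(van_iter _ (@spdx_spdy s)) => m l ml.
by rewrite -[LHS](partial_derive_evalp p m l h); apply: H.
Qed.

Definition solves_to (p : point s) (k : nat) (f : nat -> F) :=
  (forall i, (i < n)%N -> van12 p k (fDe i 1 (f i))) /\
  van12 p k (\sum_(i < n) fde1 1 (f i)).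

(** Total derivatives of order below n of the equations are derivatives of the functions obtained by
    applying the operators to a representative, so the prolongation means vanishing to order n, in
    the coordinate frame and hence in the adapted one. *)
Lemma prolongation_van p th (f : nat -> F) : jet_x th = pt_x p -> jet_y th = pt_y p ->
  (forall i, (i < n)%N -> rep (jet_section n th i.+1) (f i)) ->
  prolongation d om a gam n th <-> solves_to p n f.
Proof.
move=> hx hy hf.
have hD i : (i < n)%N -> rep (Delta_op om a gam i.+1 1%N (jet_section n th i.+1)) (fDe i 1 (f i)).
  by move=> ni; apply: rep_fDe => //; apply: hf.
have hg : rep (fun x y => sum_n_m (fun i => delta_1 om gam 1%N (jet_section n th i) x y) 1 (d - 2))
     (\sum_(i < n) fde1 1 (f i)).
  move=> x y hxy; rewrite sum_n_m_rsum.
  rewrite -(@rep_sum n (fun i => delta_1 om gam 1%N (jet_section n th i.+1))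
     (fun i => fde1 1 (f i)) _ x y hxy) //.
  by move=> i ni; apply: rep_fde1; apply: hf.
have n0 := n_gt0.
split=> [H|[H1 H2] m l /leP ml].
  split=> [i ni|].
    apply/(van12_partial _ _ (hD i ni)) => m l ml.
    have [|h _] := H m l; first by apply/leP; lia.
    by rewrite -hx -hy; apply: h; split; apply/leP; lia.
  apply/(van12_partial _ _ hg) => m l ml.
  have [|_ h] := H m l; first by apply/leP; lia.
  by rewrite -hx -hy; exact: h.
have {}ml : (m + l < n)%N by lia.
split=> [[|i] [/leP i1 /leP i2] //|].
  have ni : (i < n)%N by lia.
  rewrite /jet_fun hx hy; have /(van12_partial _ _ (hD i ni)) := H1 i ni; exact.
by rewrite /jet_fun hx hy; have /(van12_partial _ _ hg) := H2; apply.
Qed.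

Definition jet_fam (p : point s) th i := taylor p n (jet_u th i.+1).

Lemma rep_jet_fam (p : point s) th i : jet_x th = pt_x p -> jet_y th = pt_y p ->
  rep (jet_section n th i.+1) (jet_fam p th i).
Proof. exact: rep_jet_section. Qed.

Lemma jet_fun_kappa (p : point s) th : jet_x th = pt_x p -> jet_y th = pt_y p ->
  jet_fun n (kappa d om a gam) th = evalp p (fkappa (jet_fam p th)).
Proof.
move=> hx hy; rewrite /jet_fun hx hy.
have h := @rep_kappa (jet_section n th) (jet_fam p th).
by rewrite -(rep_evalp p (h _)) // => i _; exact: rep_jet_fam.
Qed.

Lemma fDeB i f g : fDe i 1 (f - g) = fDe i 1 f - fDe i 1 g.
Proof. exact: (has_symbolB _ _ _ (fDe_symbol d1 g1 g2 d2M A i)). Qed.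
Lemma fde1B f g : fde1 1 (f - g) = fde1 1 f - fde1 1 g.
Proof. exact: (has_symbolB _ _ _ (fde1_symbol d1 d2 g1)). Qed.

Lemma solves_toB p k f g : solves_to p k f -> solves_to p k g ->
  solves_to p k (fun i => f i - g i).
Proof.
move=> [f1 f2] [h1 h2]; split=> [i ni|].
  by rewrite fDeB; apply: (van_B d1M d2M); [exact: f1 | exact: h1].
rewrite (eq_bigr (fun i : 'I_n => fde1 1 (f i) - fde1 1 (g i))) => [|i _]; last exact: fde1B.
by rewrite sumrB; apply: (van_B d1M d2M).
Qed.

Lemma solves_to_van p k f : (forall i, (i < n)%N -> van12 p k.+1 (f i)) -> solves_to p k f.
Proof.
move=> hf; split=> [i ni|].
  by apply: (van_op d1M d2M _ (fDe_symbol d1 g1 g2 d2M A i)); apply: hf.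
apply: van_sum => i _; apply: (van_op d1M d2M _ (fde1_symbol d1 d2 g1)).
exact: hf.
Qed.

Lemma solves_to0 p k : solves_to p k (fun=> 0).
Proof. by apply: solves_to_van => i _; apply: van0. Qed.

(* Functions are indexed from 0, so that [A i] is a_{i+1} and [f i] is u_{i+1}. *)
Definition solves (f : nat -> F) :=
  (forall i, (i < n)%N -> fDe i 1 (f i) = 0) /\ \sum_(i < n) fde1 1 (f i) = 0.

Lemma solves_solves_to p k f : solves f -> solves_to p k f.
Proof. by move=> [h1 h2]; split=> [i ni|]; rewrite ?h1 ?h2 //; apply: van0. Qed.

Lemma solves_kappa0 p f : solves f -> evalp p (fkappa f) = 0.
Proof.
move=> hf; have [h1 h2] := solves_solves_to p n.+1 hf.
have [_ h2'] := solves_solves_to p n hf.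
rewrite (fkappa_Wd d1M d2M d12 h1 h2').
apply: (@van_ep _ _ d1 d2 _ 0).
have htr : transported d1 d2 (evalp p) n A e n.+1 f.
  by move=> i ni; rewrite -(fDe1E d1 g1 g2 d2M); apply: h1.
have h3 : van12 p n.+1 (\sum_(m < n) (d1 (f m) - g1 * f m)).
  by congr van: h2; apply: eq_bigr => m _; rewrite /Web.fde1; ring.
by have := evM_inC d1M d2M d12 htr h3 (inC_Wd d1 d2 g1 g2 n A e n); rewrite subSnn.
Qed.

Definition free_jet (f : nat -> F) (b : fidx n) := iter (\val b).2 d2 (f (\val b).1).

Lemma iter_d2B j f g : iter j d2 (f - g) = iter j d2 f - iter j d2 g.
Proof. by elim: j => //= j ->; rewrite raddfB. Qed.

(* A jet of order n in the prolongation is determined by its free derivatives,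
   hence agrees with a solution up to order n. *)
Lemma kappa0_of_solution (p : point s) th g : jet_x th = pt_x p -> jet_y th = pt_y p ->
  prolongation d om a gam n th -> solves g ->
  (forall b, evalp p (free_jet (jet_fam p th) b) = evalp p (free_jet g b)) ->
  jet_fun n (kappa d om a gam) th = 0.
Proof.
move=> hx hy hth hg hb; rewrite (jet_fun_kappa hx hy).
have hf : solves_to p n (jet_fam p th).
  by apply/(prolongation_van hx hy) => // i _; apply: rep_jet_fam.
have [k1 k2] := solves_toB hf (solves_solves_to p n hg).
apply/eqP; rewrite -[X in X == _]subr0 -{1}(solves_kappa0 p hg) -rmorphB -(fkappaB d1 g1 g2 d2M).
  apply/eqP; apply: (fkappa_order d1M d2M d12) => i ni.
  apply: (van_of_free_jet d1M d2M d12 a_unit ad_unit k1 k2) => // b.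
  by rewrite iter_d2B rmorphB; apply/eqP; rewrite subr_eq0; apply/eqP; apply: hb.
Qed.

Lemma Wd_of_kappa0 :
  (forall (p : point s) th, jet_x th = pt_x p -> jet_y th = pt_y p -> prolongation d om a gam n th ->
     jet_fun n (kappa d om a gam) th = 0) -> inC n (Wd n).
Proof.
move=> hk; have [r hr] := reduction_exists d1 d2 g1 g2 e a_unit ad_unit.
suff r0 : reduce r (Wd n) = 0.
  rewrite -[Wd n]subr0 -[X in _ - X]r0; apply: (inC_reduce hr); exact: Wd_ford.
apply: ffree_cf0; first exact: (ffree_reduceP hr).
move=> b; apply: sfun_separated => p.
(* Affine functions vanishing at [p] whose differentials there are omega_1 and omega_2, hence
   coordinates dual to the frame at [p]. *)
pose x1 := sconst s (evalp p al1) * sfst s (pt_x p) + sconst s (evalp p be1) * ssnd s (pt_y p).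
pose x2 := sconst s (evalp p al2) * sfst s (pt_x p) + sconst s (evalp p be2) * ssnd s (pt_y p).
have W0 := congr1 (evalp p) w_unit; rewrite rmorphM rmorphB !rmorphM rmorph1 in W0.
have dlin (c1 c2 : R) :
    (spdx (sconst s c1 * sfst s (pt_x p) + sconst s c2 * ssnd s (pt_y p)) = sconst s c1) *
    (spdy (sconst s c1 * sfst s (pt_x p) + sconst s c2 * ssnd s (pt_y p)) = sconst s c2).
  split.
    rewrite [LHS](raddfD dx) /dx /= !spdx_leibniz spdx_fst1 spdx_snd0 !spdx_const0.
    by ring.
  rewrite [LHS](raddfD dy) /dy /= !spdy_leibniz spdy_fst0 spdy_snd1 !spdy_const0.
  by ring.
apply: (@kappa_reduce0 _ _ d1 d2 g1 g2 d1M d2M d12 n A a_unit ad_unit (evalp p)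
  (sconst s) (evalp_const p) (vfield_const _ _) (vfield_const _ _) x1 x2) => //.
- by rewrite /x1 rmorphD !rmorphM /= evalp_fst evalp_snd !subrr !mulr0 addr0.
- by rewrite /x2 rmorphD !rmorphM /= evalp_fst evalp_snd !subrr !mulr0 addr0.
- by rewrite d1E /dx /dy /x1 /= !dlin eval_det /= !evalp_const -[RHS]W0.
- rewrite d2E /dx /dy /x1 /= !dlin addrC eval_det /= !evalp_const.
  by rewrite [X in _ * (X - _)]mulrC subrr mulr0.
- rewrite d2E /dx /dy /x2 /= !dlin addrC eval_det /= !evalp_const -[RHS]W0.
  by rewrite [X in _ * (X - _)]mulrC [X in _ * (_ - X)]mulrC.
move=> f hf1 hf2.
(* The n-jet of the given family, with a predecessor because jets count the unknowns from 1. Its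
   Taylor representatives agree with [f] up to functions vanishing to order n.+1, which kappa, of
   order n, does not see. *)
pose th := Jet (pt_x p) (pt_y p) (fun i m l => evalp p (iter m dx (iter l dy (f i.-1)))).
have hv i : (i < n)%N -> van12 p n.+1 (jet_fam p th i - f i).
  move=> ni; apply/van12_xy/(van_iter _ (@spdx_spdy s)) => m l ml.
  have itB (dd : {additive F -> F}) k u v : iter k dd (u - v) = iter k dd u - iter k dd v.
    by elim: k => //= k ->; rewrite raddfB.
  by rewrite !itB rmorphB /= /jet_fam taylor_van // subrr.
have hth : prolongation d om a gam n th.
  apply/(@prolongation_van p th (jet_fam p th)) => //.
    by move=> i _; apply: rep_jet_fam.
  have [v1 v2] := solves_to_van hv.
  have [v1' v2'] := solves_toB (conj v1 v2 : solves_to p n _) (solves_toB (solves_to0 p n) (conj hf1 hf2)).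
  split=> [i ni|].
    by have := v1' i ni; rewrite sub0r opprK subrK.
  congr van: v2'; apply: eq_bigr => i _; by rewrite sub0r opprK subrK.
have := hk p th erefl erefl hth; rewrite (jet_fun_kappa (p := p)) // => hk0.
apply/eqP; rewrite -oppr_eq0 -[X in X == _]add0r -{1}hk0 -rmorphB -(fkappaB d1 g1 g2 d2M).
by apply/eqP; apply: (fkappa_order d1M d2M d12) => i ni; apply: hv.
Qed.

Local Notation M := {ffun 'I_n -> {poly F}}.
Local Notation T := (fidx n).
Local Notation N := #|{: T}|.

(** The free derivatives are enumerated by natural numbers, the indexing of the linear systems
    solved above; this one is merely the default value of [nth]. *)
Definition fidx0 : T := Sub (Ordinal n_gt0, Ordinal n_gt0) (leqnn 0).
Definition fnth (k : nat) : T := nth fidx0 (enum {: T}) k.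
Definition frank (b : T) : nat := index b (enum {: T}).

Lemma frank_lt b : (frank b < N)%N.
Proof. by rewrite cardE index_mem mem_enum. Qed.
Lemma frankK b : fnth (frank b) = b.
Proof. by rewrite /fnth nth_index // mem_enum. Qed.
Lemma fnthK k : (k < N)%N -> frank (fnth k) = k.
Proof. by move=> kN; rewrite /frank index_uniq ?enum_uniq // -cardE. Qed.

Lemma big_fidx (V : nmodType) (G : T -> V) : \sum_b G b = \sum_(k < N) G (fnth k).
Proof.
rewrite -(big_enum_cond _ _ predT) /= (big_nth fidx0) big_mkord -cardE.
by apply: eq_bigl => k.
Qed.

Lemma rsum_fidx (G : T -> R) : rsum N (fun k => G (fnth k)) = \sum_b G b.
Proof. by rewrite rsum_big big_fidx. Qed.

Definition freemx (r : T -> M) (k l : nat) : R -> R -> R := sfv (cf (r (fnth k)) (fnth l)).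

Lemma freemx_smooth r k l : smooth_on (dom s) (freemx r k l).
Proof. exact: sfv_smooth. Qed.

Lemma freemx_sum (p : point s) r k (z : T -> R) :
  rsum N (fun l => (freemx r k l (pt_x p) (pt_y p) * z (fnth l))%R)
  = \sum_c evalp p (cf (r (fnth k)) c) * z c.
Proof. exact: (rsum_fidx (fun c => evalp p (cf (r (fnth k)) c) * z c)). Qed.

Lemma pdx_at (f : F) (p : point s) :
  is_derive (fun t => sfv f t (pt_y p)) (pt_x p) (evalp p (dx f)).
Proof.
have -> : evalp p (dx f) = Derive (fun t => sfv f t (pt_y p)) (pt_x p).
  exact: (spdxE f _ _ (pt_dom p)).
apply: Derive_correct; apply: (smooth_on_ex_x (dom s)); [exact: sfv_smooth | exact: pt_dom].
Qed.
Lemma pdy_at (f : F) (p : point s) :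
  is_derive (fun t => sfv f (pt_x p) t) (pt_y p) (evalp p (dy f)).
Proof.
have -> : evalp p (dy f) = Derive (fun t => sfv f (pt_x p) t) (pt_y p).
  exact: (spdyE f _ _ (pt_dom p)).
apply: Derive_correct; apply: (smooth_on_ex_y (dom s)); [exact: sfv_smooth | exact: pt_dom].
Qed.

Definition fzero (i : 'I_n) : T := Sub (i, Ordinal n_gt0) (leq0n i).

(** Free derivatives of every solution are parallel for one and the same connection, so a single
    radius serves all solutions and all base points [p]. *)
Lemma solution_unique : exists rho, Rlt 0 rho /\ Rle rho (sq_r s) /\
  forall f (p : point s), solves f -> sq (sq_x s) (sq_y s) rho (pt_x p, pt_y p) ->
  (forall b, evalp p (free_jet f b) = 0) ->
  forall i, (i < n)%N -> forall q : point s, sq (sq_x s) (sq_y s) rho (pt_x q, pt_y q) ->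
  evalp q (f i) = 0.
Proof.
have [rx [ry hc]] := connection_exists d1 d2 g1 g2 al1 al2 be1 be2 e a_unit ad_unit.
have [rho [[rho0 rho1] H]] := parallel_unique_near N (freemx rx) (freemx ry) (sq_x s) (sq_y s)
  (sq_r s) (sq_pos s) (fun k l _ _ => freemx_smooth rx k l) (fun k l _ _ => freemx_smooth ry k l).
exists rho; split=> //; split=> // f p [hf hg] hp hb i ni q hq.
have sub x y : sq (sq_x s) (sq_y s) rho (x, y) -> dom s (x, y) by exact: sq_le.
have htr j : (j < n)%N -> sig d1 d2 (A j) (f j) - e j * f j = 0.
  by move=> nj; rewrite -(fDe1E d1 g1 g2 d2M); apply: hf.
have hgen : \sum_(j < n) (d1 (f j) - g1 * f j) = 0.
  by rewrite -[RHS]hg; apply: eq_bigr => m _; rewrite /Web.fde1 mul1r.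
have hpar := @solution_parallel _ _ d1 d2 dx dy g1 g2 d1M d2M d12 al1 al2 be1 be2 dxE dyE n A e
   rx ry hc (point s) (@evalp s) (@sfun_separated s) f htr hgen.
have b2 : free_jet f (fzero (Ordinal ni)) = f i by [].
pose z k := sfv (free_jet f (fnth k)).
have := H z (pt_x p) (pt_y p) _ hp _ (frank (fzero (Ordinal ni))) (pt_x q) (pt_y q) _ hq.
rewrite /z frankK b2; apply; last by apply/ltP; exact: frank_lt.
  move=> k x y _ hxy; pose t := Point (sub _ _ hxy).
  have [Ex Ey] := hpar (fnth k).
  split.
    have := pdx_at (free_jet f (fnth k)) t; rewrite [dx _]Ex rmorph_sum /=.
    congr is_derive; symmetry; apply: (etrans (freemx_sum t rx k (fun c => evalp t (free_jet f c)))).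
    by apply: eq_bigr => c _; rewrite rmorphM.
  have := pdy_at (free_jet f (fnth k)) t; rewrite [dy _]Ey rmorph_sum /=.
  congr is_derive; symmetry; apply: (etrans (freemx_sum t ry k (fun c => evalp t (free_jet f c)))).
  by apply: eq_bigr => c _; rewrite rmorphM.
by move=> k _; exact: (hb (fnth k)).
Qed.

Lemma rmorph_zcoef (S T : pzRingType) (f : {rmorphism S -> T}) (t u v w : S) :
  f (t + u - v * w) = f t + f u - f v * f w.
Proof. by rewrite rmorphB rmorphD rmorphM. Qed.
Lemma addB_cancel (V : zmodType) (u v : V) : u + v - u - v = 0.
Proof. by rewrite addrAC addrK subrr. Qed.

Section LinearEvaluation.
Variables (p : point s) (z : T -> R).
(** A free element read as a linear form in the free derivatives, evaluated at [p] on the values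
    [z]. *)
Definition lincomb (Q : M) : R := \sum_c evalp p (cf Q c) * z c.

Lemma lincombZ h Q : lincomb (h *: Q) = evalp p h * lincomb Q.
Proof.
by rewrite /lincomb mulr_sumr; apply: eq_bigr => c _; rewrite cfZ rmorphM mulrA.
Qed.
Lemma lincombD P Q : lincomb (P + Q) = lincomb P + lincomb Q.
Proof.
by rewrite /lincomb -big_split; apply: eq_bigr => c _; rewrite cfD rmorphD mulrDl.
Qed.
Lemma lincombB P Q : lincomb (P - Q) = lincomb P - lincomb Q.
Proof.
by rewrite /lincomb -sumrB; apply: eq_bigr => c _; rewrite cfB rmorphB mulrBl.
Qed.
Lemma lincomb0 : lincomb 0 = 0.
Proof. by rewrite -[0 in LHS](subrr 0) lincombB subrr. Qed.
Lemma lincomb_sum (I : finType) (f : I -> M) : lincomb (\sum_i f i) = \sum_i lincomb (f i).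
Proof. by apply: (big_morph lincomb lincombD lincomb0). Qed.
Lemma lincomb_fbasis b : lincomb (fbasis F b) = z b.
Proof.
rewrite /lincomb (bigD1 b) //= cf_fbasis eqxx rmorph1 mul1r big1 ?addr0 // => c cb.
by rewrite cf_fbasis (negPf cb) rmorph0 mul0r.
Qed.
End LinearEvaluation.

Lemma evalp_winv p : evalp p winv = Rinv (wedge (om 1%N) (om 2%N) (pt_x p) (pt_y p)).
Proof. exact: (rep_evalp p (rep_winv d D om hd hweb s Hs)). Qed.

Lemma coef1_evalp (p : point s) u : Defs.coef1 om (d_fun u) (pt_x p) (pt_y p) =
  evalp p winv * (evalp p be2 * pdx u (pt_x p) (pt_y p) - evalp p al2 * pdy u (pt_x p) (pt_y p)).
Proof.
rewrite coef1_d_fun evalp_winv (rep_evalp p (rep_al2 d D om hd hweb s Hs)).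
rewrite (rep_evalp p (rep_be2 d D om hd hweb s Hs)) /Rdiv.
by rewrite [LHS]Rmult_comm [Rmult (pdx _ _ _) _]Rmult_comm [Rmult (pdy _ _ _) _]Rmult_comm.
Qed.

Lemma coef2_evalp (p : point s) u : Defs.coef2 om (d_fun u) (pt_x p) (pt_y p) =
  evalp p winv * (evalp p al1 * pdy u (pt_x p) (pt_y p) - evalp p be1 * pdx u (pt_x p) (pt_y p)).
Proof.
rewrite coef2_d_fun evalp_winv (rep_evalp p (rep_al1 d D om hd hweb s Hs)).
rewrite (rep_evalp p (rep_be1 d D om hd hweb s Hs)) /Rdiv.
by rewrite [LHS]Rmult_comm.
Qed.

Definition first_row (z : T -> R -> R -> R) (i : nat) : R -> R -> R :=
  if insub i is Some i' then z (fzero i') else fun _ _ => 0.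

(** The properties of a parallel section, expressed by the original operators and not in the
    function ring of a particular square, so that they restrict to smaller squares. *)
Definition frame_on (Q : R * R -> Prop) (z : T -> R -> R -> R) : Prop :=
  (forall b, smooth_on Q (z b)) /\ forall x y, Q (x, y) ->
  [/\ forall i, (i < n)%N -> Delta_op om a gam i.+1 1%N (first_row z i) x y = 0,
      rsum n (fun i => delta_1 om gam 1%N (first_row z i) x y) = 0 &
      forall b b' : T, (val b').1 = (val b).1 -> (val b').2 = (val b).2.+1 :> nat ->
        Defs.coef2 om (d_fun (z b)) x y = z b' x y].

(** Along a parallel section the frame derivatives of entry [b] are the linear forms [row1 b] and
    [row2 b]. The three row relations then yield the transport equations, the last equation and the
    chains of [d2]-derivatives. *)
Lemma solutions_exist : (forall Q : M, inC n.+1 Q -> ffree Q -> Q = 0) ->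
  exists rho, Rlt 0 rho /\ Rle rho (sq_r s) /\ forall c : T -> R, exists z : T -> R -> R -> R,
    (forall b, z b (sq_x s) (sq_y s) = c b) /\ frame_on (sq (sq_x s) (sq_y s) rho) z.
Proof.
move=> top.
have [rx [ry hc]] := connection_exists d1 d2 g1 g2 al1 al2 be1 be2 e a_unit ad_unit.
have flat := connection_flat d1M d2M d12 dxE dyE struct1 struct2 hc top.
have [|rho [[rho0 rho1] H]] := frobenius_linear N (freemx rx) (freemx ry) (sq_x s) (sq_y s)
  (sq_r s) (sq_pos s) (fun k l _ _ => freemx_smooth rx k l) (fun k l _ _ => freemx_smooth ry k l).
  move=> k l x y _ _ hxy; pose p := Point hxy.
  have := congr1 (evalp p) (flat (fnth k) (fnth l)); rewrite !rmorphD !rmorph_sum /=.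
  have -> : evalp p (spdy (cf (rx (fnth k)) (fnth l))) = pdy (freemx rx k l) x y.
    exact: spdyE.
  have -> : evalp p (spdx (cf (ry (fnth k)) (fnth l))) = pdx (freemx ry k l) x y.
    exact: spdxE.
  move=> E; apply: etrans (etrans E _).
    congr Rplus; apply: etrans (freemx_sum p rx k (fun b => evalp p (cf (ry b) (fnth l)))) _.
    by apply: eq_bigr => b _; rewrite rmorphM.
  congr Rplus; apply: esym; apply: etrans (freemx_sum p ry k (fun b => evalp p (cf (rx b) (fnth l)))) _.
  by apply: eq_bigr => b _; rewrite rmorphM.
exists rho; split=> //; split=> // c.
have [z [z0 [zs zp]]] := H (fun k => c (fnth k)).
have sub x y : sq (sq_x s) (sq_y s) rho (x, y) -> dom s (x, y) by exact: sq_le.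
have fl b : (frank b < N)%coq_nat by apply/ltP; apply: frank_lt.
exists (fun b => z (frank b)); split=> [b|]; first by rewrite z0 frankK.
split=> [b|x y hxy]; first exact: zs.
pose p := Point (sub _ _ hxy); pose zz (b : T) := z (frank b) x y.
have Ex b : pdx (z (frank b)) x y = lincomb p zz (rx b).
  have [h _] := zp (frank b) x y (fl b) hxy.
  apply: etrans (is_derive_unique _ _ _ h) _; rewrite /lincomb -{2}[b]frankK.
  apply: etrans (freemx_sum p rx (frank b) zz); apply: rsum_ext => l /ltP lN.
  by rewrite /zz fnthK.
have Ey b : pdy (z (frank b)) x y = lincomb p zz (ry b).
  have [_ h] := zp (frank b) x y (fl b) hxy.
  apply: etrans (is_derive_unique _ _ _ h) _; rewrite /lincomb -{2}[b]frankK.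
  apply: etrans (freemx_sum p ry (frank b) zz); apply: rsum_ext => l /ltP lN.
  by rewrite /zz fnthK.
have E1 b : Defs.coef1 om (d_fun (z (frank b))) x y = lincomb p zz (Web.row1 al2 be2 winv rx ry b).
  by rewrite (coef1_evalp p) /= Ex Ey /Web.row1 lincombZ lincombB !lincombZ.
have E2 b : Defs.coef2 om (d_fun (z (frank b))) x y = lincomb p zz (Web.row2 al1 be1 winv rx ry b).
  by rewrite (coef2_evalp p) /= Ex Ey /Web.row2 lincombZ lincombB !lincombZ.
have Eg1 : evalp p g1 = Defs.coef1 om gam x y.
  exact: (rep_evalp p (rep_g1 d D om gam hd hweb hgam s Hs)).
have Eg2 : evalp p g2 = Defs.coef2 om gam x y.
  exact: (rep_evalp p (rep_g2 d D om gam hd hweb hgam s Hs)).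
split.
- move=> i ni; rewrite /first_row insubT.
  set b := fzero _.
  have hxyz := zs _ (fl b); have Sa := smooth_inva d D om a hd hnorm s Hs i (ltP ni).
  rewrite Delta_op_at; first last.
  + exact: (smooth_on_ex_y _ _ _ _ Sa (sub _ _ hxy)).
  + exact: (smooth_on_ex_x _ _ _ _ Sa (sub _ _ hxy)).
  + exact: (smooth_on_ex_y _ _ _ _ hxyz hxy).
  + exact: (smooth_on_ex_x _ _ _ _ hxyz hxy).
  have hi := rep_inva d D om a hd hnorm s Hs i (ltP ni).
  have Ea : evalp p (A i) = a i.+1 x y by exact: (rep_evalp p hi).
  have Eda : evalp p (d2 (A i)) = Defs.coef2 om (d_fun (a i.+1)) x y.
    by rewrite -sd2E; exact: (rep_evalp p (rep_coef2 d D om hd hweb s Hs _ _ hi)).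
  have b2 : (val b).2 = 0%N :> nat by [].
  rewrite E1 E2 (row_transport d1M d2M d12 w_unit a_unit ad_unit hc b2).
  have bi : (val b).1 = i :> nat by [].
  have Ee : evalp p (d2 (A i) + g1 - g2 * A i) =
      Rminus (Rplus (coef2 om (d_fun (a i.+1)) x y) (Defs.coef1 om gam x y)) (Rmult (coef2 om gam x y) (a i.+1 x y)).
    rewrite -Ea -Eda -Eg1 -Eg2; exact: (rmorph_zcoef (@evalp s p)).
  rewrite bi lincombD !lincombZ lincomb_fbasis [evalp p (e i)]Ee Ea.
  exact: addB_cancel.
- rewrite rsum_big.
  have hb (i : 'I_n) : (val (fzero i)).1 = i /\ (val (fzero i)).2 = 0%N :> nat by [].
  have := congr1 (lincomb p zz) (row_gen d1M d2M d12 w_unit n_gt0 a_unit ad_unit hc hb).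
  rewrite lincomb0 lincomb_sum => E; rewrite -[RHS]E; apply: eq_bigr => i _.
  rewrite lincombB -E1 lincombZ lincomb_fbasis /delta_1 /first_row valK Eg1.
  by rewrite Rmult_1_l.
- move=> b b' h1 h2; rewrite E2 (row2_succ d1M d2M d12 w_unit a_unit ad_unit hc h1 h2).
  by rewrite lincomb_fbasis.
Qed.

Lemma d1_const c : d1 (sconst s c) = 0. Proof. exact: vfield_const. Qed.
Lemma d2_const c : d2 (sconst s c) = 0. Proof. exact: vfield_const. Qed.

Lemma fDeZ i c f : fDe i 1 (sconst s c * f) = sconst s c * fDe i 1 f.
Proof.
by rewrite /Web.fDe /Web.fde1 mulrCA !d1M !d2M d1_const d2_const !mul0r !add0r; ring.
Qed.
Lemma fde1Z c f : fde1 1 (sconst s c * f) = sconst s c * fde1 1 f.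
Proof.
by rewrite /Web.fde1 d1M d1_const mul0r add0r; ring.
Qed.

Lemma solves_0 : solves (fun=> 0).
Proof.
have fDe0 i : fDe i 1 0 = 0 by have := fDeZ i 0 0; rewrite !rmorph0 !mul0r.
have fde10 : fde1 1 0 = 0 by have := fde1Z 0 0; rewrite !rmorph0 !mul0r.
by split=> [i _|]; rewrite ?fDe0 // big1.
Qed.

Lemma solves_B f g : solves f -> solves g -> solves (fun i => f i - g i).
Proof.
move=> [f1 f2] [h1 h2]; split=> [i ni|]; first by rewrite fDeB f1 // h1 // subrr.
by under eq_bigr => i _ do rewrite fde1B; rewrite sumrB f2 h2 subrr.
Qed.

Lemma solves_Z c f : solves f -> solves (fun i => sconst s c * f i).
Proof.
move=> [f1 f2]; split=> [i ni|]; first by rewrite fDeZ f1 // mulr0.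
by under eq_bigr => i _ do rewrite fde1Z; rewrite -mulr_sumr f2 mulr0.
Qed.

Lemma solves_ext f g : (forall i, (i < n)%N -> f i = g i) -> solves f -> solves g.
Proof.
move=> h [f1 f2]; split=> [i ni|]; first by rewrite -h // f1.
by rewrite -[RHS]f2; apply: eq_bigr => i _; rewrite h.
Qed.

Definition comb K (c : nat -> R) (f : nat -> nat -> F) (i : nat) : F :=
  \sum_(j < K) sconst s (c j) * f j i.

Lemma solves_comb K c f : (forall j, (j < K)%N -> solves (f j)) -> solves (comb K c f).
Proof.
elim: K => [|K IH] h.
  by apply: solves_ext solves_0 => i _; rewrite /comb big_ord0.
have h1 := IH (fun j jK => h j (ltnW jK)); have h2 := solves_Z (- c K) (h K (ltnSn K)).
apply: solves_ext (solves_B h1 h2) => i _.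
by rewrite /comb big_ord_recr /= rmorphN mulNr opprK.
Qed.

Lemma iter_d2Z j c f : iter j d2 (sconst s c * f) = sconst s c * iter j d2 f.
Proof.
by elim: j => //= j ->; rewrite d2M d2_const mul0r add0r.
Qed.

Lemma free_jet_comb p K c f b :
  evalp p (free_jet (comb K c f) b) = \sum_(j < K) c j * evalp p (free_jet (f j) b).
Proof.
rewrite /free_jet /comb iter_sum rmorph_sum; apply: eq_bigr => j _.
by rewrite iter_d2Z rmorphM /= evalp_const.
Qed.

Lemma free_jet_B p f g b :
  evalp p (free_jet (fun i => f i - g i) b) = evalp p (free_jet f b) - evalp p (free_jet g b).
Proof. by rewrite /free_jet iter_d2B rmorphB. Qed.

Lemma solves_of_solves_on u : solves_on d om a gam s u -> solves (fun i => sof s (u i)).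
Proof.
move=> [us [uD ug]].
have ru i : (i < n)%N -> rep (u i) (sof s (u i)) by move=> /ltP ni; apply: rep_sof; apply: us.
split=> [i ni|]; apply: sfun_separated => p.
  by rewrite (rep_evalp p (rep_fDe 1 ni (ru i ni))) uD //; [exact/ltP | exact: pt_dom].
have := rep_evalp p (@rep_sum n (fun i => delta_1 om gam 1 (u i)) (fun i => fde1 1 (sof s (u i))) _).
by move=> -> => [|i ni]; [apply: ug; exact: pt_dom | apply: rep_fde1; apply: ru].
Qed.

Lemma evalp_sof u p : smooth_on (dom s) u -> evalp p (sof s u) = u (pt_x p) (pt_y p).
Proof. by move=> h; apply: rep_evalp; apply: rep_sof. Qed.

Lemma evalp_comb p K c (u : nat -> nat -> R -> R -> R) i :
  (forall j, (j < K)%N -> smooth_on (dom s) (u j i)) ->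
  evalp p (comb K c (fun j i => sof s (u j i)) i) =
  rsum K (fun j => (c j * u j i (pt_x p) (pt_y p))%R).
Proof.
move=> h; rewrite rsum_big rmorph_sum; apply: eq_bigr => j _.
by rewrite rmorphM /= evalp_const evalp_sof //; apply: h.
Qed.

(** If a combination of the solutions had zero free derivatives at p, it would vanish on the whole
    square and contradict independence. So the square matrix [Z] is invertible, and some combination
    has the free derivatives of the given jet. *)
Lemma kappa0_of_rank (f : nat -> nat -> F) : (forall j, (j < N)%N -> solves (f j)) ->
  (forall rho c, Rlt 0 rho -> Rle rho (sq_r s) ->
     (forall i (p : point s), (i < n)%N -> sq (sq_x s) (sq_y s) rho (pt_x p, pt_y p) ->
        evalp p (comb N c f i) = 0) -> forall j, (j < N)%N -> c j = 0) ->
  exists rho, Rlt 0 rho /\ Rle rho (sq_r s) /\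
    forall th, sq (sq_x s) (sq_y s) rho (jet_x th, jet_y th) ->
      prolongation d om a gam n th -> jet_fun n (kappa d om a gam) th = 0.
Proof.
move=> hf ind; have [rho [rho0 [rho1 uniq_sol]]] := solution_unique.
exists rho; split=> //; split=> // th hth pth.
have sub x y : sq (sq_x s) (sq_y s) rho (x, y) -> dom s (x, y) by exact: sq_le.
pose p := Point (sub _ _ hth).
pose Z : 'M[R]_N := \matrix_(j, k) evalp p (free_jet (f j) (fnth k)).
have ev (c : 'rV[R]_N) (c' : nat -> R) : (forall j : 'I_N, c' j = c 0 j) ->
    forall k : 'I_N, (c *m Z) 0 k = evalp p (free_jet (comb N c' f) (fnth k)).
  by move=> cc k; rewrite free_jet_comb !mxE; apply: eq_bigr => j _; rewrite mxE cc.
pose co (c : 'rV[R]_N) (j : nat) : R := if insub j is Some j' then c 0 j' else 0.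
have coE c (j : 'I_N) : co c j = c 0 j by rewrite /co valK.
have injZ (c : 'rV[R]_N) : c *m Z = 0 -> c = 0.
  move=> cZ; apply/matrixP => i0 j; rewrite ord1 mxE -coE.
  apply: (ind rho (co c)) => // i q ni hq.
  apply: (uniq_sol (comb N (co c) f) p) => //; first exact: solves_comb.
  move=> b; rewrite -[b]frankK; have := ev c (co c) (coE c) (Ordinal (frank_lt b)).
  by rewrite cZ mxE /= => <-.
have [c cZ] := injective_row_surj injZ (\row_k evalp p (free_jet (jet_fam p th) (fnth k))).
apply: (@kappa0_of_solution p th (comb N (co c) f)) => //; first exact: solves_comb.
move=> b; have := ev c (co c) (coE c) (Ordinal (frank_lt b)).
by rewrite cZ mxE /= frankK.
Qed.

Lemma frame_on_sub Q Q' z : (forall p, Q' p -> Q p) -> frame_on Q z -> frame_on Q' z.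
Proof.
by move=> h [zs zp]; split=> [b x y /h|x y /h]; [apply: zs | apply: zp].
Qed.

Lemma first_row_smooth Q z i : open Q -> (forall b, smooth_on Q (z b)) -> smooth_on Q (first_row z i).
Proof.
move=> oQ h; rewrite /first_row; case: insub => [j|]; first exact: h.
exact: smooth_on_const.
Qed.

Lemma frame_solves z : frame_on (dom s) z -> solves_on d om a gam s (first_row z).
Proof.
move=> [zs zp]; split=> [i _|]; first by apply: first_row_smooth => //; exact: dom_open.
by split=> [i x y /ltP ni /zp[h _ _]|x y /zp[_ h _]] //; apply: h.
Qed.

(** Induction along the entries of one unknown, each being the [d2]-derivative of the previous
    one. *)
Lemma frame_jet z b : frame_on (dom s) z ->
  rep (z b) (free_jet (fun i => sof s (first_row z i)) b).
Proof.
move=> [zs zp]; have [j bj] : exists j, (val b).2 = j :> nat by exists (val b).2.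
elim: j b bj => [|j IH] b bj.
  have eb : b = fzero (val b).1.
    by apply: val_inj; rewrite [LHS]surjective_pairing; congr pair; apply: val_inj.
  rewrite /free_jet bj /= {1}eb; have -> : z (fzero (val b).1) = first_row z (val b).1.
    by rewrite /first_row valK.
  by apply: rep_sof; apply: first_row_smooth => //; exact: dom_open.
have jb : (j < n)%N by rewrite (leq_trans _ (ltn_ord (val b).2)) // bj ltnW.
have lb : (Ordinal jb <= (val b).1)%N.
  by rewrite /= ltnW // -bj; exact: (valP b).
pose b' : T := Sub ((val b).1, Ordinal jb) lb.
have h := rep_coef2 d D om hd hweb s Hs _ _ (IH b' erefl).
move=> x y hxy; have [_ _ hs] := zp x y hxy; rewrite -(hs b' b) // [LHS]h //.
by rewrite sd2E /free_jet bj.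
Qed.

Definition center : point s := Point (dom_center s).

Section FrameBasis.
Variable z : T -> T -> R -> R -> R.
Hypothesis z_center : forall b0 b, z b0 b (sq_x s) (sq_y s) = if b == b0 then 1 else 0.
Hypothesis z_frame : forall b0, frame_on (dom s) (z b0).

Definition frame_sol (j i : nat) := first_row (z (fnth j)) i.

Lemma frame_comb_jet c b :
  evalp center (free_jet (comb N c (fun j i => sof s (frame_sol j i))) b) = c (frank b).
Proof.
rewrite free_jet_comb (bigD1 (Ordinal (frank_lt b))) //= big1 ?addr0.
  by rewrite (rep_evalp _ (frame_jet b (z_frame _))) /= z_center frankK eqxx mulr1.
move=> j jb; rewrite (rep_evalp _ (frame_jet b (z_frame _))) /= z_center.
case: eqP => [E|_]; last by rewrite mulr0.
by case/eqP: jb; apply: val_inj; rewrite /= E fnthK.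
Qed.

Lemma frame_sol_smooth j i : smooth_on (dom s) (frame_sol j i).
Proof. by apply: first_row_smooth; [exact: dom_open | exact: (z_frame _).1]. Qed.

Lemma frame_sol_free c : (forall i x y, (i < n)%N -> dom s (x, y) ->
    rsum N (fun j => (c j * frame_sol j i x y)%R) = 0) -> forall j, (j < N)%N -> c j = 0.
Proof.
move=> h j jN; rewrite -(fnthK jN) -frame_comb_jet /free_jet.
have -> : comb N c (fun j i => sof s (frame_sol j i)) (val (fnth j)).1 = 0.
  apply: sfun_separated => p; rewrite evalp_comb; last by move=> k _; exact: frame_sol_smooth.
  by apply: h; [exact: ltn_ord | exact: pt_dom].
have -> : iter (val (fnth j)).2 d2 0 = 0 by elim: (nat_of_ord _) => //= k ->; rewrite raddf0.
by rewrite rmorph0.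
Qed.

(** The coefficients are the free derivatives of [v] at the centre. The difference from the
    combination is a solution with no free derivatives there, and uniqueness annihilates it. *)
Lemma frame_sol_span v : solves_on d om a gam s v ->
  exists c rho, Rlt 0 rho /\ Rle rho (sq_r s) /\
  forall i x y, (i < n)%N -> sq (sq_x s) (sq_y s) rho (x, y) ->
    v i x y = rsum N (fun j => (c j * frame_sol j i x y)%R).
Proof.
move=> hv; have [rho [rho0 [rho1 uniq_sol]]] := solution_unique.
pose fv i := sof s (v i); pose c j := evalp center (free_jet fv (fnth j)).
exists c, rho; split=> //; split=> // i x y ni hxy.
have sub u w : sq (sq_x s) (sq_y s) rho (u, w) -> dom s (u, w) by exact: sq_le.
have sf : solves (fun i => fv i - comb N c (fun j i => sof s (frame_sol j i)) i).
  apply: solves_B; first exact: solves_of_solves_on.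
  by apply: solves_comb => j _; apply: solves_of_solves_on; apply: frame_solves.
have := uniq_sol _ center sf (sq_center _ _ _ rho0) _ i ni (Point (sub _ _ hxy)) hxy.
rewrite evalpB evalp_comb; last by move=> k _; exact: frame_sol_smooth.
rewrite evalp_sof; last by case: hv => h _; apply: h; apply/ltP.
by move=> h; apply/eqP; rewrite -subr_eq0; apply/eqP; apply: h => b; rewrite free_jet_B frame_comb_jet /c frankK subrr.
Qed.
End FrameBasis.

Lemma frames_of_kappa0 :
  (forall th, dom s (jet_x th, jet_y th) -> prolongation d om a gam n th ->
     jet_fun n (kappa d om a gam) th = 0) ->
  exists rho, Rlt 0 rho /\ Rle rho (sq_r s) /\ exists z : T -> T -> R -> R -> R,
    (forall b0 b, z b0 b (sq_x s) (sq_y s) = if b == b0 then 1 else 0) /\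
    forall b0, frame_on (sq (sq_x s) (sq_y s) rho) (z b0).
Proof.
move=> hk; have W : inC n (Wd n).
  by apply: Wd_of_kappa0 => p th hx hy; apply: hk; rewrite hx hy; exact: pt_dom.
have [|rho [rho0 [rho1 H]]] := solutions_exist.
  by move=> Q; apply: (ffree_inC_top d1M d2M d12 n_gt0 a_unit ad_unit W).
exists rho; split=> //; split=> //.
have [z hz] := boolp.choice (fun b0 : T => H (fun b => if b == b0 then 1 else 0)).
by exists z; split=> [b0 b|b0]; have [h1 h2] := hz b0; [exact: h1 | exact: h2].
Qed.
End WebTheory.

(** * The two implications for real functions *)

Section Interface.
Variables (d : nat) (D : R * R -> Prop) (om : nat -> one_form)
  (a : nat -> R -> R -> R) (gam : one_form).
Hypothesis hd : (3 <= d)%coq_nat.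
Hypothesis hweb : is_web d D om.
Hypothesis hnorm : is_normalized d D om a.
Hypothesis hgam : is_chern_connection D om gam.
Local Notation n := (d - 2)%coq_nat.
Local Notation N := (Nat.div ((d - 1) * (d - 2))%coq_nat 2).

Definition combination (K : nat) (c : nat -> R) (u : nat -> nat -> R -> R -> R) (i : nat) (x y : R) :=
  rsum K (fun j => Rmult (c j) (u j i x y)).

Lemma kappa_zero_of_solutions s (Hs : forall p, dom s p -> D p) (u : nat -> nat -> R -> R -> R) :
  (forall j, (j < N)%coq_nat -> solves_on d om a gam s (u j)) ->
  (forall rho c, Rlt 0 rho -> Rle rho (sq_r s) ->
     (forall i x y, (i < n)%coq_nat -> sq (sq_x s) (sq_y s) rho (x, y) ->
        combination N c u i x y = 0) -> forall j, (j < N)%coq_nat -> c j = 0) ->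
  exists rho, Rlt 0 rho /\ forall th, sq (sq_x s) (sq_y s) rho (jet_x th, jet_y th) ->
      prolongation d om a gam n th -> jet_fun n (kappa d om a gam) th = 0.
Proof.
rewrite -card_fidx => su ind.
have [|rho c rho0 rho1 h j /ltP|rho [rho0 [_ H]]] := @kappa0_of_rank d D om a gam hd hweb hnorm hgam s Hs
   (fun j i => sof s (u j i)).
- by move=> j /ltP jN; apply: (solves_of_solves_on hd hweb hnorm hgam Hs); apply: su.
- apply: (ind rho c) => // i x y /ltP ni hxy.
  have hp : dom s (x, y) by exact: sq_le rho1 hxy.
  have := h i (Point hp) ni hxy; rewrite evalp_comb //= => k /ltP kN.
  by have [h1 _] := su k kN; apply: h1; apply/ltP.
- by exists rho.
Qed.

(** The rank is that of germs, so independence and spanning are asserted on every smaller square and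
    not only on the one where the solutions are constructed. *)
Lemma solutions_of_kappa_zero x0 y0 r (r0 : Rlt 0 r) :
  (forall p, sq x0 y0 r p -> D p) ->
  (forall th, sq x0 y0 r (jet_x th, jet_y th) -> prolongation d om a gam n th ->
     jet_fun n (kappa d om a gam) th = 0) ->
  exists rho (rho0 : Rlt 0 rho), Rle rho r /\ exists u : nat -> nat -> R -> R -> R,
  (forall j, (j < N)%coq_nat -> solves_on d om a gam (Square x0 y0 rho rho0) (u j)) /\
  forall rho' (rho0' : Rlt 0 rho'), Rle rho' rho ->
  (forall c, (forall i x y, (i < n)%coq_nat -> sq x0 y0 rho' (x, y) ->
     combination N c u i x y = 0) -> forall j, (j < N)%coq_nat -> c j = 0) /\
  (forall v, solves_on d om a gam (Square x0 y0 rho' rho0') v ->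
     exists c rho1, Rlt 0 rho1 /\ forall i x y, (i < n)%coq_nat ->
       sq x0 y0 rho1 (x, y) -> v i x y = combination N c u i x y).
Proof.
move=> hD hk; rewrite -card_fidx.
have [rho [rho0 [rho1 [z [z0 zf]]]]] :=
  @frames_of_kappa0 d D om a gam hd hweb hnorm hgam (Square x0 y0 r r0) hD hk.
exists rho, rho0; split=> //; exists (frame_sol hd z); split=> [j _|rho' rho0' le].
  by apply: frame_solves; exact: zf.
have zf' b0 : frame_on om a gam hd (dom (Square x0 y0 rho' rho0')) (z b0).
  by apply: frame_on_sub (zf b0) => p; exact: sq_le.
have hD' p : dom (Square x0 y0 rho' rho0') p -> D p.
  by move=> h; apply: hD; apply: sq_le h; exact: Rle_trans le rho1.
split=> [c h j /ltP jN|v hv].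
  apply: (frame_sol_free hweb hD' _ zf' _ jN) => // i x y /ltP ni hxy; exact: h.
have [c [rh [rh0 [_ H]]]] := frame_sol_span hweb hnorm hgam hD' z0 zf' hv.
by exists c, rh; split=> // i x y /ltP ni hxy; exact: H.
Qed.
End Interface.

End Web.

(** * Germs of solutions and the rank *)

Lemma lam_of_comb d a K c u l x y :
  rsum K (fun j => c j * lam_of d a (u j) l x y)
  = lam_of d a (Web.combination K c u) l x y.
Proof.
  destruct l as [|[|[|l]]]; cbn [lam_of]; unfold Web.combination.
  - apply rsum_0; intros; ring.
  - rewrite (rsum_ext (d - 2) _ (fun i => rsum K (fun j => c j * (a (S i) x y * u j i x y)))).
    + rewrite rsum_swap. apply rsum_ext; intros j _. now rewrite rsum_scal.
    + intros i _. rewrite <- rsum_scal. apply rsum_ext; intros j _. ring.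
  - rewrite rsum_swap. apply rsum_ext; intros j _. now rewrite rsum_scal.
  - reflexivity.
Qed.

Lemma lam_of_ext d a u v l x y : (l <= d)%nat ->
  (forall i, (i < d - 2)%nat -> u i x y = v i x y) -> lam_of d a u l x y = lam_of d a v l x y.
Proof.
  intros Hl H. destruct l as [|[|[|l]]]; cbn [lam_of]; [reflexivity | | | apply H; lia].
  - apply rsum_ext; intros i Hi. now rewrite H.
  - now apply rsum_ext.
Qed.

Lemma lam_of_0 d a u l x y : (l <= d)%nat ->
  (forall i, (i < d - 2)%nat -> u i x y = 0) -> lam_of d a u l x y = 0.
Proof.
  intros Hl H. destruct l as [|[|[|l]]]; cbn [lam_of]; [reflexivity | | | apply H; lia];
    apply rsum_0; intros i Hi; rewrite H by exact Hi; ring.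
Qed.

Lemma locally_2d_sq P x0 y0 :
  locally_2d P x0 y0 <-> exists r, 0 < r /\ forall x y, sq x0 y0 r (x, y) -> P x y.
Proof.
  split.
  - intros [r H]. exists r. split; [apply cond_pos|]. intros x y [Hx Hy]. now apply H.
  - intros [r [Hr H]]. exists (mkposreal r Hr). intros x y Hx Hy. now apply H.
Qed.

Lemma common_square K (P : nat -> R -> R -> Prop) x0 y0 :
  (forall j, (j < K)%nat -> locally_2d (P j) x0 y0) ->
  exists r, 0 < r /\ forall j x y, (j < K)%nat -> sq x0 y0 r (x, y) -> P j x y.
Proof.
  induction K as [|K IH]; intros H.
  - exists 1. split; [lra|]. intros; lia.
  - destruct IH as [r1 [Hr1 H1]]; [intros j Hj; apply H; lia|].
    destruct (proj1 (locally_2d_sq _ _ _) (H K ltac:(lia))) as [r2 [Hr2 H2]].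
    exists (Rmin r1 r2). split; [now apply Rmin_glb_lt|]. intros j x y Hj Hxy.
    destruct (Nat.eq_dec j K) as [->|Hne].
    + apply H2. now apply (sq_le _ _ (Rmin r1 r2)); [apply Rmin_r|].
    + apply H1; [lia|]. now apply (sq_le _ _ (Rmin r1 r2)); [apply Rmin_l|].
Qed.

Theorem theorem1 (d : nat) (D : R * R -> Prop) (om : nat -> one_form)
    (a : nat -> R -> R -> R) (gam : one_form) (x0 y0 : R)
    (hd : (3 <= d)%nat)
    (hD : open D) (h0 : D (x0, y0))
    (hweb : is_web d D om)
    (hnorm : is_normalized d D om a)
    (hgam : is_chern_connection D om gam) :
  has_rank d om x0 y0 ((d - 1) * (d - 2) / 2)
  <->
  locally_2d (fun x y =>
    forall th : jet, jet_x th = x -> jet_y th = y ->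
      prolongation d om a gam (d - 2) th ->
      jet_fun (d - 2) (kappa d om a gam) th = 0) x0 y0.
Proof.
  set (N := ((d - 1) * (d - 2) / 2)%nat).
  assert (LD := proj1 (locally_2d_sq _ _ _) (open_locally_2d D x0 y0 hD h0)).
  destruct LD as [rD [HrD LD]].
  split.
  - intros [s [Hs [ind _]]].
    destruct (common_square N (fun j x y =>
      (forall i, (1 <= i <= d)%nat -> smooth_at (s (S j) i) x y) /\
      sum_n_m (fun i => s (S j) i x y * dx_coef (om i) x y) 1 d = 0 /\
      sum_n_m (fun i => s (S j) i x y * dy_coef (om i) x y) 1 d = 0 /\
      (forall i, (1 <= i <= d)%nat -> d_form (form_scale (s (S j) i) (om i)) x y = 0)) x0 y0)
      as [r [Hr HS]].
    { intros j Hj. apply (Hs (S j)). lia. }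
    assert (Hrho : 0 < Rmin r rD) by now apply Rmin_glb_lt.
    set (sq1 := Square x0 y0 (Rmin r rD) Hrho).
    assert (Hsq1 : forall p, dom sq1 p -> D p).
    { intros [x y] H. apply LD. now apply (sq_le _ _ (Rmin r rD)); [apply Rmin_r|]. }
    assert (Hab := fun j Hj => solves_of_abelian d D om a gam hd hweb hnorm hgam sq1 Hsq1 (s (S j))
      (fun x y Hxy => HS j x y Hj (sq_le _ _ _ _ _ (Rmin_l r rD) Hxy))).
    destruct (@Web.kappa_zero_of_solutions d D om a gam hd hweb hnorm hgam sq1 Hsq1
      (fun j i => s (S j) (i + 3)%nat)) as [rho [Hrho' HK]].
    + intros j Hj. apply (Hab j Hj).
    + intros rho c Hr0 Hr1 Hc j Hj. change (j < N)%nat in Hj.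
      apply (ind (fun j => c (pred j))) with (j := S j); [|lia].
      apply locally_2d_sq. exists rho. split; [exact Hr0|]. intros x y Hxy l Hl.
      rewrite sum_n_m_rsum. cbn [pred].
      assert (Hxy1 : dom sq1 (x, y)) by now apply (sq_le _ _ rho).
      rewrite (rsum_ext N _ (fun j => c j * lam_of d a ((fun j i => s (S j) (i + 3)%nat) j) l x y)).
      2:{ intros k Hk. now rewrite (proj2 (Hab k Hk) l x y Hl Hxy1). }
      rewrite lam_of_comb. apply lam_of_0; [lia|]. intros i Hi. now apply Hc.
    + apply locally_2d_sq. exists rho. split; [exact Hrho'|]. intros x y Hxy th Hx Hy.
      apply HK. simpl. now rewrite Hx, Hy.
  - intros HK. apply locally_2d_sq in HK. destruct HK as [r [Hr HK]].
    assert (Hr' : 0 < Rmin r rD) by now apply Rmin_glb_lt.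
    destruct (@Web.solutions_of_kappa_zero d D om a gam hd hweb hnorm hgam x0 y0 (Rmin r rD) Hr')
      as [rho [rho0 [Hle [u [Hu Hind]]]]].
    { intros [x y] H. apply LD. now apply (sq_le _ _ (Rmin r rD)); [apply Rmin_r|]. }
    { intros th H. apply (HK (jet_x th) (jet_y th)); [|reflexivity|reflexivity].
      now apply (sq_le _ _ (Rmin r rD)); [apply Rmin_l|]. }
    change (forall j, (j < N)%nat -> solves_on d om a gam (Square x0 y0 rho rho0) (u j)) in Hu.
    change (forall rho' (rho0' : 0 < rho'), rho' <= rho ->
      (forall c, (forall i x y, (i < d - 2)%nat -> sq x0 y0 rho' (x, y) ->
        Web.combination N c u i x y = 0) -> forall j, (j < N)%nat -> c j = 0) /\
      (forall v, solves_on d om a gam (Square x0 y0 rho' rho0') v ->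
        exists c rho1, 0 < rho1 /\ forall i x y, (i < d - 2)%nat ->
          sq x0 y0 rho1 (x, y) -> v i x y = Web.combination N c u i x y)) in Hind.
    assert (HD : forall rho', rho' <= rho -> forall p, sq x0 y0 rho' p -> D p).
    { intros rho' H [x y] Hxy. apply LD. apply (sq_le _ _ rho'); [|exact Hxy].
      apply Rle_trans with (1 := H). apply Rle_trans with (1 := Hle). apply Rmin_r. }
    (* [has_rank] numbers the basis from 1, the construction from 0. *)
    exists (fun j => lam_of d a (u (pred j))). split; [|split].
    + intros j Hj.
      apply (abelian_of_solves d D om a gam hd hweb hnorm hgam (Square x0 y0 rho rho0)).
      * apply HD. apply Rle_refl.
      * apply Hu. fold N in Hj. lia.
    + intros c Hc. apply locally_2d_sq in Hc. destruct Hc as [r1 [Hr1 Hc]].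
      assert (Hm : 0 < Rmin r1 rho) by now apply Rmin_glb_lt.
      destruct (Hind (Rmin r1 rho) Hm (Rmin_r _ _)) as [HI _].
      intros j Hj. fold N in Hj.
      enough (HE : forall j, (j < N)%nat -> c (S j) = 0).
      { specialize (HE (pred j) ltac:(lia)). now replace (S (pred j)) with j in HE by lia. }
      apply HI. intros i x y Hi Hxy.
      (* The components of [lam_of] from index 3 on are the unknowns themselves, so a vanishing
         combination of families is one of the [u j]. *)
      specialize (Hc x y (sq_le _ _ _ _ _ (Rmin_l _ _) Hxy) (S (S (S i))) ltac:(lia)).
      fold N in Hc. rewrite sum_n_m_rsum in Hc. exact Hc.
    + intros lam Hlam. apply locally_2d_sq in Hlam. destruct Hlam as [r1 [Hr1 Hlam]].
      assert (Hm : 0 < Rmin r1 rho) by now apply Rmin_glb_lt.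
      destruct (Hind (Rmin r1 rho) Hm (Rmin_r _ _)) as [_ HSp].
      destruct (solves_of_abelian d D om a gam hd hweb hnorm hgam (Square x0 y0 (Rmin r1 rho) Hm)
        (HD _ (Rmin_r _ _)) lam
        (fun x y Hxy => Hlam x y (sq_le _ _ _ _ _ (Rmin_l r1 rho) Hxy))) as [Hv HE].
      destruct (HSp _ Hv) as [c [rho1 [Hrho1 Hc]]].
      exists (fun j => c (pred j)). apply locally_2d_sq.
      exists (Rmin rho1 (Rmin r1 rho)). split; [now apply Rmin_glb_lt|].
      intros x y Hxy l Hl. fold N. rewrite sum_n_m_rsum. cbn [pred].
      rewrite lam_of_comb, (HE l x y Hl).
      * apply lam_of_ext; [lia|]. intros i Hi.
        apply Hc; [exact Hi|]. now apply (sq_le _ _ (Rmin rho1 (Rmin r1 rho))); [apply Rmin_l|].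
      * now apply (sq_le _ _ (Rmin rho1 (Rmin r1 rho))); [apply Rmin_r|].
Qed.
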